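(* Let $d_0,d_\infty\ge2$, $d=d_0+d_\infty-1$, let $\theta\in(0,1)$ be an irrational number of bounded type, and let $f_\theta\in\mathcal X_{d_0,d_\infty,\theta}$ be a unicritical map, i.e. with $z=1$ as its unique critical point other than $0,\infty$, with Herman quasicircle $\mathbf H$. For $j\in\mathbb Z$ let $c_j=(f_\theta|_{\mathbf H})^j(1)$. Let $$f_\theta^{q_n}:(U_n,c_0)\to(V_n,c_{q_n}),\qquad n\in\mathbb N,$$ be degree $d$ branched coverings between pointed disks with bounded shape and with diameters comparable to $|c_0-c_{q_n}|$, all bounds being independent of $n$ (and depending only on $d_0,d_\infty,\beta(\theta)$). Let $A_n(z)=(z-c_0)/(c_{q_n}-c_0)$. Then the sequence of rescaled first return maps $$A_n\circ f_\theta^{q_n}\circ A_n^{-1}:(A_n(U_n),0)\to(A_n(V_n),1)$$ is precompact in the Carathéodory topology. Moreover, all limit maps are degree $d$ covering maps branched only at $0$.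
   Context: For $\theta=[0;a_1,a_2,\dots]$ put $\beta(\theta)=\max_ia_i$; bounded type means $\beta(\theta)<\infty$. $p_n/q_n$ are the best rational approximations of $\theta$: $q_n=a_nq_{n-1}+q_{n-2}$, $q_{-1}=0$, $q_0=1$ (and similarly $p_n$). $\mathcal X_{d_0,d_\infty,\theta}$ is the space of degree $d_0+d_\infty-1$ rational maps $f$ such that: (i) $0$ and $\infty$ are superattracting fixed points of local degrees $d_0$ and $d_\infty$; (ii) $f$ has a Herman quasicircle $\mathbf H$ of rotation number $\theta$, i.e. a forward invariant quasicircle, not contained in the closure of any rotation domain (Siegel disk or Herman ring), on which $f$ is conjugate to the rotation $z\mapsto e^{2\pi i\theta}z$ of the unit circle; (iii) $\mathbf H$ separates $0$ and $\infty$; (iv) every critical point of $f$ other than $0,\infty$ lies on $\mathbf H$. A pointed disk $(U,x)$ has bounded shape if the inner radius $\sup\{r:\mathbb D(x,r)\subset U\}$ and outer radius $\inf\{r:U\subset\mathbb D(x,r)\}$ are comparable, i.e. their ratio is bounded by a fixed constant. Coverings $f_\theta^{q_n}:(U_n,c_0)\to(V_n,c_{q_n})$ with the properties listed in the claim exist for every $n$, with all bounds depending only on $d_0,d_\infty,\beta(\theta)$. Carathéodory topology: $(U_n,u_n)\to(U,u)$ if $u_n\to u$, every compact subset of $U$ lies in $U_n$ for all large $n$, and every connected open set containing $u$ and contained in $U_n$ for infinitely many $n$ lies in $U$. A sequence of maps $g_n:(U_n,u_n)\to(V_n,v_n)$ converges to $g:(U,u)\to(V,v)$ if the pointed domains and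 pointed ranges converge and $g_n\to g$ uniformly on compact subsets of $U$. Precompact means every subsequence has a further convergent subsequence. *)

(* Defs.v *)
From HB Require Import structures.
From mathcomp Require Import all_boot all_order all_algebra.
From mathcomp Require Import complex.
From mathcomp Require Import all_classical all_reals all_analysis.

Set Implicit Arguments.
Unset Strict Implicit.
Unset Printing Implicit Defensive.

Import Order.TTheory GRing.Theory Num.Theory.
Import numFieldNormedType.Exports.

Local Open Scope classical_set_scope.
Local Open Scope ring_scope.

(* R[i] has no topology of its own; as a numClosedFieldType it gets the norm
   topology. *)
Definition cplx (R : realType) : numClosedFieldType := R[i].

(* Some z is the point z of the plane and None is the point at infinity. *)
Definition sphere (R : realType) := one_point_compactification (cplx R).

Section Plane.
Variable R : realType.
Local Notation C := (cplx R).

Definition modulus (z : C) : R := ComplexField.Normc.normc z.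

Definition disc (x : C) (r : R) : set C := [set z | modulus (z - x) < r].

Definition unit_disc : set C := disc 0 1.

Definition unit_circle : set C := [set z | modulus z = 1].

Definition rot (t : R) : C :=
  (cos (2 * pi * t) +i* sin (2 * pi * t))%C.

Definition finite_part (z : sphere R) : C := if z is Some w then w else 0.

Definition sphere_inv (z : sphere R) : sphere R :=
  if z is Some w then (if w == 0 then None else Some w^-1) else Some 0.

Definition chordal (z w : sphere R) : R :=
  match z, w with
  | Some a, Some b =>
      2 * modulus (a - b) /
      (Num.sqrt (1 + modulus a ^+ 2) * Num.sqrt (1 + modulus b ^+ 2))
  | Some a, None | None, Some a => 2 / Num.sqrt (1 + modulus a ^+ 2)
  | None, None => 0
  end.

Definition homeo_onto (A B : set C) (h : C -> C) : Prop :=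
  exists k : C -> C,
    [/\ {within A, continuous h}, {within B, continuous k},
        h @` A `<=` B & k @` B `<=` A] /\
    (forall z, A z -> k (h z) = z) /\ (forall w, B w -> h (k w) = w).

(* Metric definition of quasiconformality (orientation is not constrained, which
   does not affect the class of quasicircles): the linear dilatation
   limsup_(r -> 0) max_(|y - x| = r) |phi y - phi x|
                   / min_(|y - x| = r) |phi y - phi x|
   is bounded uniformly in x. *)
Definition quasiconformal (phi : C -> C) : Prop :=
  homeo_onto setT setT phi /\
  exists K : R, forall x : C, \forall r \near 0^'+,
    forall y y' : C, modulus (y - x) = r -> modulus (y' - x) = r ->
      modulus (phi y - phi x) <= K * modulus (phi y' - phi x).

Definition quasicircle (H : set C) : Prop :=
  exists2 phi, quasiconformal phi & H = phi @` unit_circle.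

End Plane.

Section ContinuedFraction.
Variable R : realType.

Fixpoint gauss_orbit (t : R) (n : nat) : R :=
  if n is n'.+1 then
    let x := (gauss_orbit t n')^-1 in x - (Num.truncn x)%:R
  else t.

(* For t = [0; a_1, a_2, ...] in (0, 1), partial_quotient t i is a_(i+1). *)
Definition partial_quotient (t : R) (i : nat) : nat :=
  Num.truncn (gauss_orbit t i)^-1.

Definition bounded_type (t : R) : Prop :=
  exists B : nat, forall i, (partial_quotient t i <= B)%N.

(* The pair (q_(n-1), q_n). *)
Fixpoint cf_denom_pair (t : R) (n : nat) : nat * nat :=
  if n is n'.+1 then
    let p := cf_denom_pair t n' in
    (p.2, partial_quotient t n' * p.2 + p.1)%N
  else (0, 1)%N.

Definition cf_denom (t : R) (n : nat) : nat := (cf_denom_pair t n).2.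

End ContinuedFraction.

Record ratmap (R : realType) := Ratmap {
  rnum : {poly cplx R};
  rden : {poly cplx R};
  rcoprime : coprimep rnum rden
}.

Section RationalMaps.
Variable R : realType.
Local Notation C := (cplx R).
Implicit Type f : ratmap R.

Definition rdeg f : nat := (maxn (size (rnum f)) (size (rden f))).-1.

Definition reval f (z : sphere R) : sphere R :=
  match z with
  | Some a => if (rden f).[a] == 0 then None
              else Some ((rnum f).[a] / (rden f).[a])
  | None => if (rden f)`_(rdeg f) == 0 then None
            else Some ((rnum f)`_(rdeg f) / (rden f)`_(rdeg f))
  end.

(* The multiplicity of z as a solution of f = f(z).  The solutions of f = w in
   the plane are the roots of rnum f - w *: rden f (of rden f if w is
   infinity), and the remaining ones among the rdeg f solutions are at
   infinity. *)
Definition local_degree f (z : sphere R) : nat :=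
  let eqn := if reval f z is Some w then rnum f - w *: rden f else rden f in
  if z is Some a then mup a eqn else (rdeg f - (size eqn).-1)%N.

Definition critical f (z : sphere R) : Prop := (1 < local_degree f z)%N.

(* The largest open set on which the iterates of f are equicontinuous for the
   chordal metric. *)
Definition fatou f : set (sphere R) := [set x |
  exists W : set (sphere R), [/\ open W, W x &
    forall y, W y -> forall e : R, 0 < e -> \forall z \near y,
      forall n, chordal (iter n (reval f) z) (iter n (reval f) y) < e]].

Definition fatou_component f (U : set (sphere R)) : Prop :=
  exists2 x, fatou f x & U = connected_component (fatou f) x.

(* Complex differentiability in one of the two standard charts. *)
Definition sphere_derivable (psi : C -> sphere R) (z : C) : Prop :=
  exists g : C -> C, derivable g z 1 /\
    ((\forall w \near z, psi w = Some (g w)) \/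
     (\forall w \near z, psi w = sphere_inv (Some (g w)))).

Definition rotation_model (M : set C) : Prop :=
  M = @unit_disc R \/
  exists r : R, 0 < r < 1 /\ M = [set z | r < modulus z < 1].

(* A Siegel disk or a Herman ring, of period dividing p. *)
Definition rotation_domain f (U : set (sphere R)) : Prop :=
  fatou_component f U /\
  exists (p : nat) (M : set C) (psi : C -> sphere R) (alpha : R),
    [/\ (0 < p)%N, rotation_model M & irrational alpha] /\
    [/\ forall z, M z -> sphere_derivable psi z,
        set_bij M U psi &
        forall z, M z ->
          iter p (reval f) (psi z) = psi (rot alpha * z)].

Definition conj_to_rotation f (H : set C) (theta : R) : Prop :=
  exists2 h : C -> C, homeo_onto (@unit_circle R) H h &
    forall z, unit_circle z ->
      reval f (Some (h z)) = Some (h (rot theta * z)).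

Definition herman_quasicircle f (H : set C) (theta : R) : Prop :=
  [/\ quasicircle H,
      forall z, H z -> exists2 w, H w & reval f (Some z) = Some w,
      forall U, rotation_domain f U ->
        ~ ((Some @` H : set (sphere R)) `<=` closure U) &
      conj_to_rotation f H theta].

Definition separates_0_infty (H : set C) : Prop :=
  ~ H 0 /\
  ~ connected_component (~` (Some @` H) : set (sphere R)) (Some 0) None.

(* f belongs to the space X_(d0, dinf, theta), with Herman quasicircle H. *)
Definition in_X (d0 dinf : nat) (theta : R) f (H : set C) : Prop :=
  [/\ rdeg f = (d0 + dinf - 1)%N,
      [/\ reval f (Some 0) = Some 0, local_degree f (Some 0) = d0,
          reval f None = None & local_degree f None = dinf],
      herman_quasicircle f H theta,
      separates_0_infty H &
      forall z : sphere R, critical f z -> z <> Some 0 -> z <> None ->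
        exists2 w, H w & z = Some w].

Definition unicritical f : Prop :=
  forall z : sphere R, z <> Some 0 -> z <> None ->
    (critical f z <-> z = Some 1).

(* Since f is injective on H, this says that c j = (f|_H)^j (x). *)
Definition orbit_on f (H : set C) (x : C) (c : int -> C) : Prop :=
  [/\ c 0 = x, forall j, H (c j) &
      forall j, reval f (Some (c j)) = Some (c (j + 1))].

End RationalMaps.

Section PointedDisks.
Variable R : realType.
Local Notation C := (cplx R).

Definition pointed_disk (U : set C) (x : C) : Prop :=
  [/\ open U, exists h, homeo_onto (@unit_disc R) U h & U x].

Local Open Scope ereal_scope.

(* Extended reals, so that the outer radius and the diameter of an unbounded
   set are +oo. *)
Definition inner_radius (U : set C) (x : C) : \bar R :=
  ereal_sup [set r%:E | r in [set r : R | disc x r `<=` U]].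

Definition outer_radius (U : set C) (x : C) : \bar R :=
  ereal_inf [set r%:E | r in [set r : R | U `<=` disc x r]].

Definition bounded_shape (K : R) (U : set C) (x : C) : Prop :=
  outer_radius U x <= K%:E * inner_radius U x.

Definition diameter (U : set C) : \bar R :=
  ereal_sup [set (modulus (p.1 - p.2))%:E | p in U `*` U].

Definition diameter_comparable (K : R) (U : set C) (delta : R) : Prop :=
  diameter U <= K%:E * delta%:E /\ delta%:E <= K%:E * diameter U.

Local Close Scope ereal_scope.

(* g - g(x) vanishes to order exactly k at x. *)
Definition holo_degree (g : C -> C) (x : C) (k : nat) : Prop :=
  exists h : C -> C,
    [/\ \forall z \near x, derivable h z 1, h x != 0 &
        \forall z \near x, g z - g x = (z - x) ^+ k * h z].

(* Proper holomorphic map U -> V all of whose fibres have d points counted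
   with multiplicity. *)
Definition branched_cover (d : nat) (U V : set C) (g : C -> C) : Prop :=
  [/\ forall z, U z -> derivable g z 1,
      forall z, U z -> V (g z),
      forall K, compact K -> K `<=` V -> compact (U `&` g @^-1` K) &
      forall v, V v -> exists (s : seq C) (m : C -> nat),
        [/\ uniq s, forall x, x \in s <-> U x /\ g x = v,
            forall x, x \in s -> holo_degree g x (m x) &
            (\sum_(x <- s) m x)%N = d]].

Definition branched_only_at (U : set C) (g : C -> C) (x0 : C) : Prop :=
  forall x, U x ->
    ((exists2 k, (1 < k)%N & holo_degree g x k) <-> x = x0).

End PointedDisks.

(* Data of a map pfun : (pdom, pbase) -> (pran, ptgt); the values of pfun
   outside pdom are irrelevant. *)
Record pmap (R : realType) := PMap {
  pdom : set (cplx R);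
  pbase : cplx R;
  pran : set (cplx R);
  ptgt : cplx R;
  pfun : cplx R -> cplx R
}.

Section Caratheodory.
Variable R : realType.
Local Notation C := (cplx R).

Definition is_pmap (g : pmap R) : Prop :=
  [/\ pointed_disk (pdom g) (pbase g), pointed_disk (pran g) (ptgt g),
      forall z, pdom g z -> pran g (pfun g z) &
      pfun g (pbase g) = ptgt g].

Definition cara_cvg (Un : nat -> set C) (un : nat -> C)
    (U : set C) (u : C) : Prop :=
  [/\ un n @[n --> \oo] --> u,
      forall K, compact K -> K `<=` U -> \forall n \near \oo, K `<=` Un n &
      forall W, open W -> connected W -> W u ->
        (forall N, exists2 n, (N <= n)%N & W `<=` Un n) -> W `<=` U].

Definition pmap_cvg (G : nat -> pmap R) (g : pmap R) : Prop :=
  [/\ cara_cvg (fun n => pdom (G n)) (fun n => pbase (G n))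
               (pdom g) (pbase g),
      cara_cvg (fun n => pran (G n)) (fun n => ptgt (G n))
               (pran g) (ptgt g) &
      forall K, compact K -> K `<=` pdom g ->
        {uniform K, (fun n => pfun (G n)) @ \oo --> pfun g}].

Definition increasing (s : nat -> nat) : Prop :=
  {homo s : m n / (m < n)%N}.

(* Limits are taken in the space of maps between pointed disks. *)
Definition limit_map (G : nat -> pmap R) (g : pmap R) : Prop :=
  is_pmap g /\ exists2 s, increasing s & pmap_cvg (G \o s) g.

Definition cara_precompact (G : nat -> pmap R) : Prop :=
  forall s, increasing s ->
    exists t g, [/\ increasing t, is_pmap g & pmap_cvg (G \o s \o t) g].

Definition affine_norm (a b z : C) : C := (z - a) / (b - a).

Definition affine_norm_inv (a b w : C) : C := a + (b - a) * w.

(* A \o F \o A^-1 : (A(U), 0) -> (A(V), 1), where A = affine_norm a b maps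
   a to 0 and b to 1. *)
Definition rescaled (a b : C) (U V : set C) (F : C -> C) : pmap R :=
  PMap (affine_norm a b @` U) 0 (affine_norm a b @` V) 1
       (affine_norm a b \o F \o affine_norm_inv a b).

End Caratheodory.

(* Main.v *)
Require Import Defs.
From HB Require Import structures.
From mathcomp Require Import all_boot all_order all_algebra.
From mathcomp Require Import complex.
From mathcomp Require Import all_classical all_reals all_analysis.
From mathcomp Require Import separable cyclotomic.
From mathcomp Require Import zify ring lra.

Set Implicit Arguments.
Unset Strict Implicit.
Unset Printing Implicit Defensive.

Import Order.TTheory GRing.Theory Num.Theory.
Import numFieldNormedType.Exports.

Local Open Scope classical_set_scope.
Local Open Scope ring_scope.

(* Near the critical point 1 the map f has local degree d (the Wronskian of
   numerator and denominator has degree 2d - dinf - 1 and only the roots 0, of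
   multiplicity d0 - 1, and 1), so f^(q_n) - c_(q_n) vanishes to order at least d
   at c_0, and c_0 is the whole fibre of c_(q_n).  With Riemann maps phi_n of U_n
   and psi_n of V_n, the map psi_n^-1 o f^(q_n) o phi_n is a proper self-map of the
   unit disc whose only zero is a d-fold one at 0; by the maximum principle it
   is z -> z^d up to a rotation, which can be absorbed in psi_n.  After rescaling
   the two families of Riemann maps are normal, with univalent limits phi and
   psi, and psi o (z -> z^d) o phi^-1 is the limit of the return maps.

   The complex analysis rests on Goursat's bisection for midpoint Riemann sums.
   Applied to f(c + exp(2 pi z)) it shows that the means of a holomorphic f over
   concentric circles agree asymptotically; their limit along an ultrafilter
   replaces the integral in Cauchy's formula. *)

(** The limit in [limit_map] is an arbitrary map between pointed disks, not one built from Riemann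
    maps; it is identified with such a one by extracting a further subsequence and using uniqueness
    of Carathéodory limits. Hence everything runs on one class of maps, psi o (z -> z^d) o phi^-1,
    which passes to limits and shows degree and branching.

    A pointed disk comes only with a homeomorphism to the unit disc. Simple connectedness enters
    through one consequence, that nowhere vanishing continuous functions have continuous square
    roots, which is what Koebe's proof of the Riemann mapping theorem consumes.

    The order of f^(q_n) at c_0 is only bounded below along the orbit; the upper bound is the degree
    d of the covering, so the other points of the orbit matter only through a Lipschitz bound.

    Normality needs the rescaled disks to lie between two fixed concentric discs: bounded shape and
    comparable diameter give the radii 1/(4K^2) and K + 1. Limits of Riemann maps are taken along an
    ultrafilter, where bounded families converge at once, and a subsequence is extracted only at the
    end. *)

Local Notation "`‖ z ‖" := (modulus z) (at level 0, z at level 99, format "`‖ z ‖").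

(** * Limits and derivatives over a closed field *)

Section ClosedFieldTopology.
Variable K : numClosedFieldType.
Implicit Types (f g : K -> K) (z a b : K).

Lemma cvgM_closed (T : Type) (F : set_system T) {FF : Filter F} (f g : T -> K) a b :
  f @ F --> a -> g @ F --> b -> (fun x => f x * g x) @ F --> a * b.
Proof. exact: (@cvgM K T F _ f g a b). Qed.

Lemma cvgD_closed (T : Type) (F : set_system T) {FF : Filter F} (f g : T -> K) a b :
  f @ F --> a -> g @ F --> b -> (fun x => f x + g x) @ F --> a + b.
Proof. exact: (@cvgD K K T F _ f g a b). Qed.

Lemma cvgV_closed (T : Type) (F : set_system T) {FF : Filter F} (f : T -> K) a :
  a != 0 -> f @ F --> a -> (fun x => (f x)^-1) @ F --> a^-1.
Proof. exact: (@cvgV K T F _ f a). Qed.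

Lemma cvg_unique_closed (T : Type) (F : set_system T) {FF : ProperFilter F} (f : T -> K) a b :
  f @ F --> a -> f @ F --> b -> a = b.
Proof. by apply: cvg_unique; apply: norm_hausdorff. Qed.

Lemma derivableD_closed f g z : derivable f z 1 -> derivable g z 1 ->
  derivable (fun w => f w + g w) z 1.
Proof. exact: (@derivableD K K K f g z 1). Qed.

Lemma derivableM_closed f g z : derivable f z 1 -> derivable g z 1 ->
  derivable (fun w => f w * g w) z 1.
Proof. exact: (@derivableM K K f g z 1). Qed.

Lemma derivableV_closed f z : f z != 0 -> derivable f z 1 ->
  derivable (fun w => (f w)^-1) z 1.
Proof. exact: (@derivableV K K f z 1). Qed.

Lemma derivable_id_closed z : derivable (fun w : K => w) z 1.
Proof. exact: (@derivable_id K K z 1). Qed.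

Lemma derivable_cst_closed a z : derivable (fun w : K => a) z 1.
Proof. exact: (@derivable_cst K K K a z 1). Qed.

Lemma derivable_comp_closed f g z : derivable f z 1 -> derivable g (f z) 1 ->
  derivable (fun w => g (f w)) z 1.
Proof.
move=> /derivable1_diffP df /derivable1_diffP dg; apply/derivable1_diffP.
exact: (@differentiable_comp K K K K f g z).
Qed.

Lemma derivable_continuous_closed f z : derivable f z 1 -> {for z, continuous f}.
Proof. by move/derivable1_diffP/differentiable_continuous. Qed.

End ClosedFieldTopology.

(** * Epsilon-delta calculus with the real-valued modulus *)

Section Modulus.
Variable R : realType.
Local Notation C := (cplx R).
Implicit Types (z w l : C) (f g : C -> C).

Lemma modulusE z : `|z| = (`‖z‖)%:C%C :> C.
Proof. by []. Qed.

Lemma modulus_ge0 z : 0 <= `‖z‖.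
Proof. by case: z => a b; apply: sqrtr_ge0. Qed.

Lemma modulus0 : `‖(0 : C)‖ = 0.
Proof. exact: ComplexField.Normc.normc0. Qed.

Lemma modulus1 : `‖(1 : C)‖ = 1.
Proof. exact: ComplexField.Normc.normc1. Qed.

Lemma modulusM z w : `‖z * w‖ = `‖z‖ * `‖w‖.
Proof. exact: ComplexField.Normc.normcM. Qed.

Lemma modulusV z : `‖z^-1‖ = `‖z‖^-1.
Proof. exact: ComplexField.Normc.normcV. Qed.

Lemma modulusN z : `‖- z‖ = `‖z‖.
Proof. exact: (@normcN R z). Qed.

Lemma modulusX z n : `‖z ^+ n‖ = `‖z‖ ^+ n.
Proof. by elim: n => [|n IH]; rewrite ?expr0 ?modulus1 // !exprS modulusM IH. Qed.

Lemma modulusD z w : `‖z + w‖ <= `‖z‖ + `‖w‖.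
Proof. exact: (@le_normcD R z w). Qed.

Lemma modulusBC z w : `‖z - w‖ = `‖w - z‖.
Proof. by rewrite -modulusN opprB. Qed.

Lemma modulus_le_triangle z w t : `‖z - t‖ <= `‖z - w‖ + `‖w - t‖.
Proof. by rewrite (_ : z - t = (z - w) + (w - t)) ?modulusD //; ring. Qed.

Lemma modulus_dist z w : `‖z‖ - `‖w‖ <= `‖z - w‖.
Proof.
by have := modulusD (z - w) w; rewrite subrK; lra.
Qed.

Lemma modulus_eq0 z : (`‖z‖ == 0) = (z == 0).
Proof.
apply/eqP/eqP => [|->]; last exact: modulus0.
exact: ComplexField.Normc.eq0_normc.
Qed.

Lemma modulus_gt0 z : (0 < `‖z‖) = (z != 0).
Proof. by rewrite lt_def modulus_eq0 modulus_ge0 andbT. Qed.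

Lemma modulus_small_eq z w : (forall e : R, 0 < e -> `‖z - w‖ <= e) -> z = w.
Proof.
move=> zw; apply/eqP; rewrite -subr_eq0 -modulus_eq0 eq_le modulus_ge0 andbT.
by apply/ler_addgt0Pr => e e0; rewrite add0r; apply: zw.
Qed.

Lemma exists_pos_lt (s : seq R) : all (fun x => 0 < x) s ->
  exists2 t, 0 < t & all (fun x => t < x) s.
Proof.
elim: s => [|x s IH] /=; first by exists 1.
move=> /andP[x0 /IH[t t0 ts]]; have m0 : 0 < Num.min x t by rewrite lt_min x0.
have mx : Num.min x t <= x by rewrite ge_min lexx.
have mt : Num.min x t <= t by rewrite ge_min lexx orbT.
exists (Num.min x t / 2); first lra.
by apply/andP; split; [lra | apply: sub_all ts => y ty; lra].
Qed.

Lemma exists_pos_lt2 (a b : R) : 0 < a -> 0 < b -> exists t, [/\ 0 < t, t < a & t < b].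
Proof.
move=> a0 b0; have [|t t0 /and3P[? ? _]] := @exists_pos_lt [:: a; b]; last by exists t.
by rewrite /= a0 b0.
Qed.

Lemma near_inv_nat (e : R) : 0 < e -> \forall m \near \oo, m.+1%:R^-1 < e.
Proof.
move=> e0; exists (Num.bound e^-1) => // m /= nm.
rewrite invf_plt ?posrE ?ltr0n //; apply: lt_trans (archi_boundP _) _.
  by rewrite invr_ge0 ltW.
by rewrite ltr_nat ltnS.
Qed.

Lemma modulus_real (x : R) : `‖(x%:C%C : C)‖ = `|x|.
Proof. by rewrite /modulus /= expr0n addr0 sqrtr_sqr. Qed.

Lemma Re_le_modulus z : `|complex.Re z| <= `‖z‖.
Proof.
case: z => a b /=; rewrite /modulus /= -sqrtr_sqr.
by rewrite ler_sqrt ?lerDl ?sqr_ge0 // addr_ge0 ?sqr_ge0.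
Qed.

Lemma Im_le_modulus z : `|complex.Im z| <= `‖z‖.
Proof.
case: z => a b /=; rewrite /modulus /= -sqrtr_sqr.
by rewrite ler_sqrt ?lerDr ?sqr_ge0 // addr_ge0 ?sqr_ge0.
Qed.

Lemma modulus_le_ReIm (a b : R) : `‖((a +i* b)%C : C)‖ <= `|a| + `|b|.
Proof.
rewrite (_ : (a +i* b)%C = a%:C%C + (0 +i* 1)%C * b%:C%C :> C); last first.
  by apply/eqP; rewrite eq_complex /= !(mul0r, mulr0, mul1r, add0r, addr0, subr0) !eqxx.
apply: (le_trans (modulusD _ _)); rewrite modulusM !modulus_real.
by rewrite /modulus /= expr0n add0r expr1n sqrtr1 mul1r.
Qed.

Lemma ltr_modulusE z (e : R) : (`|z| < e%:C%C :> C) = (`‖z‖ < e).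
Proof. by rewrite modulusE; apply: ltcR. Qed.

(** The order of [C] makes every positive element real, so the radii of the norm topology, which
    live in [C], can be replaced by radii in [R]. *)
Lemma nbhs_discP z (A : set C) :
  nbhs z A <-> exists2 r : R, 0 < r & disc z r `<=` A.
Proof.
rewrite -nbhs_nbhs_norm; split=> [[e /= e0 eA]|[r r0 rA]].
  move: e0; rewrite ltcE /= => /andP[/eqP Ie Re0].
  exists (complex.Re e) => // w; rewrite /disc /= => wz; apply: eA => /=.
  rewrite distrC (_ : e = (complex.Re e)%:C%C) ?ltr_modulusE //.
  by case: e Ie {Re0 wz} => a b /= ->.
exists r%:C%C => /=; first by rewrite (ltcR 0).
by move=> w /=; rewrite distrC ltr_modulusE; apply: rA.
Qed.

Lemma nbhs_disc z (r : R) : 0 < r -> nbhs z (disc z r).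
Proof. by move=> r0; apply/nbhs_discP; exists r. Qed.

Lemma open_discP (A : set C) :
  open A <-> forall z, A z -> exists2 r : R, 0 < r & disc z r `<=` A.
Proof.
rewrite openE; split=> [oA z /oA|oA z Az]; first by move/nbhs_discP.
by apply/nbhs_discP; apply: oA.
Qed.

Definition tends (T : Type) (F : set_system T) (f : T -> C) l :=
  forall e : R, 0 < e -> \forall x \near F, `‖f x - l‖ < e.

Definition cts f z := forall e : R, 0 < e ->
  exists2 r : R, 0 < r & forall w, `‖w - z‖ < r -> `‖f w - f z‖ < e.

Lemma tendsP (T : Type) (F : set_system T) {FF : Filter F} (f : T -> C) l :
  f @ F --> l <-> tends F f l.
Proof.
split=> [fl e e0|fl A /nbhs_discP[r r0 rA]].
  exact: (fl _ (nbhs_disc l e0)).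
apply: filterS (fl r r0) => x; exact: rA.
Qed.

Lemma near_modulusP z (P : C -> Prop) :
  (\forall w \near z, P w) <->
  exists2 r : R, 0 < r & forall w, `‖w - z‖ < r -> P w.
Proof. exact: nbhs_discP. Qed.

Lemma tends_cts f z : tends (nbhs z) f (f z) <-> cts f z.
Proof. by split=> fz e /fz /near_modulusP. Qed.

Lemma ctsP f z : {for z, continuous f} <-> cts f z.
Proof.
split=> fz; first by apply/tends_cts; apply: (iffLR (@tendsP _ (nbhs z) _ f (f z))).
by apply: (iffRL (@tendsP _ (nbhs z) _ f (f z))); apply/tends_cts.
Qed.

Lemma continuous_withinP (A : set C) f :
  {within A, continuous f} <->
  forall z, A z -> forall e : R, 0 < e ->
   exists2 r : R, 0 < r & forall w, A w -> `‖w - z‖ < r -> `‖f w - f z‖ < e.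
Proof.
rewrite subspace_continuousP; split=> fA z Az.
  move=> e e0.
  have /tendsP /(_ e e0) /near_modulusP[r r0 rP] := fA z Az.
  by exists r => // w Aw wz; apply: rP.
apply/tendsP => e e0; have [r r0 rP] := fA z Az e e0.
by apply/near_modulusP; exists r => // w wz Aw; apply: rP.
Qed.

(** First-order approximation instead of a difference quotient: with a weak inequality the point
    [w = z] needs no exception. *)
Definition has_deriv (f : C -> C) z l :=
  forall e : R, 0 < e -> exists2 r : R, 0 < r &
    forall w, `‖w - z‖ < r -> `‖f w - f z - l * (w - z)‖ <= e * `‖w - z‖.

Lemma has_derivP f z l :
  has_deriv f z l <-> h^-1 *: ((f \o shift z) (h *: 1) - f z) @[h --> 0^'] --> l.
Proof.
have key (h : C) : h != 0 -> h^-1 *: ((f \o shift z) (h *: 1) - f z) - l =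
    h^-1 * (f (h + z) - f z - l * h).
  move=> h0 /=; rewrite -[h *: 1]/(h * 1) mulr1 -[_ *: _]/(_ * _).
  by rewrite [RHS]mulrBr [l * h]mulrC mulKf.
split=> [fl|/tendsP fl e e0].
  apply/tendsP => e e0.
  have [r r0 rP] := fl (e / 2) ltac:(lra).
  apply/near_modulusP; exists r => // h; rewrite subr0 => hr h0.
  rewrite key // modulusM modulusV mulrC.
  have hp : 0 < `‖h‖ by rewrite modulus_gt0.
  have := rP (h + z); rewrite addrK => /(_ hr) le.
  have : `‖f (h + z) - f z - l * h‖ / `‖h‖ <= e / 2 by rewrite ler_pdivrMr.
  lra.
have /near_modulusP[r r0 rP] := fl e e0.
exists r => // w wr; have [->|wz] := eqVneq w z.
  by rewrite !subrr mulr0 subrr modulus0 mulr0.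
have h0 : w - z != 0 by rewrite subr_eq0.
have := rP (w - z); rewrite subr0 => /(_ wr h0).
rewrite key // subrK modulusM modulusV mulrC => /ltW.
by rewrite ler_pdivrMr // modulus_gt0.
Qed.

Lemma derivable_has_deriv f z : derivable f z 1 <-> exists l, has_deriv f z l.
Proof.
split=> [fz|[l /has_derivP fl]]; last by apply/cvg_ex; exists l.
by exists ('D_1 f z); apply/has_derivP.
Qed.

Definition holo_at f z := exists l, has_deriv f z l.

Lemma holo_atP f z : derivable f z 1 <-> holo_at f z.
Proof. exact: derivable_has_deriv. Qed.

Section Tends.
Variables (T : Type) (F : set_system T).
Context {FF : ProperFilter F}.
Implicit Types u v : T -> C.

Lemma tends_unique u l l' : tends F u l -> tends F u l' -> l = l'.
Proof.
move=> /(iffRL (tendsP _ _)) ul /(iffRL (tendsP _ _)) ul'.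
exact: (@cvg_unique_closed C T F _ u l l' ul ul').
Qed.

Lemma tends_cst l : tends F (fun=> l) l.
Proof. by move=> e e0; apply: nearW => x; rewrite subrr modulus0. Qed.

Lemma tendsD u v l m : tends F u l -> tends F v m ->
  tends F (fun x => u x + v x) (l + m).
Proof.
move=> /(iffRL (tendsP _ _)) ul /(iffRL (tendsP _ _)) vm.
by apply: (iffLR (tendsP _ _)); exact: (@cvgD_closed C T F _ u v l m).
Qed.

Lemma tendsM u v l m : tends F u l -> tends F v m ->
  tends F (fun x => u x * v x) (l * m).
Proof.
move=> /(iffRL (tendsP _ _)) ul /(iffRL (tendsP _ _)) vm.
by apply: (iffLR (tendsP _ _)); exact: (@cvgM_closed C T F _ u v l m).
Qed.

Lemma tendsN u l : tends F u l -> tends F (fun x => - u x) (- l).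
Proof.
move=> ul e e0; apply: filterS (ul e e0) => x.
by rewrite -opprD modulusN.
Qed.

Lemma tendsB u v l m : tends F u l -> tends F v m ->
  tends F (fun x => u x - v x) (l - m).
Proof. by move=> ul vm; apply: tendsD => //; apply: tendsN. Qed.

Lemma tendsV u l : l != 0 -> tends F u l -> tends F (fun x => (u x)^-1) l^-1.
Proof.
move=> l0 /(iffRL (tendsP _ _)) ul.
by apply: (iffLR (tendsP _ _)); exact: (@cvgV_closed C T F _ u l).
Qed.

Lemma tends_near u v l : (\forall x \near F, u x = v x) -> tends F u l -> tends F v l.
Proof.
by move=> uv ul e e0; apply: filterS2 uv (ul e e0) => x ->.
Qed.

Lemma tends_modulus_le u l (B : R) :
  (\forall x \near F, `‖u x‖ <= B) -> tends F u l -> `‖l‖ <= B.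
Proof.
move=> uB ul; apply/ler_addgt0Pr => e e0.
have [x [ux xl]] := filter_ex (filterI uB (ul e e0)).
by have := modulus_le_triangle l (u x) 0; rewrite !subr0 (modulusBC l); lra.
Qed.

Lemma tends_modulus_ge u l (B : R) :
  (\forall x \near F, B <= `‖u x‖) -> tends F u l -> B <= `‖l‖.
Proof.
move=> uB ul; apply/ler_addgt0Pr => e e0.
have [x [ux xl]] := filter_ex (filterI uB (ul e e0)).
by have := modulus_le_triangle (u x) l 0; rewrite !subr0; lra.
Qed.

Lemma tends_cts_comp u l f : cts f l -> tends F u l -> tends F (fun x => f (u x)) (f l).
Proof. by move=> fl ul e /fl[r r0 fr]; apply: filterS (ul r r0) => x /fr. Qed.

End Tends.

Lemma cts_cst (a : C) z : cts (fun=> a) z.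
Proof. by apply/tends_cts; apply: tends_cst. Qed.

Lemma cts_id z : cts id z.
Proof. by move=> e e0; exists e. Qed.

Lemma ctsD f g z : cts f z -> cts g z -> cts (fun w => f w + g w) z.
Proof. by move=> /tends_cts fz /tends_cts gz; apply/tends_cts; apply: tendsD. Qed.

Lemma ctsM f g z : cts f z -> cts g z -> cts (fun w => f w * g w) z.
Proof. by move=> /tends_cts fz /tends_cts gz; apply/tends_cts; apply: tendsM. Qed.

Lemma ctsN f z : cts f z -> cts (fun w => - f w) z.
Proof. by move=> /tends_cts fz; apply/tends_cts; apply: tendsN. Qed.

Lemma ctsB f g z : cts f z -> cts g z -> cts (fun w => f w - g w) z.
Proof. by move=> fz gz; apply: ctsD => //; apply: ctsN. Qed.

Lemma ctsV f z : f z != 0 -> cts f z -> cts (fun w => (f w)^-1) z.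
Proof. by move=> f0 /tends_cts fz; apply/tends_cts; apply: tendsV. Qed.

Lemma cts_comp f g z : cts f z -> cts g (f z) -> cts (fun w => g (f w)) z.
Proof. by move=> /tends_cts fz gz; apply/tends_cts; apply: tends_cts_comp. Qed.

Lemma cts_near f g z (r : R) : 0 < r -> (forall w, `‖w - z‖ < r -> f w = g w) ->
  cts f z -> cts g z.
Proof.
move=> r0 fg fz e /fz[s s0 sP]; exists (Num.min r s) => [|w]; first by rewrite lt_min r0.
rewrite lt_min => /andP[wr ws]; rewrite -!fg ?subrr ?modulus0 //; exact: sP.
Qed.

Lemma holo_cts f z : holo_at f z -> cts f z.
Proof.
move/holo_atP => fz; apply/ctsP; exact: (@derivable_continuous_closed C f z fz).
Qed.

Lemma holo_cst (a : C) z : holo_at (fun=> a) z.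
Proof. apply/holo_atP; exact: (@derivable_cst_closed C a z). Qed.

Lemma holo_id z : holo_at id z.
Proof. apply/holo_atP; exact: (@derivable_id_closed C z). Qed.

Lemma holoD f g z : holo_at f z -> holo_at g z -> holo_at (fun w => f w + g w) z.
Proof.
by move=> /holo_atP fz /holo_atP gz; apply/holo_atP; exact: (@derivableD_closed C f g z fz gz).
Qed.

Lemma holoM f g z : holo_at f z -> holo_at g z -> holo_at (fun w => f w * g w) z.
Proof.
by move=> /holo_atP fz /holo_atP gz; apply/holo_atP; exact: (@derivableM_closed C f g z fz gz).
Qed.

Lemma holoV f z : f z != 0 -> holo_at f z -> holo_at (fun w => (f w)^-1) z.
Proof.
by move=> f0 /holo_atP fz; apply/holo_atP; exact: (@derivableV_closed C f z f0 fz).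
Qed.

Lemma holo_comp f g z : holo_at f z -> holo_at g (f z) -> holo_at (fun w => g (f w)) z.
Proof.
by move=> /holo_atP fz /holo_atP gz; apply/holo_atP; exact: (@derivable_comp_closed C f g z fz gz).
Qed.

Lemma holoB f g z : holo_at f z -> holo_at g z -> holo_at (fun w => f w - g w) z.
Proof.
move=> fz gz; apply: holoD => //; have [l gl] := gz; exists (- l) => e e0.
have [r r0 rP] := gl e e0; exists r => // w /rP.
by rewrite mulNr -!opprD modulusN.
Qed.

Lemma holo_subc (b : C) f z : holo_at f z -> holo_at (fun w => f w - b) z.
Proof. by move=> fz; apply: holoB => //; apply: holo_cst. Qed.

Lemma holoX f z n : holo_at f z -> holo_at (fun w => f w ^+ n) z.
Proof.
move=> fz; elim: n => [|n IH]; first exact: holo_cst.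
have := holoM fz IH; congr holo_at; by apply/funext => w; rewrite exprS.
Qed.

Lemma holo_near f g z (r : R) : 0 < r -> (forall w, `‖w - z‖ < r -> f w = g w) ->
  holo_at f z -> holo_at g z.
Proof.
move=> r0 fg [l fl]; exists l => e e0; have [s s0 sP] := fl e e0.
exists (Num.min r s) => [|w]; first by rewrite lt_min r0.
rewrite lt_min => /andP[wr ws]; rewrite -!fg ?subrr ?modulus0 //; exact: sP.
Qed.

Lemma has_deriv_unique f z l l' : has_deriv f z l -> has_deriv f z l' -> l = l'.
Proof.
move=> /has_derivP fl /has_derivP fl'.
exact: (@cvg_unique_closed C _ _ _ _ l l' fl fl').
Qed.

Definition quotient f z l w := if w == z then l else (f w - f z) / (w - z).

Lemma quotientE f z l w : f w - f z = quotient f z l w * (w - z).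
Proof.
rewrite /quotient; case: eqVneq => [->|wz]; first by rewrite !subrr mulr0.
by rewrite divfK // subr_eq0.
Qed.

Lemma quotient_cts f z l : has_deriv f z l -> cts (quotient f z l) z.
Proof.
move=> fl e e0; have e2 : 0 < e / 2 by lra.
have [d d0 dP] := fl _ e2; exists d => // w wd.
rewrite /quotient eqxx; case: (eqVneq w z) => [_|wz]; first by rewrite subrr modulus0.
have w0 : 0 < `‖w - z‖ by rewrite modulus_gt0 subr_eq0.
have w1 : w - z != 0 by rewrite subr_eq0.
rewrite (_ : _ - l = (f w - f z - l * (w - z)) / (w - z)); last by field.
by rewrite modulusM modulusV ltr_pdivrMr //; have := dP _ wd; nra.
Qed.

Lemma compact_closed_disc (z : C) (r : R) : compact [set w : C | `‖w - z‖ <= r].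
Proof.
pose g (p : R * R) : C := z + ((p.1 +i* p.2)%C : C).
have gc : continuous g.
  move=> p; apply: (iffRL (@tendsP _ (nbhs p) _ g (g p))) => e e0.
  have e2 : 0 < e / 2 by lra.
  exists (ball p.1 (e / 2), ball p.2 (e / 2)) => /=.
    by split; apply: nbhsx_ballx.
  case=> q1 q2 [/=]; rewrite -!ball_normE /= => q1e q2e.
  rewrite /g opprD addrACA subrr add0r.
  rewrite -[X in modulus X]/((q1 - p.1) +i* (q2 - p.2))%C.
  apply: le_lt_trans (modulus_le_ReIm _ _) _.
  rewrite distrC [X in _ + X]distrC.
  lra.
have kI : compact (`[- r, r]%classic `*` `[- r, r]%classic : set (R * R)).
  by apply: compact_setX; apply: segment_compact.
apply: (@subclosed_compact _ _ (g @` (`[- r, r]%classic `*` `[- r, r]%classic))).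
- rewrite -openC; apply/open_discP => w /= /negP; rewrite -ltNge => wr.
  exists (`‖w - z‖ - r); first by rewrite subr_gt0.
  move=> t; rewrite /disc /= => tw; apply/negP; rewrite -ltNge.
  by have := modulus_le_triangle w t z; rewrite (modulusBC w t); lra.
- by apply: continuous_compact => //; apply: continuous_subspaceT.
- move=> w /= wr; exists (complex.Re (w - z), complex.Im (w - z)) => /=.
    rewrite !in_itv /= -!ler_norml; split.
      exact: le_trans (Re_le_modulus _) wr.
    exact: le_trans (Im_le_modulus _) wr.
  rewrite /g /= (_ : (_ +i* _)%C = w - z); first by rewrite addrC subrK.
  by case: (w - z).
Qed.

(** An ultrafilter contains each set or its complement, so a point [l] that is not a limit has a
    disc around it that [f] avoids along [F]. If this held for every [l] in the compact disc of
    radius [B], compactness would make [f] avoid that whole disc. *)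
Lemma ultra_bounded_tends (T : Type) (F : set_system T) (FF : UltraFilter F)
    (f : T -> C) (B : R) :
  (\forall x \near F, `‖f x‖ <= B) -> exists l, tends F f l.
Proof.
move=> fB; have := @compact_closed_disc 0 B.
move=> /(iffLR (compact_near_coveringP _)) cov.
apply: contrapT => nl.
have near_ne (l : C) : [set w : C | `‖w - 0‖ <= B] l ->
    \forall l' \near l & x \near F, f x <> l'.
  move=> /=; rewrite subr0 => lB.
  have [e [e0 ne]] : exists e : R, 0 < e /\ ~ \forall x \near F, `‖f x - l‖ < e.
    apply: contrapT => ne; apply: nl; exists l => e e0.
    by apply: contrapT => ne'; apply: ne; exists e.
  have [//|Fe] := in_ultra_setVsetC [set x | `‖f x - l‖ < e] FF.
  exists ([set w | `‖w - l‖ < e], [set x | ~ `‖f x - l‖ < e]) => /=.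
    by split => //; apply: (nbhs_disc l e0).
  by case=> w x /= [we nx] fx; apply: nx; rewrite fx.
have H := cov T F (fun x l => f x <> l) ultra_proper near_ne.
have [x [/= fx]] := filter_ex (filterI fB (H FF)).
by move/(_ (f x)); rewrite /= subr0 => /(_ fx).
Qed.

End Modulus.

(** * Goursat's theorem for midpoint sums *)

Section Goursat.
Variable R : realType.
Local Notation C := (cplx R).
Implicit Types (phi psi : R -> C) (F : R -> R -> C) (N : nat).

Definition ofR (x : R) : C := x%:C%C.
Definition imag : C := (0 +i* 1)%C.

Lemma ofRD x y : ofR (x + y) = ofR x + ofR y.
Proof. exact: (rmorphD (real_complex R)). Qed.

Lemma ofRB x y : ofR (x - y) = ofR x - ofR y.
Proof. exact: (rmorphB (real_complex R)). Qed.

Lemma ofR1 : ofR 1 = 1.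
Proof. by []. Qed.

Lemma ofR_half x : ofR x = ofR (x / 2) + ofR (x / 2).
Proof. by rewrite -ofRD; congr ofR; field. Qed.

Lemma modulus_ofR x : `‖ofR x‖ = `|x|.
Proof. exact: modulus_real. Qed.

Lemma modulus_shift (z : C) (t : R) : 0 < t -> `‖z + ofR t - z‖ = t.
Proof. by move=> t0; rewrite addrAC subrr add0r modulus_ofR gtr0_norm. Qed.

Lemma modulus_imag : `‖imag‖ = 1.
Proof. by rewrite /modulus /= expr0n add0r expr1n sqrtr1. Qed.

(** The composite midpoint rule on [s, s + l] with [2 ^ N] nodes, defined by halving so that
    refinement matches the bisection of rectangles exactly. *)
Fixpoint edge N phi s l : C :=
  if N is M.+1 then edge M phi s (l / 2) + edge M phi (s + l / 2) (l / 2)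
  else ofR l * phi (s + l / 2).

Lemma eq_edge N phi psi s l : 0 <= l ->
  (forall t, s <= t <= s + l -> phi t = psi t) -> edge N phi s l = edge N psi s l.
Proof.
elim: N s l => [|N IH] s l l0 E /=; first by rewrite E //; apply/andP; split; lra.
by rewrite !IH //; try lra; move=> t /andP[? ?]; apply: E; apply/andP; split; lra.
Qed.

Lemma edgeD N phi psi s l :
  edge N (fun t => phi t + psi t) s l = edge N phi s l + edge N psi s l.
Proof. elim: N s l => [|N IH] s l /=; [by ring | by rewrite !IH; ring]. Qed.

Lemma edgeZ N a phi s l : edge N (fun t => a * phi t) s l = a * edge N phi s l.
Proof. elim: N s l => [|N IH] s l /=; [by ring | by rewrite !IH; ring]. Qed.

(** The midpoint rule is exact on affine functions; hence the affine part of a holomorphic function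
    drops out of every boundary sum, without a limit in [N]. *)
Lemma edge_affine N p q s l :
  edge N (fun t => p + ofR t * q) s l = ofR l * (p + ofR (s + l / 2) * q).
Proof.
elim: N s l => [//|N IH] s l /=; rewrite !IH.
have El := ofR_half l; have El2 := ofR_half (l / 2).
by rewrite !ofRD El El2; ring.
Qed.

Lemma edge_cst N p s l : edge N (fun=> p) s l = ofR l * p.
Proof.
have := edge_affine N p 0 s l; rewrite mulr0 addr0 => <-; congr edge.
by apply/funext => t; rewrite mulr0 addr0.
Qed.

Lemma edge_le N phi s l (B : R) : 0 <= l ->
  (forall t, s <= t <= s + l -> `‖phi t‖ <= B) -> `‖edge N phi s l‖ <= l * B.
Proof.
elim: N s l => [|N IH] s l l0 E /=.
  rewrite modulusM modulus_ofR ger0_norm // ler_wpM2l // E //.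
  by apply/andP; split; lra.
apply: le_trans (modulusD _ _) _.
have -> : l * B = l / 2 * B + l / 2 * B by field.
by apply: lerD; apply: IH; try lra; move=> t /andP[? ?]; apply: E; apply/andP; split; lra.
Qed.

(* The midpoint sums of F dz along the positively oriented boundary of a
   rectangle, with 2^N nodes on each side. *)
Definition bdry N F x y a b : C :=
  edge N (F^~ y) x a + imag * edge N (F (x + a)) y b
  - edge N (F^~ (y + b)) x a - imag * edge N (F x) y b.

Lemma bdryD N F G x y a b :
  bdry N (fun s t => F s t + G s t) x y a b = bdry N F x y a b + bdry N G x y a b.
Proof. by rewrite /bdry !edgeD; ring. Qed.

Definition cart (x y : R) : C := ofR x + imag * ofR y.

Lemma bdry_affine N p q x y a b : bdry N (fun s t => p + q * cart s t) x y a b = 0.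
Proof.
rewrite /cart.
have h t : (fun s => p + q * (ofR s + imag * ofR t)) =
   (fun s => (p + q * imag * ofR t) + ofR s * q) by apply/funext => s; ring.
have v s : (fun t => p + q * (ofR s + imag * ofR t)) =
   (fun t => (p + q * ofR s) + ofR t * (q * imag)) by apply/funext => t; ring.
rewrite /bdry !h !v !edge_affine !ofRD (ofR_half a) (ofR_half b).
by ring.
Qed.

(** The two sums along an interior side use the same nodes with opposite signs, so they cancel
    exactly and not merely in the limit. *)
Lemma bdry_split N F x y a b : bdry N.+1 F x y a b =
  bdry N F x y (a / 2) (b / 2) + bdry N F (x + a / 2) y (a / 2) (b / 2) +
  bdry N F x (y + b / 2) (a / 2) (b / 2) +
  bdry N F (x + a / 2) (y + b / 2) (a / 2) (b / 2).
Proof.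
rewrite /bdry /=.
have -> : x + a / 2 + a / 2 = x + a by field.
have -> : y + b / 2 + b / 2 = y + b by field.
by ring.
Qed.

Lemma bdry_le N F x y a b (B : R) : 0 <= a -> 0 <= b ->
  (forall s t, x <= s <= x + a -> y <= t <= y + b -> `‖F s t‖ <= B) ->
  `‖bdry N F x y a b‖ <= 2 * (a + b) * B.
Proof.
move=> a0 b0 FB; rewrite /bdry.
have lex u : 0 <= u -> forall z : R, z <= z <= z + u.
  by move=> u0 z; rewrite lexx lerDl.
have rex u : 0 <= u -> forall z : R, z <= z + u <= z + u.
  by move=> u0 z; rewrite lexx lerDl andbT.
have e1 : `‖edge N (F^~ y) x a‖ <= a * B.
  by apply: edge_le => // t tx; apply: FB => //; apply: lex.
have e2 : `‖edge N (F (x + a)) y b‖ <= b * B.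
  by apply: edge_le => // t tx; apply: FB => //; apply: rex.
have e3 : `‖edge N (F^~ (y + b)) x a‖ <= a * B.
  by apply: edge_le => // t tx; apply: FB => //; apply: rex.
have e4 : `‖edge N (F x) y b‖ <= b * B.
  by apply: edge_le => // t tx; apply: FB => //; apply: lex.
apply: le_trans (modulusD _ _) _; rewrite modulusN modulusM modulus_imag mul1r.
have := modulusD (edge N (F^~ y) x a + imag * edge N (F (x + a)) y b) (- edge N (F^~ (y + b)) x a).
have := modulusD (edge N (F^~ y) x a) (imag * edge N (F (x + a)) y b).
rewrite modulusN modulusM modulus_imag mul1r.
lra.
Qed.

Lemma modulus_cart x y : `‖cart x y‖ <= `|x| + `|y|.
Proof.
by apply: le_trans (modulusD _ _) _; rewrite modulusM modulus_imag mul1r !modulus_ofR.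
Qed.

Lemma nested_intervals (u : nat -> R) (a : R) : 0 <= a ->
  (forall n, u n <= u n.+1 <= u n + a / 2 ^+ n.+1) ->
  exists x, forall n, u n <= x <= u n + a / 2 ^+ n.
Proof.
move=> a0 uP.
have step n : 2 * (a / 2 ^+ n.+1) = a / 2 ^+ n.
  by rewrite exprS; field; rewrite expf_neq0.
have up n m : u n <= u (n + m)%N.
  by elim: m => [|m IH]; rewrite ?addn0 // addnS (le_trans IH) //; case/andP: (uP (n + m)%N).
have low n m : u (n + m)%N + a / 2 ^+ (n + m)%N <= u n + a / 2 ^+ n.
  elim: m => [|m IH]; rewrite ?addn0 // addnS; apply: le_trans IH.
  by have /andP[_] := uP (n + m)%N; have := step (n + m)%N; lra.
have pos n : 0 <= a / 2 ^+ n by rewrite divr_ge0 // exprn_ge0.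
have ub n m : u m <= u n + a / 2 ^+ n.
  have [nm|/ltnW mn] := leqP n m.
    by have := low n (m - n)%N; rewrite subnKC //; have := pos m; lra.
  by have := up m (n - m)%N; rewrite subnKC //; have := pos n; lra.
have hs : has_sup (range u).
  by split; [exists (u 0%N), 0%N | exists (u 0%N + a / 2 ^+ 0) => _ [m _ <-]].
exists (sup (range u)) => n; apply/andP; split.
  by apply: ub_le_sup; [case: hs | exists n].
by apply: ge_sup; [case: hs | move=> _ [m _ <-]].
Qed.

Lemma geometric_small (a e : R) : 0 < e -> exists n, a / 2 ^+ n <= e.
Proof.
move=> e0; have [n n1] : exists n, a / e <= n%:R.
  exists (Num.bound `|a / e|); apply: le_trans (ler_norm _) _.
  exact: ltW (archi_boundP (normr_ge0 _)).
exists n; rewrite ler_pdivrMr ?exprn_gt0 // -ler_pdivrMl // mulrC.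
apply: (le_trans n1); rewrite -natrX ler_nat; apply: ltnW; exact: ltn_expl.
Qed.

Section Bisection.
Variables (f : C -> C) (x0 y0 a b : R).
Hypotheses (a0 : 0 < a) (b0 : 0 < b).
Hypothesis fh : forall x y, x0 <= x <= x0 + a -> y0 <= y <= y0 + b ->
  holo_at f (cart x y).

Let F x y := f (cart x y).

(** The bound is proportional to the area: it adds up over four quadrants, so a failure on a
    rectangle forces a failure on one of its quadrants. *)
Let good (e : R) (n : nat) (p : R * R) :=
  \forall N \near \oo,
    `‖bdry N F p.1 p.2 (a / 2 ^+ n) (b / 2 ^+ n)‖ <= e * (a / 2 ^+ n) * (b / 2 ^+ n).

Let quadrant (n : nat) (p p' : R * R) :=
  (p.1 <= p'.1 <= p.1 + a / 2 ^+ n.+1) /\ (p.2 <= p'.2 <= p.2 + b / 2 ^+ n.+1).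

Let halve (u : R) n : u / 2 ^+ n / 2 = u / 2 ^+ n.+1.
Proof. by rewrite exprSr invfM mulrA. Qed.

Let bad_quadrant e n p : ~ good e n p -> exists p', quadrant n p p' /\ ~ good e n.+1 p'.
Proof.
move=> bp; apply: contrapT => nq; apply: bp.
have an : 0 < a / 2 ^+ n.+1 by rewrite divr_gt0 // exprn_gt0.
have bn : 0 < b / 2 ^+ n.+1 by rewrite divr_gt0 // exprn_gt0.
have gq p' : quadrant n p p' -> good e n.+1 p'.
  by move=> qp; apply: contrapT => bq; apply: nq; exists p'.
have g1 := gq (p.1, p.2).
have g2 := gq (p.1 + a / 2 ^+ n.+1, p.2).
have g3 := gq (p.1, p.2 + b / 2 ^+ n.+1).
have g4 := gq (p.1 + a / 2 ^+ n.+1, p.2 + b / 2 ^+ n.+1).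
have : good e n.+1 (p.1, p.2) by apply: g1; split => /=; apply/andP; split; lra.
have : good e n.+1 (p.1 + a / 2 ^+ n.+1, p.2) by apply: g2; split => /=; apply/andP; split; lra.
have : good e n.+1 (p.1, p.2 + b / 2 ^+ n.+1) by apply: g3; split => /=; apply/andP; split; lra.
have : good e n.+1 (p.1 + a / 2 ^+ n.+1, p.2 + b / 2 ^+ n.+1).
  by apply: g4; split => /=; apply/andP; split; lra.
move=> {g1 g2 g3 g4} [N4 _ h4] [N3 _ h3] [N2 _ h2] [N1 _ h1].
exists (N1 + N2 + N3 + N4).+1%N => // -[//|N] /= NN.
have le1 : (N1 <= N)%N by lia.
have le2 : (N2 <= N)%N by lia.
have le3 : (N3 <= N)%N by lia.
have le4 : (N4 <= N)%N by lia.
rewrite bdry_split !halve.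
have := h1 N le1; have := h2 N le2; have := h3 N le3; have := h4 N le4.
rewrite /= => {h1 h2 h3 h4}.
set B1 := bdry _ _ _ _ _ _; set B2 := bdry _ _ _ _ _ _; set B3 := bdry _ _ _ _ _ _.
set B4 := bdry _ _ _ _ _ _ => h1 h2 h3 h4.
have -> : e * (a / 2 ^+ n) * (b / 2 ^+ n) = 4 * (e * (a / 2 ^+ n.+1) * (b / 2 ^+ n.+1)).
  by rewrite -!halve; field; rewrite expf_neq0.
have m1 := modulusD (B4 + B3 + B2) B1.
have m2 := modulusD (B4 + B3) B2.
have m3 := modulusD B4 B3.
lra.
Qed.

Lemma goursat (e : R) : 0 < e -> \forall N \near \oo, `‖bdry N F x0 y0 a b‖ <= e.
Proof.
move=> e0; pose e1 := e / (a * b).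
have ab0 : 0 < a * b by rewrite mulr_gt0.
have e10 : 0 < e1 by rewrite divr_gt0.
suff : good e1 0 (x0, y0).
  rewrite /good /= expr0 !divr1 -mulrA divfK // gt_eqF //.
apply: contrapT => b00.
have /choice[step stepP] : forall np : nat * (R * R), exists p' : R * R,
    ~ good e1 np.1 np.2 -> quadrant np.1 np.2 p' /\ ~ good e1 np.1.+1 p'.
  move=> [n p]; have [g|bp] := pselect (good e1 n p); first by exists p.
  by have [p' ?] := bad_quadrant bp; exists p'.
pose fix sq n := if n is m.+1 then step (m, sq m) else (x0, y0).
have bsq n : ~ good e1 n (sq n).
  by elim: n => [//|n IH] /=; case: (stepP (n, sq n) IH).
have qsq n : quadrant n (sq n) (sq n.+1) by case: (stepP (n, sq n) (bsq n)).
have [x xP] := @nested_intervals (fun n => (sq n).1) a (ltW a0) (fun n => (qsq n).1).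
have [y yP] := @nested_intervals (fun n => (sq n).2) b (ltW b0) (fun n => (qsq n).2).
have [L dL] : holo_at f (cart x y).
  apply: fh; first by have := xP 0%N; rewrite /= expr0 divr1.
  by have := yP 0%N; rewrite /= expr0 divr1.
(* On a rectangle scaled by [u] the remainder is at most [e2 * (a + b) * u] and the perimeter is
   [2 * (a + b) * u]; their product is [e * u ^+ 2], which is [e1] times the area. *)
pose e2 := e / (2 * (a + b) ^+ 2).
have ab1 : 0 < a + b by rewrite addr_gt0.
have e20 : 0 < e2 by rewrite divr_gt0 // mulr_gt0 // exprn_gt0.
have [r r0 rP] := dL e2 e20.
have r2 : 0 < r / 2 by lra.
have [n nr] := geometric_small (a + b) r2.
pose u := (2 ^+ n : R)^-1.
have u0 : 0 < u by rewrite invr_gt0 exprn_gt0.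
have nr' : a * u + b * u <= r / 2 by rewrite -mulrDl.
have au : 0 < a * u by rewrite mulr_gt0.
have bu : 0 < b * u by rewrite mulr_gt0.
apply: (bsq n); rewrite /good; apply: nearW => N.
pose G s t := F s t - (F x y - L * cart x y + L * cart s t).
have -> : F = fun s t => (F x y - L * cart x y + L * cart s t) + G s t.
  by apply/funext => s; apply/funext => t; rewrite /G; ring.
rewrite bdryD bdry_affine add0r.
have xn := xP n; have yn := yP n; rewrite -!/u in xn yn *.
move: (sq n) xn yn => [p1 p2] /= /andP[x1 x2] /andP[y1 y2].
apply: le_trans (_ : 2 * (a * u + b * u) * (e2 * (a * u + b * u)) <= _).
  apply: bdry_le; try exact: ltW.
  move=> s t /andP[s1 s2] /andP[t1 t2].
  have sx : `|s - x| <= a * u by rewrite ler_norml; apply/andP; split; lra.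
  have ty : `|t - y| <= b * u by rewrite ler_norml; apply/andP; split; lra.
  have := modulus_cart (s - x) (t - y).
  rewrite (_ : cart (s - x) (t - y) = cart s t - cart x y); last first.
    by rewrite /cart !ofRB; ring.
  move=> w1; have w2 : `‖cart s t - cart x y‖ <= a * u + b * u by lra.
  rewrite (_ : G s t = f (cart s t) - f (cart x y) - L * (cart s t - cart x y)); last first.
    by rewrite /G /F; ring.
  apply: le_trans (rP _ _) _; first lra.
  by rewrite ler_pM2l.
rewrite /e2 /e1 le_eqVlt; apply/orP; left; apply/eqP; field.
by rewrite ?gt_eqF //= addr_gt0.
Qed.

End Bisection.
End Goursat.

(** * The exponential map and Riemann sums over circles *)

Section CircleMean.
Variable R : realType.
Local Notation C := (cplx R).
Implicit Types (f g phi psi : C -> C) (c z w : C) (r s : R).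

Lemma real_deriv_le (g : R -> R) (x l : R) : is_derive x 1 g l ->
  forall e : R, 0 < e -> exists2 r : R, 0 < r &
    forall h, `|h| < r -> `|g (x + h) - g x - l * h| <= e * `|h|.
Proof.
move=> [dg gl] e e0.
have : h^-1 *: ((g \o shift x) (h *: 1) - g x) @[h --> 0^'] --> l by rewrite -gl.
move=> /cvgrPdistC_le /(_ e e0) [r /= r0 rP]; exists r => // h hr.
have [->|h0] := eqVneq h 0; first by rewrite addr0 subrr mulr0 subrr normr0 mulr0.
have := rP h; rewrite /ball_ /= sub0r normrN => /(_ hr h0).
rewrite -[h *: 1]/(h * 1) mulr1 -[_ *: _]/(_ * _) /= (addrC h x) => H.
have -> : g (x + h) - g x - l * h = h * (h^-1 * (g (x + h) - g x) - l) by field.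
by rewrite normrM mulrC; apply: ler_wpM2r.
Qed.

Definition polar (x y : R) : C := ((expR x * cos y) +i* (expR x * sin y))%C.

Lemma polarD x y x' y' : polar (x + x') (y + y') = polar x y * polar x' y'.
Proof.
apply/eqP; rewrite eq_complex /= expRD cosD sinD.
by apply/andP; split; apply/eqP; ring.
Qed.

Lemma modulus_polar x y : `‖polar x y‖ = expR x.
Proof.
rewrite /modulus /= !exprMn -mulrDr cos2Dsin2 mulr1 sqrtr_sqr.
by rewrite ger0_norm // expR_ge0.
Qed.

Lemma polar2pi x y : polar x (y + 2 * pi) = polar x y.
Proof. by rewrite /polar mulr_natl cosD2pi sinD2pi. Qed.

Definition cexp z : C := polar (complex.Re z) (complex.Im z).

Lemma cexp_deriv0 : has_deriv cexp 0 1.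
Proof.
(* The four error terms below add up to at most [9 * e1] times the modulus of [w], so a sixteenth of
   [e] leaves room; the bound by 1 keeps [expR h] below 3. *)
move=> e e0; pose e1 := Num.min 1 (e / 16).
have e10 : 0 < e1 by rewrite lt_min ltr01 divr_gt0.
have e11 : e1 <= 1 by rewrite ge_min lexx.
have e1e : 16 * e1 <= e by have : e1 <= e / 16 by [rewrite ge_min lexx orbT]; lra.
clearbody e1.
have [r1 r10 E] := real_deriv_le (is_derive_expR 0) e10.
have [r2 r20 Cs] := real_deriv_le (is_derive_cos 0) e10.
have [r3 r30 Sn] := real_deriv_le (is_derive_sin 0) e10.
exists (Num.min (Num.min r1 r2) (Num.min r3 e1)); first by rewrite !lt_min r10 r20 r30.
move=> w; rewrite subr0 mul1r (_ : cexp 0 = 1); last first.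
  by rewrite /cexp /polar expR0 cos0 sin0 mulr1 mulr0.
rewrite !lt_min => /andP[/andP[w1 w2] /andP[w3 w4]].
have := Re_le_modulus w; have := Im_le_modulus w; rewrite /cexp.
set h := complex.Re w; set k := complex.Im w => kw hw.
have {E} := E h (le_lt_trans hw w1); rewrite !add0r expR0 mul1r => E.
have {Cs} := Cs k (le_lt_trans kw w2); rewrite !add0r cos0 sin0 oppr0 mul0r subr0 => Cs.
have {Sn} := Sn k (le_lt_trans kw w3); rewrite !add0r sin0 cos0 mul1r subr0 => Sn.
have -> : polar h k - 1 - w =
  ofR (expR h - 1 - h) + ofR (expR h * (cos k - 1)) +
  imag R * ofR (expR h * (sin k - k) + (expR h - 1) * k).
  apply/eqP; rewrite /h /k; case: (w) => x y; rewrite eq_complex /=.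
  by apply/andP; split; apply/eqP; ring.
have xh : `|expR h| <= 3.
  have -> : expR h = (expR h - 1 - h) + h + 1 by ring.
  have := ler_normD ((expR h - 1 - h) + h) 1; have := ler_normD (expR h - 1 - h) h.
  rewrite normr1; have := normr_ge0 h; nra.
have xh1 : `|expR h - 1| <= 2 * `|h|.
  have -> : expR h - 1 = (expR h - 1 - h) + h by ring.
  by have := ler_normD (expR h - 1 - h) h; have := normr_ge0 h; nra.
have t2 : `|expR h * (cos k - 1)| <= 3 * (e1 * `|k|) by rewrite normrM; apply: ler_pM.
have t3 : `|expR h * (sin k - k)| <= 3 * (e1 * `|k|) by rewrite normrM; apply: ler_pM.
have t4 : `|(expR h - 1) * k| <= 2 * e1 * `|k|.
  by rewrite normrM; apply: ler_wpM2r => //; lra.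
apply: le_trans (modulusD _ _) _; rewrite modulusM modulus_imag mul1r !modulus_ofR.
have := modulusD (ofR (expR h - 1 - h)) (ofR (expR h * (cos k - 1))).
rewrite !modulus_ofR.
have := ler_normD (expR h * (sin k - k)) ((expR h - 1) * k).
have : 16 * e1 * `‖w‖ <= e * `‖w‖ by rewrite ler_wpM2r ?modulus_ge0.
have : e1 * `|h| <= e1 * `‖w‖ by rewrite ler_pM2l.
have : e1 * `|k| <= e1 * `‖w‖ by rewrite ler_pM2l.
have : 0 <= e1 * `‖w‖ by rewrite mulr_ge0 ?modulus_ge0 // ltW.
lra.
Qed.

(** The addition formula [cexp w = cexp z * cexp (w - z)] moves the question to the origin. *)
Lemma holo_cexp z : holo_at cexp z.
Proof.
have E : (fun w => cexp z * cexp (w - z)) = cexp.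
  apply/funext => w; rewrite /cexp -polarD; case: (z) => x y; case: (w) => s t /=.
  by congr polar; ring.
rewrite -E; apply: holoM; first exact: holo_cst.
apply: (holo_comp (holo_subc z (@holo_id R z))); rewrite subrr.
by exists 1; exact: cexp_deriv0.
Qed.

Definition circle c r (t : R) : C := c + ofR r * polar 0 (2 * pi * t).

Lemma circle_modulus c r t : 0 <= r -> `‖circle c r t - c‖ = r.
Proof.
by move=> r0; rewrite /circle addrAC subrr add0r modulusM modulus_ofR modulus_polar expR0 mulr1 ger0_norm.
Qed.

Definition node_mean (N : nat) c r phi : C := edge N (phi \o circle c r) 0 1.

Lemma circle_polar c (x t : R) :
  circle c (expR (2 * pi * x)) t = c + polar (2 * pi * x) (2 * pi * t).
Proof.
congr (_ + _).
have -> : polar (2 * pi * x) (2 * pi * t) = polar (2 * pi * x + 0) (0 + 2 * pi * t).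
  by rewrite addr0 add0r.
rewrite polarD.
by congr (_ * _); apply/eqP; rewrite eq_complex /= cos0 sin0 mulr1 mulr0 !eqxx.
Qed.

Lemma cexp_cart (p x y : R) : cexp (ofR p * cart x y) = polar (p * x) (p * y).
Proof. by rewrite /cexp /=; congr polar; ring. Qed.

Lemma holo_comp_cexp f c (p x y : R) : holo_at f (c + polar (p * x) (p * y)) ->
  holo_at (fun z => f (c + cexp (ofR p * z))) (cart x y).
Proof.
rewrite -cexp_cart; apply: (@holo_comp R (fun z => c + cexp (ofR p * z))).
apply: (holoD (@holo_cst R c _)); apply: (@holo_comp R (fun z => ofR p * z)).
  exact: (holoM (@holo_cst R (ofR p) _) (@holo_id R _)).
exact: holo_cexp.
Qed.

(* The function f(c + exp(2 pi z)) has period i, so the two horizontal sides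
   of the rectangle [ln r / 2pi, ln s / 2pi] x [0, 1] cancel and Goursat compares
   the means of f over the circles of radii r and s. *)
Lemma node_mean_annulus f c r s : 0 < r -> r < s ->
  (forall z, r <= `‖z - c‖ <= s -> holo_at f z) ->
  forall e, 0 < e -> \forall N \near \oo,
    `‖node_mean N c s f - node_mean N c r f‖ <= e.
Proof.
move=> r0 rs fh e e0; pose p : R := 2 * pi.
have p0 : 0 < p by rewrite mulr_gt0 // pi_gt0.
have s0 := lt_trans r0 rs.
pose x := ln r / p; pose a := ln s / p - ln r / p.
have a0 : 0 < a by rewrite subr_gt0 ltr_pM2r ?invr_gt0 // ltr_ln.
have px : p * x = ln r by rewrite mulrC divfK // gt_eqF.
have pxa : p * (x + a) = ln s by rewrite /a addrC subrK mulrC divfK // gt_eqF.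
pose F s t := f (c + cexp (ofR p * cart s t)).
have dF u v : x <= u <= x + a -> 0 <= v <= 0 + 1 ->
    holo_at (fun z => f (c + cexp (ofR p * z))) (cart u v).
  move=> /andP[xu ua] _; apply: holo_comp_cexp; apply: fh.
  rewrite addrAC subrr add0r modulus_polar -/p; apply/andP; split.
    by rewrite -(lnK (r0 : r \is Num.pos)) ler_expR -px ler_pM2l.
  by rewrite -[leRHS](lnK (s0 : s \is Num.pos)) ler_expR -pxa ler_pM2l.
have hz : F^~ (0 + 1) = F^~ 0.
  apply/funext => u; rewrite /F !cexp_cart; congr (f (c + _)).
  by rewrite add0r mulr1 mulr0 -(polar2pi (p * u) 0) add0r.
have vert u t : expR (p * u) = t -> F u = f \o circle c t.
  by move=> <-; apply/funext => v; rewrite /F /= cexp_cart circle_polar.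
have := goursat a0 ltr01 dF e0; apply: filterS => N.
rewrite /bdry hz.
rewrite (_ : _ - _ - _ = imag R * (edge N (F (x + a)) 0 1 - edge N (F x) 0 1)); last by ring.
rewrite modulusM modulus_imag mul1r.
rewrite (@vert (x + a) s) ?(@vert x r) //.
  by rewrite px lnK.
by rewrite pxa lnK.
Qed.

End CircleMean.

(** * Uniformity on compact sets *)

Section Compactness.
Variable R : realType.
Local Notation C := (cplx R).
Implicit Types (f : C -> C) (c z w : C) (r s : R) (K : set C).

Lemma near_compact (T : Type) (F : set_system T) {FF : Filter F} K (P : T -> C -> Prop) :
  compact K -> (forall z, K z -> exists2 r : R, 0 < r &
     \forall i \near F, forall w, `‖w - z‖ < r -> P i w) ->
  \forall i \near F, forall z, K z -> P i z.
Proof.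
move=> /(iffLR (compact_near_coveringP _)) cov KP.
suff : \forall i \near F, K `<=` P i by apply: filterS => i iP z /iP.
apply: cov => z /KP[r r0 rP].
exists ([set w | `‖w - z‖ < r], [set i | forall w, `‖w - z‖ < r -> P i w]) => /=.
  by split; [exact: (nbhs_disc z r0) | exact: rP].
by case=> w i /= [wr]; apply.
Qed.

(** The local hypothesis ranges over nearby points and all smaller radii at once, which is what a
    covering argument along the filter of small positive radii consumes. *)
Lemma compact_uniform_radius K (P : R -> C -> Prop) : compact K ->
  (forall z, K z -> exists2 d : R, 0 < d &
     forall z' d', `‖z' - z‖ < d -> 0 < d' -> d' < d -> P d' z') ->
  exists2 d : R, 0 < d & forall z, K z -> P d z.
Proof.
move=> cK KP; have : \forall d \near (0 : R)^'+, forall z, K z -> P d z.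
  apply: near_compact => // z /KP[d d0 dP]; exists d => //.
  by apply: filterS2 (nbhs_right_gt 0) (nbhs_right_lt d0) => d' d'0 d'd w wd; apply: dP.
by move=> H; have [d [d0 dP]] := filter_ex (filterI (nbhs_right_gt 0) H); exists d.
Qed.

Lemma cts_compact_bounded K f : compact K -> (forall z, K z -> cts f z) ->
  exists2 B : R, 0 < B & forall z, K z -> `‖f z‖ <= B.
Proof.
move=> cK fK.
have [z /fK fz|d d0 dP] := @compact_uniform_radius K (fun d z => `‖f z‖ <= d^-1) cK.
  have [r r0 rP] := fz 1 ltr01; have B0 := modulus_ge0 (f z).
  exists (Num.min r (`‖f z‖ + 1)^-1); first by rewrite lt_min r0 invr_gt0; lra.
  move=> z' d'; rewrite !lt_min => /andP[zr _] d'0 /andP[_ d'B].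
  have : `‖f z'‖ <= `‖f z‖ + 1.
    by have := modulusD (f z' - f z) (f z); rewrite subrK; have := rP _ zr; lra.
  move=> /le_trans; apply; rewrite -[leLHS]invrK lef_pV2 ?ltW // posrE //.
  by rewrite invr_gt0; lra.
by exists d^-1; rewrite ?invr_gt0.
Qed.

Lemma cts_compact_uniform K f : compact K -> (forall z, K z -> cts f z) ->
  forall e : R, 0 < e -> exists2 d : R, 0 < d &
    forall z z', K z -> `‖z' - z‖ <= d -> `‖f z' - f z‖ <= e.
Proof.
move=> cK fK e e0.
have [z /fK fz|d d0 dP] := @compact_uniform_radius K
    (fun d z => forall z', `‖z' - z‖ <= d -> `‖f z' - f z‖ <= e) cK.
  have e2 : 0 < e / 2 by lra.
  have [r r0 rP] := fz _ e2.
  exists (r / 2); first lra.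
  move=> z1 d' z1r d'0 d'r z2 z21.
  have z2r : `‖z2 - z‖ < r by have := modulus_le_triangle z2 z1 z; lra.
  have z1r' : `‖z1 - z‖ < r by lra.
  have := modulus_le_triangle (f z2) (f z) (f z1); have := rP _ z2r; have := rP _ z1r'.
  by rewrite (modulusBC (f z) (f z1)); lra.
by exists d => // z z' Kz; apply: dP.
Qed.

Lemma compact_circle c r : compact [set z : C | `‖z - c‖ = r].
Proof.
apply: (@subclosed_compact _ _ [set z : C | `‖z - c‖ <= r]).
- rewrite -openC; apply/open_discP => w /= /eqP wr.
  exists `| `‖w - c‖ - r|; first by rewrite normr_gt0 subr_eq0.
  move=> t; rewrite /disc /= => tw tr; move: tw; apply/negP; rewrite -leNgt.
  have := modulus_dist (w - c) (t - c); have := modulus_dist (t - c) (w - c).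
  rewrite !opprB !addrA !subrK (modulusBC w t) tr => h1 h2.
  by rewrite ler_norml; apply/andP; split; lra.
- exact: compact_closed_disc.
- by move=> z /= ->.
Qed.

End Compactness.

(** * Circle means and Cauchy's formula *)

Section Mean.
Variable R : realType.
Local Notation C := (cplx R).
Implicit Types (f g phi psi : C -> C) (c z w : C) (r s : R) (K : set C).

(** An ultrafilter finer than [\oo] inherits all eventual statements, and along it bounded sequences
    converge without passing to subsequences. *)
Lemma omega_subproof : exists G : set_system nat, UltraFilter G /\ \oo `<=` G.
Proof. exact: ultraFilterLemma. Qed.

Definition omega : set_system nat := sval (cid omega_subproof).

Global Instance omega_ultra : UltraFilter omega.
Proof. by have [] := svalP (cid omega_subproof). Qed.

Global Instance omega_proper : ProperFilter omega.
Proof. exact: ultra_proper. Qed.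

Lemma near_omega (P : nat -> Prop) :
  (\forall n \near \oo, P n) -> \forall n \near omega, P n.
Proof. by have [_] := svalP (cid omega_subproof); apply. Qed.

(* The circle mean (2 pi)^-1 int_0^(2 pi) phi(c + r e^(it)) dt, as a Banach
   limit of Riemann sums: this is defined for all bounded phi. *)
Definition mean c r phi : C :=
  xget 0 [set l | tends omega (fun N => node_mean N c r phi) l].

Definition bounded_on_circle c r phi :=
  exists B : R, forall z, `‖z - c‖ = r -> `‖phi z‖ <= B.

Lemma node_mean_le N c r phi (B : R) : 0 <= r ->
  (forall z, `‖z - c‖ = r -> `‖phi z‖ <= B) -> `‖node_mean N c r phi‖ <= B.
Proof.
move=> r0 phiB; rewrite -[leRHS]mul1r; apply: edge_le => // t _.
by apply: phiB; apply: circle_modulus.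
Qed.

Lemma mean_tends c r phi : 0 <= r -> bounded_on_circle c r phi ->
  tends omega (fun N => node_mean N c r phi) (mean c r phi).
Proof.
move=> r0 [B phiB].
have [|l lP] := @ultra_bounded_tends R _ omega _ (fun N => node_mean N c r phi) B.
  by apply: nearW => N; apply: node_mean_le.
by rewrite /mean; case: xgetP => [x _ //|/(_ l)].
Qed.

Lemma mean_unique c r phi l : 
  tends omega (fun N => node_mean N c r phi) l -> mean c r phi = l.
Proof.
move=> tl; rewrite /mean; case: xgetP => [x _ /= tx|/(_ l) //].
exact: tends_unique tx tl.
Qed.

Lemma mean_le c r phi (B : R) : 0 <= r ->
  (forall z, `‖z - c‖ = r -> `‖phi z‖ <= B) -> `‖mean c r phi‖ <= B.
Proof.
move=> r0 phiB; apply: tends_modulus_le (mean_tends r0 _); last by exists B.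
by apply: nearW => N; apply: node_mean_le.
Qed.

Lemma eq_mean c r phi psi : 0 <= r ->
  (forall z, `‖z - c‖ = r -> phi z = psi z) -> mean c r phi = mean c r psi.
Proof.
move=> r0 E; rewrite /mean; congr xget; apply/funext => l; congr tends.
apply/funext => N; apply: eq_edge; first exact: ler01.
by move=> t _; apply: E; apply: circle_modulus.
Qed.

Lemma mean_cst c r a : mean c r (fun=> a) = a.
Proof.
apply: mean_unique; apply: tends_near (tends_cst a).
apply: nearW => N; rewrite /node_mean /comp edge_cst; exact: esym (mul1r a).
Qed.

Lemma meanD c r phi psi : 0 <= r ->
  bounded_on_circle c r phi -> bounded_on_circle c r psi ->
  mean c r (fun z => phi z + psi z) = mean c r phi + mean c r psi.
Proof.
move=> r0 bphi bpsi; apply: mean_unique.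
apply: tends_near (tendsD (mean_tends r0 bphi) (mean_tends r0 bpsi)).
by apply: nearW => N; rewrite /node_mean /comp -edgeD.
Qed.

Lemma meanZ c r a phi : 0 <= r -> bounded_on_circle c r phi ->
  mean c r (fun z => a * phi z) = a * mean c r phi.
Proof.
move=> r0 bphi; apply: mean_unique.
apply: tends_near (tendsM (tends_cst a) (mean_tends r0 bphi)).
by apply: nearW => N; rewrite /node_mean /comp -edgeZ.
Qed.

Lemma bounded_circleD c r phi psi :
  bounded_on_circle c r phi -> bounded_on_circle c r psi ->
  bounded_on_circle c r (fun z => phi z + psi z).
Proof.
move=> [A HA] [B HB]; exists (A + B) => z zr.
by apply: le_trans (modulusD _ _) _; apply: lerD; [apply: HA|apply: HB].
Qed.

Lemma bounded_circleM c r phi psi :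
  bounded_on_circle c r phi -> bounded_on_circle c r psi ->
  bounded_on_circle c r (fun z => phi z * psi z).
Proof.
move=> [A HA] [B HB]; exists (A * B) => z zr; rewrite modulusM.
by apply: ler_pM; rewrite ?modulus_ge0 //; [apply: HA|apply: HB].
Qed.

Lemma bounded_circle_cst c r a : bounded_on_circle c r (fun=> a).
Proof. by exists `‖a‖. Qed.

Lemma bounded_circle_inv c r w : `‖w - c‖ < r ->
  bounded_on_circle c r (fun z => (z - w)^-1).
Proof.
move=> wr; exists (r - `‖w - c‖)^-1 => z zr.
have h : r - `‖w - c‖ <= `‖z - w‖.
  by have := modulus_le_triangle z w c; lra.
rewrite modulusV lef_pV2 // posrE; lra.
Qed.

Lemma meanB c r phi psi : 0 <= r ->
  bounded_on_circle c r phi -> bounded_on_circle c r psi ->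
  mean c r (fun z => phi z - psi z) = mean c r phi - mean c r psi.
Proof.
move=> r0 bphi bpsi.
rewrite -mulN1r -meanZ // -meanD //; last first.
  by apply: bounded_circleM => //; apply: bounded_circle_cst.
by congr mean; apply/funext => z; rewrite mulN1r.
Qed.

Lemma cts_bounded_circle c r phi :
  (forall z, `‖z - c‖ = r -> cts phi z) -> bounded_on_circle c r phi.
Proof.
move=> phic; have [B _ BP] := cts_compact_bounded (@compact_circle R c r) phic.
by exists B.
Qed.

Lemma mean_annulus f c r s : 0 < r -> r <= s ->
  (forall z, r <= `‖z - c‖ <= s -> holo_at f z) -> mean c s f = mean c r f.
Proof.
move=> r0; rewrite le_eqVlt => /predU1P[->//|rs] fh.
have s0 := lt_trans r0 rs.
have br : bounded_on_circle c r f.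
  by apply: cts_bounded_circle => z zr; apply: holo_cts; apply: fh; rewrite zr lexx ltW.
have bs : bounded_on_circle c s f.
  by apply: cts_bounded_circle => z zr; apply: holo_cts; apply: fh; rewrite zr lexx ltW.
apply: modulus_small_eq => e e0.
apply: tends_modulus_le (tendsB (mean_tends (ltW s0) bs) (mean_tends (ltW r0) br)).
exact: near_omega (node_mean_annulus r0 rs fh e0).
Qed.

(** Nodes with the same angle on the circles of radii [r] and [s] are at distance [|r - s|], so
    uniform continuity of [f] makes the mean continuous in the radius. *)
Lemma mean_dist_le f c r s (e : R) : 0 <= r -> 0 <= s ->
  bounded_on_circle c r f -> bounded_on_circle c s f ->
  (forall z z', `‖z - c‖ = s -> `‖z' - z‖ <= `|r - s| -> `‖f z' - f z‖ <= e) ->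
  `‖mean c r f - mean c s f‖ <= e.
Proof.
move=> r0 s0 br bs fe.
apply: tends_modulus_le (tendsB (mean_tends r0 br) (mean_tends s0 bs)).
apply: nearW => N; rewrite /node_mean /comp.
rewrite -mulN1r -edgeZ -edgeD -[leRHS]mul1r; apply: edge_le => // t _.
rewrite mulN1r; apply: fe; first exact: circle_modulus.
rewrite /circle opprD addrACA subrr add0r -mulrBl -ofRB modulusM modulus_ofR.
by rewrite modulus_polar expR0 mulr1.
Qed.

(** The mean does not change with the radius in the punctured disc, and on a tiny circle it is close
    to [f c] by continuity. *)
Lemma mean_value_punctured f c r : 0 < r -> cts f c ->
  (forall z, 0 < `‖z - c‖ <= r -> holo_at f z) -> mean c r f = f c.
Proof.
move=> r0 fc fh; apply: modulus_small_eq => e e0.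
have [d d0 dP] := fc e e0; pose s := Num.min r (d / 2).
have s0 : 0 < s by rewrite lt_min r0 divr_gt0.
have sr : s <= r by rewrite ge_min lexx.
have sd : s < d by apply: (@le_lt_trans _ _ (d / 2)); [rewrite ge_min lexx orbT|lra].
have fs z : `‖z - c‖ = s -> `‖f z - f c‖ <= e.
  by move=> zs; apply: ltW; apply: dP; rewrite zs.
rewrite (@mean_annulus f c s r) //; last first.
  by move=> z /andP[sz zr]; apply: fh; rewrite zr andbT (lt_le_trans s0).
rewrite -[f c](mean_cst c s) -meanB; first exact: mean_le (ltW s0) fs.
- exact: ltW.
- apply: cts_bounded_circle => z zs; apply: holo_cts; apply: fh.
  by rewrite zs s0.
- exact: bounded_circle_cst.
Qed.

(* Continuity of the mean in the radius carries the equality across the circle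
   through the exceptional point w. *)
Lemma mean_value f c w r (rho : R) : `‖w - c‖ < r -> r < rho ->
  (forall z, `‖z - c‖ < rho -> cts f z) ->
  (forall z, `‖z - c‖ < rho -> z != c -> z != w -> holo_at f z) -> mean c r f = f c.
Proof.
move=> wr rrho fc fh; set s := `‖w - c‖ in wr.
have s0 : 0 <= s by apply: modulus_ge0.
have r0 : 0 < r by lra.
have rho0 : 0 < rho by lra.
have bdd t : t < rho -> bounded_on_circle c t f.
  by move=> tr; apply: cts_bounded_circle => z zt; apply: fc; rewrite zt.
have ncw z : 0 < `‖z - c‖ -> z != c by rewrite modulus_gt0 subr_eq0.
have nws z : `‖z - c‖ <> s -> z != w by move=> zs; apply/eqP => zw; apply: zs; rewrite zw.
have fc0 : cts f c by apply: fc; rewrite subrr modulus0.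
have unif (t : R) (e : R) : 0 <= t -> t < rho -> 0 < e -> exists2 d : R, 0 < d &
    forall u, 0 <= u -> u < rho -> `|u - t| <= d -> `‖mean c u f - mean c t f‖ <= e.
  move=> t0 tr e0.
  have [z zt|d d0 dP] := cts_compact_uniform (@compact_circle R c t) (f := f) _ e0.
    by apply: fc; rewrite zt.
  exists d => // u u0 ur ut; apply: mean_dist_le => //; try exact: bdd.
  by move=> z z' zt z'z; apply: dP => //; apply: le_trans ut.
have mean_s : 0 < s -> mean c s f = f c.
  move=> sp; apply: modulus_small_eq => e e0.
  have [d d0 dP] := unif s e s0 (lt_trans wr rrho) e0.
  have [m [m0 md ms]] := exists_pos_lt2 d0 sp.
  have <- : mean c (s - m) f = f c.
    apply: mean_value_punctured => //; first lra.
    by move=> z /andP[z0 zt]; apply: fh; [lra | exact: ncw | apply: nws; lra].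
  rewrite modulusBC; apply: dP; try lra.
  by rewrite ler_norml; apply/andP; split; lra.
have [sp|s0'] := ltP 0 s; last first.
  apply: mean_value_punctured => // z /andP[z0 zr].
  by apply: fh; [lra | exact: ncw | apply: nws; lra].
apply: modulus_small_eq => e e0.
have [d d0 dP] := unif s e s0 (lt_trans wr rrho) e0.
have rs0 : 0 < r - s by lra.
have [m [m0 md ms]] := exists_pos_lt2 d0 rs0.
rewrite -(mean_s sp) (@mean_annulus f c (s + m) r); first last.
- move=> z /andP[z1 z2]; apply: fh; [lra | apply: ncw; lra | apply: nws; lra].
- lra.
- lra.
apply: dP; try lra.
by rewrite ler_norml; apply/andP; split; lra.
Qed.

(** The function tends to 1 at infinity, and its mean is the same over all larger circles. *)
Lemma mean_kernel c w r : `‖w - c‖ < r -> mean c r (fun z => (z - c) / (z - w)) = 1.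
Proof.
move=> wr; have s0 := modulus_ge0 (w - c).
have r0 : 0 < r by lra.
have bk t : `‖w - c‖ < t -> bounded_on_circle c t (fun z => (z - c) / (z - w)).
  move=> wt; apply: bounded_circleM; last exact: bounded_circle_inv.
  by exists t => z ->.
apply: modulus_small_eq => e e0.
(* On this circle [|z - w|] exceeds [|w - c| / e], which makes [(w - c) / (z - w)] at most [e] in
   modulus. *)
pose t := r + `‖w - c‖ / e.
have q0 : 0 <= `‖w - c‖ / e by rewrite divr_ge0 // ltW.
rewrite -(@mean_annulus _ c r t) //; last 2 first.
- by rewrite /t; lra.
- move=> z /andP[zr _].
  apply: holoM; first by apply: holoB; [exact: holo_id | exact: holo_cst].
  apply: holoV; last by apply: holoB; [exact: holo_id | exact: holo_cst].
  rewrite -modulus_gt0; have := modulus_le_triangle z w c; lra.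
rewrite -(mean_cst c t 1) -meanB; first last.
- exact: bounded_circle_cst.
- by apply: bk; rewrite /t; lra.
- by rewrite /t; lra.
apply: mean_le => [|z zt]; first by rewrite /t; lra.
have zw : `‖w - c‖ / e < `‖z - w‖.
  by have := modulus_le_triangle z w c; rewrite zt /t; lra.
have zw0 : 0 < `‖z - w‖ by lra.
have nz : z - w != 0 by rewrite -modulus_gt0.
rewrite (_ : _ - 1 = (w - c) / (z - w)); last by field.
rewrite modulusM modulusV ler_pdivrMr // mulrC.
by move: zw; rewrite ltr_pdivrMr // => /ltW.
Qed.

Section Cauchy.
Variables (f : C -> C) (c : C) (rho : R).
Hypothesis fc : cts f c.
Hypothesis fh : forall z, `‖z - c‖ < rho -> z != c -> holo_at f z.

Let f_cts z : `‖z - c‖ < rho -> cts f z.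
Proof. by move=> zr; have [->//|zc] := eqVneq z c; apply: holo_cts; apply: fh. Qed.

(** Since [dz = i (z - c) dt] on the circle, this is the usual contour integral written as a mean.
    For [w] other than [c] it is the mean value property of [(z - c) (f z - f w) / (z - w)], which
    extends continuously to [w] and vanishes at [c]. At [c] the function [f] is only assumed
    continuous, so that the formula yields removable singularities. *)
Lemma cauchy_formula w r : `‖w - c‖ < r -> r < rho ->
  f w = mean c r (fun z => (z - c) * f z * (z - w)^-1).
Proof.
move=> wr rrho; have s0 := modulus_ge0 (w - c).
have r0 : 0 < r by lra.
have bf : bounded_on_circle c r f.
  by apply: cts_bounded_circle => z zr; apply: f_cts; rewrite zr.
have [wc|wc] := eqVneq w c.
  rewrite wc (@eq_mean c r _ f); first last.
  - move=> z zr; have zc : z - c != 0 by rewrite -modulus_gt0 zr.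
    by field.
  - lra.
  apply/esym/(@mean_value f c c r rho) => //; first by rewrite subrr modulus0.
  by move=> z zr zc _; apply: fh.
have [l fl] : holo_at f w by apply: fh => //; lra.
pose g z := if z == w then (w - c) * l else (z - c) / (z - w) * (f z - f w).
have gE z : z != w -> g z = (z - c) / (z - w) * (f z - f w) by rewrite /g => /negbTE ->.
have kernel_holo z : z != w -> holo_at (fun z => (z - c) / (z - w)) z.
  move=> zw; apply: holoM; first by apply: holoB; [exact: holo_id | exact: holo_cst].
  apply: holoV; last by apply: holoB; [exact: holo_id | exact: holo_cst].
  by rewrite subr_eq0.
have near_ne z : z != w -> 0 < `‖z - w‖ /\ forall z', `‖z' - z‖ < `‖z - w‖ -> z' != w.
  move=> zw; split; first by rewrite modulus_gt0 subr_eq0.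
  by move=> z' zz; apply/eqP => zw'; move: zz; rewrite zw' modulusBC ltxx.
have g_holo z : z != w -> holo_at f z -> holo_at g z.
  move=> zw fz; have [d0 dP] := near_ne z zw.
  apply: (holo_near d0) (holoM (kernel_holo z zw) (holo_subc (f w) fz)).
  by move=> z' /dP zw'; rewrite (gE z' zw').
have g_cts z : `‖z - c‖ < rho -> cts g z.
  move=> zr; have [->|zw] := eqVneq z w; last first.
    have [d0 dP] := near_ne z zw.
    apply: (cts_near d0) (ctsM (holo_cts (kernel_holo z zw)) (ctsB (f_cts zr) (@cts_cst R (f w) z))).
    by move=> z' /dP zw'; rewrite (gE z' zw').
  have := ctsM (ctsB (@cts_id R w) (@cts_cst R c w)) (quotient_cts fl).
  congr cts; apply/funext => z'; rewrite /g /quotient; case: eqVneq => [->//|zw].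
  by rewrite mulrAC mulrA.
have := @mean_value g c w r rho wr rrho g_cts.
have -> : g c = 0 by rewrite gE 1?eq_sym // subrr mul0r mul0r.
have g_holo' z : `‖z - c‖ < rho -> z != c -> z != w -> holo_at g z.
  by move=> zr zc zw; apply: g_holo => //; apply: fh.
move=> /(_ g_holo') g0.
have zwn z : `‖z - c‖ = r -> z - w != 0.
  by move=> zr; rewrite subr_eq0; apply/eqP => zw; move: wr; rewrite -zw zr ltxx.
have bk : bounded_on_circle c r (fun z => (z - c) / (z - w)).
  by apply: bounded_circleM; [exists r => z -> | exact: bounded_circle_inv].
have bphi : bounded_on_circle c r (fun z => (z - c) * f z * (z - w)^-1).
  apply: bounded_circleM; last exact: bounded_circle_inv.
  by apply: bounded_circleM => //; exists r => z ->.
have : mean c r (fun z => (z - c) * f z * (z - w)^-1 - f w * ((z - c) / (z - w))) = 0.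
  rewrite -[RHS]g0; apply: eq_mean => [|z zr]; first lra.
  have zw := zwn _ zr.
  have zw' : z != w by rewrite -subr_eq0.
  rewrite (gE z zw').
  by field.
rewrite meanB ?meanZ ?mean_kernel //; first last.
- by apply: bounded_circleM => //; apply: bounded_circle_cst.
- lra.
- lra.
by rewrite mulr1 => /eqP; rewrite subr_eq0 => /eqP.
Qed.

End Cauchy.
End Mean.

(** * Local theory: removable singularities, orders of zeros, open mapping *)

Section LocalTheory.
Variable R : realType.
Local Notation C := (cplx R).
Implicit Types (f g phi psi : C -> C) (a c z w : C) (r s rho : R).

Section CauchyTransform.
Variables (c : C) (r : R) (phi : C -> C) (B : R).
Hypothesis r0 : 0 <= r.
Hypothesis phiB : forall z, `‖z - c‖ = r -> `‖phi z‖ <= B.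

Definition transform w := mean c r (fun z => phi z * (z - w)^-1).
Definition transform_deriv w := mean c r (fun z => phi z * (z - w)^-1 ^+ 2).

Variables (w w' : C) (d : R).
Hypothesis d0 : 0 < d.
Hypothesis dw : forall z, `‖z - c‖ = r -> d <= `‖z - w‖.
Hypothesis dw' : forall z, `‖z - c‖ = r -> d <= `‖z - w'‖.

Let inv_le z t : d <= `‖z - t‖ -> `‖(z - t)^-1‖ <= d^-1.
Proof. by move=> dt; rewrite modulusV lef_pV2 // posrE //; apply: lt_le_trans dt. Qed.

Let bphi : bounded_on_circle c r phi.
Proof. by exists B. Qed.

Let binv t : (forall z, `‖z - c‖ = r -> d <= `‖z - t‖) ->
  bounded_on_circle c r (fun z => (z - t)^-1).
Proof. by move=> dt; exists d^-1 => z /dt; apply: inv_le. Qed.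

Let nz z t : d <= `‖z - t‖ -> z - t != 0.
Proof. by move=> dt; rewrite -modulus_gt0; apply: lt_le_trans dt. Qed.

Let di : 0 <= d^-1.
Proof. by rewrite invr_ge0 ltW. Qed.

Lemma transform_lip : `‖transform w' - transform w‖ <= B * d^-1 ^+ 2 * `‖w' - w‖.
Proof.
rewrite -meanB //; try by apply: bounded_circleM => //; apply: binv.
apply: mean_le => // z zr.
have z1 := nz (dw zr); have z2 := nz (dw' zr).
rewrite (_ : _ - _ = phi z * ((z - w)^-1 * (z - w')^-1) * (w' - w)); last first.
  by field; rewrite z1 z2.
rewrite !modulusM; apply: ler_wpM2r; first exact: modulus_ge0.
apply: ler_pM; rewrite ?mulr_ge0 ?modulus_ge0 //; first exact: phiB.
by rewrite expr2; apply: ler_pM; rewrite ?modulus_ge0 //; apply: inv_le; [apply: dw|apply: dw'].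
Qed.

(** Differentiation under the mean: [1/(z - w') - 1/(z - w) - (w' - w)/(z - w)^2] equals
    [(w' - w)^2 / ((z - w)^2 (z - w'))], which gives an explicit quadratic error. *)
Lemma transform_quad : `‖transform w' - transform w - transform_deriv w * (w' - w)‖
   <= B * d^-1 ^+ 3 * `‖w' - w‖ ^+ 2.
Proof.
have b2 : bounded_on_circle c r (fun z => phi z * (z - w)^-1 ^+ 2).
  by under eq_fun do rewrite expr2; apply: bounded_circleM => //; apply: bounded_circleM; apply: binv.
rewrite mulrC -meanZ // -meanB //; try by apply: bounded_circleM => //; apply: binv.
rewrite -meanB //; first last.
- by apply: bounded_circleM => //; apply: bounded_circle_cst.
- apply: bounded_circleD; first by apply: bounded_circleM => //; apply: binv.
  under eq_fun do rewrite -mulN1r; apply: bounded_circleM; first exact: bounded_circle_cst.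
  by apply: bounded_circleM => //; apply: binv.
apply: mean_le => // z zr.
have z1 := nz (dw zr); have z2 := nz (dw' zr).
rewrite (_ : _ - _ = phi z * ((z - w)^-1 ^+ 2 * (z - w')^-1) * (w' - w) ^+ 2); last first.
  by field; rewrite z1 z2.
rewrite [X in X <= _]modulusM modulusX modulusM modulusM modulusX; apply: ler_wpM2r; first by rewrite exprn_ge0 ?modulus_ge0.
apply: ler_pM; rewrite ?mulr_ge0 ?exprn_ge0 ?modulus_ge0 //; first exact: phiB.
rewrite [d^-1 ^+ 3]exprSr; apply: ler_pM; rewrite ?exprn_ge0 ?modulus_ge0 //.
  by rewrite ler_pXn2r ?nnegrE ?modulus_ge0 //; apply: inv_le; apply: dw.
by apply: inv_le; apply: dw'.
Qed.

End CauchyTransform.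

Lemma has_deriv_quad f z l (K d : R) : 0 < d ->
  (forall w, `‖w - z‖ < d -> `‖f w - f z - l * (w - z)‖ <= K * `‖w - z‖ ^+ 2) ->
  has_deriv f z l.
Proof.
move=> d0 fK e e0; pose K1 := `|K| + 1.
have K0 : 0 < K1 by rewrite /K1; have := normr_ge0 K; lra.
have KK : K <= K1 by rewrite /K1; have := ler_norm K; lra.
exists (Num.min d (e / K1)) => [|w]; first by rewrite lt_min d0 divr_gt0.
rewrite lt_min => /andP[wd we]; apply: le_trans (fK w wd) _.
have m0 := modulus_ge0 (w - z).
rewrite expr2 mulrA; apply: ler_wpM2r => //.
move: we; rewrite ltr_pdivlMr // mulrC => we.
by apply: le_trans (ltW we); apply: ler_wpM2r.
Qed.

Section PuncturedDisc.
Variables (f : C -> C) (c : C) (rho : R).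
Hypothesis fc : cts f c.
Hypothesis fh : forall z, `‖z - c‖ < rho -> z != c -> holo_at f z.

Let f_cts z : `‖z - c‖ < rho -> cts f z.
Proof. by move=> zr; have [->//|zc] := eqVneq z c; apply: holo_cts; apply: fh. Qed.

Lemma circle_dist w r s z : `‖w - c‖ <= s -> `‖z - c‖ = r -> r - s <= `‖z - w‖.
Proof. by move=> wr zr; have := modulus_le_triangle z w c; lra. Qed.

(** Cauchy's formula holds with mere continuity at the centre, and its right-hand side is
    differentiable in [w]. *)
Lemma removable_holo : 0 < rho -> holo_at f c.
Proof.
move=> rho0; pose r := rho / 2.
have rrho : r < rho by rewrite /r; lra.
have r0 : 0 < r by rewrite /r; lra.
have [B fB] : bounded_on_circle c r (fun z => (z - c) * f z).
  apply: bounded_circleM; first by exists r => z ->.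
  by apply: cts_bounded_circle => z zr; apply: f_cts; rewrite zr.
have tf w : `‖w - c‖ < r -> transform c r (fun z => (z - c) * f z) w = f w.
  by move=> wr; rewrite (cauchy_formula fc fh wr).
exists (transform_deriv c r (fun z => (z - c) * f z) c).
have r2 : 0 < r / 2 by lra.
apply: (@has_deriv_quad _ _ _ (B * (r / 2)^-1 ^+ 3) (r / 2)) => // w wr.
rewrite -!tf; last 2 first.
- by rewrite subrr modulus0.
- lra.
apply: transform_quad => //; first exact: ltW.
  by move=> z ->; lra.
by move=> z zr; have := circle_dist (ltW wr) zr; lra.
Qed.

End PuncturedDisc.

(** Cauchy's formula on the circle of radius [rho / 2], which is at distance at least [rho / 4] from
    [w] and [w']: the constant is [rho / 2 * M * (4 / rho)^2]. In [holo_quad] the exponent is 3. *)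
Lemma holo_lip f c rho (M : R) : 0 < rho ->
  (forall z, `‖z - c‖ < rho -> holo_at f z) ->
  (forall z, `‖z - c‖ < rho -> `‖f z‖ <= M) ->
  forall w w', `‖w - c‖ <= rho / 4 -> `‖w' - c‖ <= rho / 4 ->
    `‖f w' - f w‖ <= 8 * M / rho * `‖w' - w‖.
Proof.
move=> rho0 fh fM w w' wr wr'.
have fc : cts f c by apply: holo_cts; apply: fh; rewrite subrr modulus0.
have fh' z : `‖z - c‖ < rho -> z != c -> holo_at f z by move=> /fh.
have h0 : rho / 2 < rho by lra.
have hB z : `‖z - c‖ = rho / 2 -> `‖(z - c) * f z‖ <= rho / 2 * M.
  by move=> zr; rewrite modulusM zr ler_pM2l ?fM ?zr //; lra.
have := @transform_lip c (rho / 2) _ _ _ hB w w' (rho / 4).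
rewrite /transform -!(cauchy_formula fc fh') //; try lra.
have -> : rho / 2 * M * (rho / 4)^-1 ^+ 2 = 8 * M / rho by field; rewrite gt_eqF.
apply; try lra.
  by move=> z zr; have := circle_dist wr zr; lra.
by move=> z zr; have := circle_dist wr' zr; lra.
Qed.

Lemma holo_quad f c rho (M : R) : 0 < rho ->
  (forall z, `‖z - c‖ < rho -> holo_at f z) ->
  (forall z, `‖z - c‖ < rho -> `‖f z‖ <= M) ->
  exists l, forall w, `‖w - c‖ <= rho / 4 ->
    `‖f w - f c - l * (w - c)‖ <= 32 * M / rho ^+ 2 * `‖w - c‖ ^+ 2.
Proof.
move=> rho0 fh fM.
have fc : cts f c by apply: holo_cts; apply: fh; rewrite subrr modulus0.
have fh' z : `‖z - c‖ < rho -> z != c -> holo_at f z by move=> /fh.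
have h0 : rho / 2 < rho by lra.
have hB z : `‖z - c‖ = rho / 2 -> `‖(z - c) * f z‖ <= rho / 2 * M.
  by move=> zr; rewrite modulusM zr ler_pM2l ?fM ?zr //; lra.
exists (transform_deriv c (rho / 2) (fun z => (z - c) * f z) c) => w wr.
have := @transform_quad c (rho / 2) _ _ _ hB c w (rho / 4).
have cr : `‖c - c‖ < rho / 2 by rewrite subrr modulus0; lra.
rewrite /transform -!(cauchy_formula fc fh') //; try lra.
have -> : rho / 2 * M * (rho / 4)^-1 ^+ 3 = 32 * M / rho ^+ 2 by field; rewrite gt_eqF.
apply; try lra.
  by move=> z ->; lra.
by move=> z zr; have := circle_dist wr zr; lra.
Qed.

Lemma max_modulus f c r (B : R) : 0 < r ->
  (forall z, `‖z - c‖ <= r -> holo_at f z) ->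
  (forall z, `‖z - c‖ = r -> `‖f z‖ <= B) -> `‖f c‖ <= B.
Proof.
move=> r0 fh fB; rewrite -(@mean_value_punctured R f c r) //.
- exact: mean_le (ltW r0) fB.
- by apply: holo_cts; apply: fh; rewrite subrr modulus0 ltW.
- by move=> z /andP[_]; apply: fh.
Qed.

(** The difference quotient extended by [l] is continuous at [c], hence holomorphic there by
    [removable_holo]. *)
Lemma holo_factor f c rho l : 0 < rho ->
  (forall z, `‖z - c‖ < rho -> holo_at f z) -> f c = 0 -> has_deriv f c l ->
  exists g, [/\ forall z, `‖z - c‖ < rho -> holo_at g z, g c = l &
     forall z, f z = (z - c) * g z].
Proof.
move=> rho0 fh fc0 fl; pose g := quotient f c l.
have gE z : z != c -> g z = f z * (z - c)^-1 by rewrite /g /quotient fc0 subr0 => /negbTE ->.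
have g_holo z : `‖z - c‖ < rho -> z != c -> holo_at g z.
  move=> zr zc; have d0 : 0 < `‖z - c‖ by rewrite modulus_gt0 subr_eq0.
  apply: (holo_near d0) (holoM (fh _ zr) (holoV _ (holo_subc c (@holo_id R z)))).
    move=> w wz; rewrite gE //; apply/eqP => wc; move: wz.
    by rewrite wc modulusBC ltxx.
  by rewrite subr_eq0.
exists g; split=> [z zr||z]; last by rewrite mulrC -quotientE fc0 subr0.
  have [->|zc] := eqVneq z c; last exact: g_holo.
  exact: (removable_holo (quotient_cts fl) g_holo).
by rewrite /g /quotient eqxx.
Qed.

Lemma expr_small (q e : R) : 0 <= q -> q < 1 -> 0 < e -> exists n, q ^+ n <= e.
Proof.
move=> q0 q1 e0.
have q1' : `|q| < 1 by rewrite ger0_norm.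
have /cvgrPdist_le /(_ e e0) [n _ nP] := cvg_expr q1'.
exists n; have := nP n (leqnn n); rewrite /= sub0r normrN ger0_norm //.
exact: exprn_ge0.
Qed.

(** Cauchy's formula for the cofactor of [(z - c)^k], on a circle of radius [r] between [|z - c|]
    and [rho], bounds [|f z|] by [(|z - c| / r)^k] times a constant independent of [k]. *)
Lemma flat_zero f c rho : 0 < rho ->
  (forall k, exists2 g, forall z, `‖z - c‖ < rho -> holo_at g z &
     forall z, f z = (z - c) ^+ k * g z) ->
  forall z, `‖z - c‖ < rho -> f z = 0.
Proof.
move=> rho0 fk z zr.
pose r := (`‖z - c‖ + rho) / 2.
have rr : r < rho by rewrite /r; lra.
have zr' : `‖z - c‖ < r by rewrite /r; lra.
have z0 := modulus_ge0 (z - c).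
have r0 : 0 < r by lra.
have [B fB] : bounded_on_circle c r f.
  have [g gh fg] := fk 0%N; apply: cts_bounded_circle => w wr.
  apply: holo_cts; apply: (@holo_near R g f w 1) => // [t _|]; first by rewrite fg mul1r.
  by apply: gh; rewrite wr.
have B0 : 0 <= B.
  apply: le_trans (fB (c + ofR r) _); first exact: modulus_ge0.
  by rewrite modulus_shift.
pose q := `‖z - c‖ / r.
have q0 : 0 <= q by rewrite divr_ge0 // ltW.
have q1 : q < 1 by rewrite ltr_pdivrMr // mul1r.
pose A := B * r / (r - `‖z - c‖) + 1.
have A1 : 0 <= B * r / (r - `‖z - c‖) by apply: divr_ge0; [apply: mulr_ge0 => //; exact: ltW | lra].
have fA k : `‖f z‖ <= q ^+ k * A.
  have [g gh fg] := fk k.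
  have gc : cts g c by apply: holo_cts; apply: gh; rewrite subrr modulus0.
  have gh' w : `‖w - c‖ < rho -> w != c -> holo_at g w by move=> /gh.
  rewrite fg (cauchy_formula gc gh' zr' rr) modulusM modulusX.
  have rk : 0 < r ^+ k by rewrite exprn_gt0.
  rewrite /q expr_div_n -mulrA; apply: ler_wpM2l; first by rewrite exprn_ge0.
  apply: mean_le (ltW r0) _ => w wr; rewrite !modulusM wr modulusV.
  have gB : `‖g w‖ <= B / r ^+ k.
    by rewrite ler_pdivlMr // mulrC -wr -modulusX -modulusM -fg; apply: fB.
  have wz : r - `‖z - c‖ <= `‖w - z‖ by exact: circle_dist (lexx _) wr.
  have wz0 : 0 < `‖w - z‖ by apply: lt_le_trans wz; rewrite subr_gt0.
  rewrite ler_pdivrMr //.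
  apply: le_trans (_ : r * (B / r ^+ k) <= _); first by rewrite ler_pM2l.
  have -> : r * (B / r ^+ k) = (r ^+ k)^-1 * (B * r) by ring.
  rewrite -mulrA; apply: ler_wpM2l; first by rewrite invr_ge0 ltW.
  have d0 : 0 < r - `‖z - c‖ by rewrite subr_gt0.
  apply: le_trans (_ : (B * r / (r - `‖z - c‖)) * (r - `‖z - c‖) <= _).
    by rewrite divfK // gt_eqF.
  by apply: ler_pM => //; rewrite ?ltW // /A ltrDl.
apply: modulus_small_eq => e e0; rewrite subr0.
have A0 : 0 < A by rewrite /A; lra.
have [n nP] := expr_small q0 q1 (divr_gt0 e0 A0).
by apply: le_trans (fA n) _; rewrite -ler_pdivlMr.
Qed.

(** The order of a zero without power series: factors [z - c] are split off as long as the cofactor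
    vanishes at [c], and if this never stops then [flat_zero] applies. *)
Lemma holo_order f c rho : 0 < rho ->
  (forall z, `‖z - c‖ < rho -> holo_at f z) ->
  (forall z, `‖z - c‖ < rho -> f z = 0) \/
  exists k g, [/\ forall z, `‖z - c‖ < rho -> holo_at g z, g c != 0 &
     forall z, f z = (z - c) ^+ k * g z].
Proof.
move=> rho0 fh; have [|nk] := pselect (exists k g,
  [/\ forall z, `‖z - c‖ < rho -> holo_at g z, g c != 0 &
     forall z, f z = (z - c) ^+ k * g z]); first by right.
left; apply: flat_zero => // k; elim: k => [|k [g gh fg]].
  by exists f => // z; rewrite mul1r.
have gc : g c = 0.
  by apply/eqP; apply: contrapT => /negP gc; apply: nk; exists k, g.
have [l gl] : holo_at g c by apply: gh; rewrite subrr modulus0.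
have [h [hh _ gE]] := holo_factor rho0 gh gc gl.
by exists h => // z; rewrite fg gE mulrA exprSr.
Qed.

Lemma cts_neq0 f z : cts f z -> f z != 0 ->
  exists2 d : R, 0 < d & forall w, `‖w - z‖ < d -> f w != 0.
Proof.
rewrite -modulus_gt0 => fz f0; have [d d0 dP] := fz _ f0.
exists d => // w /dP; rewrite -modulus_gt0.
have := modulus_le_triangle (f z) (f w) 0; rewrite !subr0 (modulusBC (f z)); lra.
Qed.

Lemma isolated_zero f c rho : 0 < rho ->
  (forall z, `‖z - c‖ < rho -> holo_at f z) ->
  (forall z, `‖z - c‖ < rho -> f z = 0) \/
  exists2 d : R, 0 < d & forall z, `‖z - c‖ < d -> z != c -> f z != 0.
Proof.
move=> rho0 fh; have [?|[k [g [gh gc fg]]]] := holo_order rho0 fh; [by left|right].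
have g_cts : cts g c by apply: holo_cts; apply: gh; rewrite subrr modulus0.
have [d d0 dP] := cts_neq0 g_cts gc.
by exists d => // z /dP gz zc; rewrite fg mulf_neq0 // expf_neq0 // subr_eq0.
Qed.

(* If f_i - v had no zero inside a small circle around a, then 1/(f_i - v)
   would violate the maximum principle; this gives the open mapping theorem and
   Hurwitz's theorem at once. *)
Lemma near_open_mapping (T : Type) (F : set_system T) {FF : ProperFilter F}
    (h : T -> C -> C) f a rho :
  0 < rho -> (forall z, `‖z - a‖ < rho -> holo_at f z) ->
  (\forall i \near F, forall z, `‖z - a‖ < rho -> holo_at (h i) z) ->
  (forall e, 0 < e -> \forall i \near F, forall z, `‖z - a‖ < rho -> `‖h i z - f z‖ < e) ->
  ~ (forall z, `‖z - a‖ < rho -> f z = f a) ->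
  forall s, 0 < s -> exists2 m, 0 < m & \forall i \near F, forall v,
    `‖v - f a‖ < m -> exists2 z, `‖z - a‖ < s & h i z = v.
Proof.
move=> rho0 fh hh hf fnc s0 s00.
have gh z : `‖z - a‖ < rho -> holo_at (fun z => f z - f a) z.
  by move=> /fh fz; apply: (holo_subc (f a) fz).
have [g0|[d d0 dP]] := isolated_zero rho0 gh.
  by exfalso; apply: fnc => z zr; apply/eqP; rewrite -subr_eq0; apply/eqP; apply: g0.
have [|s sp /and4P[sd srho ss0 _]] := @exists_pos_lt R [:: d; rho; s0].
  by rewrite /= d0 rho0 s00.
have zne z : `‖z - a‖ = s -> f z - f a != 0.
  by move=> zs; apply: dP; [lra | rewrite -subr_eq0 -modulus_gt0; lra].
have [B B0 BP] : exists2 B, 0 < B & forall z, `‖z - a‖ = s -> `‖(f z - f a)^-1‖ <= B.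
  apply: (cts_compact_bounded (@compact_circle R a s)) => z /= zs.
  by apply: ctsV; [exact: zne | apply: holo_cts; apply: gh; lra].
pose mu := B^-1; have mu0 : 0 < mu by rewrite invr_gt0.
have mu4 : 0 < mu / 4 by lra.
have fmu z : `‖z - a‖ = s -> mu <= `‖f z - f a‖.
  move=> zs; have := BP z zs; rewrite modulusV /mu => H.
  by rewrite -[leRHS]invrK lef_pV2 // posrE invr_gt0 modulus_gt0 zne.
(* Both errors stay below [mu / 4], so [|h i z - v|] is at least [mu / 2] on the circle and smaller
   than [mu / 2] at [a], contrary to the maximum principle for the inverse of [h i - v]. *)
exists (mu / 4) => //; apply: filterS2 hh (hf _ mu4) => i hih hif v vm.
apply: contrapT => nv.
have nvz z : `‖z - a‖ < s -> h i z - v != 0.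
  by move=> zs; rewrite subr_eq0; apply/eqP => zv; apply: nv; exists z => //; lra.
have circ z : `‖z - a‖ = s -> mu / 2 <= `‖h i z - v‖.
  move=> zs; have zr : `‖z - a‖ < rho by lra.
  have := hif z zr; have := fmu z zs.
  have := modulus_le_triangle (f z) (h i z) (f a); have := modulus_le_triangle (h i z) v (f a).
  by rewrite (modulusBC (f z) (h i z)); lra.
have : `‖(h i a - v)^-1‖ <= 2 / mu.
  apply: (@max_modulus (fun z => (h i z - v)^-1) a s) => // z zs.
    apply: holoV; last first.
      by apply: (holo_subc v _); apply: hih; lra.
    have [zs'|zs'] := ltP `‖z - a‖ s; first exact: nvz.
    by rewrite -modulus_gt0; apply: lt_le_trans (circ _ _); lra.
  rewrite modulusV -[2 / mu]invrK lef_pV2 ?posrE ?invf_div; first exact: circ.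
    by apply: lt_le_trans (circ _ zs); lra.
  by rewrite divr_gt0.
have aa : `‖a - a‖ < s by rewrite subrr modulus0.
have ar : `‖a - a‖ < rho by lra.
have hav : 0 < `‖h i a - v‖ by rewrite modulus_gt0; apply: nvz.
rewrite modulusV ler_pdivlMr // ler_pdivrMl // => H.
have := hif a ar; have := modulus_le_triangle (h i a) (f a) v.
by rewrite (modulusBC (f a) v); lra.
Qed.

End LocalTheory.

Section DerivativeProduct.
Variable K : numClosedFieldType.
Implicit Types (f g : K -> K) (z l m : K).

Lemma is_derive_quotient f z l : is_derive z 1 f l <->
  h^-1 *: ((f \o shift z) (h *: 1) - f z) @[h --> 0^'] --> l.
Proof.
split=> [[df <-]|fl]; first exact: df.
have df : derivable f z 1 by apply/cvg_ex; exists l.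
by split=> //; apply: (cvg_unique _ df fl); apply: norm_hausdorff.
Qed.

Lemma is_deriveM_closed f g z l m : is_derive z 1 f l -> is_derive z 1 g m ->
  is_derive z 1 (fun w => f w * g w) (f z * m + g z * l).
Proof. by move=> df dg; exact: (@is_deriveM K K f g z 1 l m). Qed.

End DerivativeProduct.

(** * Identity, open mapping, Hurwitz, Montel and inverse function theorems on domains *)

Section Domains.
Variable R : realType.
Local Notation C := (cplx R).
Implicit Types (f g : C -> C) (a b c z w : C) (U V : set C).

Lemma has_derivM f g z l m : has_deriv f z l -> has_deriv g z m ->
  has_deriv (fun w => f w * g w) z (f z * m + g z * l).
Proof.
move=> /has_derivP /(iffRL (is_derive_quotient _ _ _)) fl.
move=> /has_derivP /(iffRL (is_derive_quotient _ _ _)) gm.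
apply/has_derivP.
exact: (iffLR (is_derive_quotient _ _ _) (@is_deriveM_closed C f g z l m fl gm)).
Qed.

Lemma has_deriv_id z : has_deriv id z 1.
Proof. by move=> e e0; exists 1 => // w _; rewrite mul1r subrr modulus0 mulr_ge0 ?modulus_ge0 // ltW. Qed.

Lemma has_deriv_shift f b z l : has_deriv f z l -> has_deriv (fun w => f w - b) z l.
Proof.
move=> fl e /fl[d d0 dP]; exists d => // w /dP; congr (_ <= _); congr modulus; ring.
Qed.

Lemma has_derivX a z n :
  has_deriv (fun w => (w - a) ^+ n.+1) z (n.+1%:R * (z - a) ^+ n).
Proof.
elim: n => [|n IH].
  have := has_deriv_shift a (has_deriv_id z); rewrite mulr1.
  by congr (has_deriv _ _ _); apply/funext => w; rewrite expr1.
have := has_derivM (has_deriv_shift a (has_deriv_id z)) IH.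
congr (has_deriv _ _ _).
by rewrite mulr1 mulrCA -exprS -[X in _ + X]mul1r -mulrDl natr1.
Qed.

Lemma has_deriv_le f z l (K d : R) : 0 < d ->
  (forall w, `‖w - z‖ < d -> `‖f w - f z‖ <= K * `‖w - z‖) ->
  has_deriv f z l -> `‖l‖ <= K.
Proof.
move=> d0 fK fl; apply/ler_addgt0Pr => e e0.
have [s s0 sP] := fl e e0.
have [t [t0 td ts]] := exists_pos_lt2 d0 s0.
have ht : `‖z + ofR t - z‖ = t by rewrite modulus_shift.
have := fK (z + ofR t); have := sP (z + ofR t); rewrite ht => /(_ ts) h1 /(_ td) h2.
have := modulus_dist (l * (z + ofR t - z)) (f (z + ofR t) - f z).
rewrite modulusM ht [X in _ <= X](modulusBC _ (f _ - f z)) => h3.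
rewrite -(ler_pM2r t0) mulrDl; lra.
Qed.

Definition opn U := forall z, U z -> exists2 r : R, 0 < r & forall w, `‖w - z‖ < r -> U w.

Lemma opnP U : open U <-> opn U.
Proof. exact: open_discP. Qed.

(* Connectedness: a subset that is open and closed in U and nonempty is U. *)
Definition conn U := forall P : C -> Prop,
  (forall z, U z -> P z -> exists2 r : R, 0 < r & forall w, U w -> `‖w - z‖ < r -> P w) ->
  (forall z, U z -> ~ P z -> exists2 r : R, 0 < r & forall w, U w -> `‖w - z‖ < r -> ~ P w) ->
  forall a b, U a -> U b -> P a -> P b.

Definition holo_on U f := forall z, U z -> holo_at f z.

Definition injective_on U f := forall z w, U z -> U w -> f z = f w -> z = w.

(** Locally uniform convergence along a filter; the neighbourhood is chosen before the error. *)
Definition luc (T : Type) (F : set_system T) U (h : T -> C -> C) f :=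
  forall z, U z -> exists2 r : R, 0 < r & forall e : R, 0 < e ->
    \forall i \near F, forall w, `‖w - z‖ < r -> `‖h i w - f w‖ < e.

Lemma holo_onB U f b : holo_on U f -> holo_on U (fun z => f z - b).
Proof. by move=> fU z /fU fz; apply: (holo_subc b fz). Qed.

(** The points near which [f] vanishes form an open set, and since zeros are otherwise isolated, its
    complement in [U] is open too. *)
Lemma identity_theorem U f a r : opn U -> conn U -> holo_on U f ->
  U a -> 0 < r -> (forall z, `‖z - a‖ < r -> f z = 0) -> forall z, U z -> f z = 0.
Proof.
move=> oU cU fU Ua r0 fa z Uz.
pose P z := exists2 r : R, 0 < r & forall w, `‖w - z‖ < r -> f w = 0.
suff : P z by move=> [s s0 /(_ z)]; apply; rewrite subrr modulus0.
apply: (cU P _ _ a z) => //; last by exists r.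
  move=> t Ut [s s0 sP]; exists (s / 2); first lra.
  move=> w _ wt; exists (s / 2); first lra.
  by move=> u uw; apply: sP; have := modulus_le_triangle u w t; lra.
move=> t Ut nPt; have [s s0 sU] := oU t Ut.
have fs u : `‖u - t‖ < s -> holo_at f u by move=> /sU; apply: fU.
have [f0|[d d0 dP]] := isolated_zero s0 fs.
  by exfalso; apply: nPt; exists s.
exists d => // w _ wd [u u0 uP]; have [wt|wt] := eqVneq w t.
  by apply: nPt; exists u => //; rewrite -wt.
by have /eqP[] := dP w wd wt; apply: uP; rewrite subrr modulus0.
Qed.

Lemma nonconstant_near U f a b : opn U -> conn U -> holo_on U f ->
  U a -> U b -> f a <> f b ->
  forall z r, U z -> 0 < r -> ~ (forall w, `‖w - z‖ < r -> f w = f z).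
Proof.
move=> oU cU fU Ua Ub fab z r Uz r0 fz; apply: fab.
have E := identity_theorem oU cU (@holo_onB U f (f z) fU) Uz r0.
have {}E : forall w, U w -> f w - f z = 0.
  by apply: E => w /fz ->; rewrite subrr.
have /eqP := E a Ua; have /eqP := E b Ub.
by rewrite !subr_eq0 => /eqP-> /eqP->.
Qed.

Lemma luc_open_mapping (T : Type) (F : set_system T) {FF : ProperFilter F}
    U (h : T -> C -> C) f a : opn U -> holo_on U f ->
  (\forall i \near F, holo_on U (h i)) -> luc F U h f -> U a ->
  (forall r, 0 < r -> ~ (forall w, `‖w - a‖ < r -> f w = f a)) ->
  forall s, 0 < s -> exists2 m, 0 < m & \forall i \near F, forall v,
    `‖v - f a‖ < m -> exists2 z, `‖z - a‖ < s & h i z = v.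
Proof.
move=> oU fU hU hf Ua nc s s0.
have [r1 r10 r1U] := oU a Ua; have [r2 r20 r2P] := hf a Ua.
have r0 : 0 < Num.min r1 r2 by rewrite lt_min r10.
apply: (@near_open_mapping R T F _ h f a (Num.min r1 r2)) => //.
- by move=> z; rewrite lt_min => /andP[zr _]; apply/fU/r1U.
- by apply: filterS hU => i hi z; rewrite lt_min => /andP[zr _]; apply/hi/r1U.
- move=> e e0; apply: filterS (r2P e e0) => i hi z.
  by rewrite lt_min => /andP[_]; apply: hi.
- exact: nc.
Qed.

Lemma open_mapping U f a : opn U -> holo_on U f -> U a ->
  (forall r, 0 < r -> ~ (forall w, `‖w - a‖ < r -> f w = f a)) ->
  forall s, 0 < s -> exists2 m, 0 < m & forall v,
    `‖v - f a‖ < m -> exists2 z, `‖z - a‖ < s & f z = v.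
Proof.
move=> oU fU Ua nc s s0.
have fl : luc omega U (fun _ : nat => f) f.
  move=> z Uz; exists 1 => // e e0; apply: nearW => i w _.
  by rewrite subrr modulus0.
have fh : \forall i \near omega, holo_on U ((fun _ : nat => f) i) by apply: nearW.
have [m m0 mP] := luc_open_mapping oU fU fh fl Ua nc s0.
by exists m => //; have [j] := filter_ex mP.
Qed.

(** A nonconstant [f] would be open at [b] and take a value [(1 + m / 2) * f b], of modulus above
    1. *)
Lemma strong_max_modulus U f b : opn U -> conn U -> holo_on U f ->
  (forall z, U z -> `‖f z‖ <= 1) -> U b -> `‖f b‖ = 1 -> forall z, U z -> f z = f b.
Proof.
move=> oU cU fU f1 Ub fb1 z Uz; apply: contrapT => fzb.
have [s s0 sU] := oU b Ub.
have nc := nonconstant_near oU cU fU Uz Ub fzb.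
have [m m0 mP] := open_mapping oU fU Ub (fun r => nc b r Ub) s0.
have [|w ws fw] := mP (ofR (1 + m / 2) * f b).
  rewrite -{2}[f b]mul1r -mulrBl modulusM fb1 mulr1 -ofR1 -ofRB modulus_ofR.
  by rewrite addrAC subrr add0r gtr0_norm; lra.
have := f1 w (sU w ws); rewrite fw modulusM modulus_ofR fb1 mulr1 gtr0_norm; lra.
Qed.

(** If [f a = f b], then [h i z - h i b] tends to a function vanishing at [a], so by the uniform
    open mapping theorem it has a zero closer to [a] than [b] is, against injectivity of [h i]. The
    points [a0] and [b0] exclude a constant limit. *)
Lemma hurwitz_injective (T : Type) (F : set_system T) {FF : ProperFilter F}
    U (h : T -> C -> C) f a0 b0 : opn U -> conn U -> holo_on U f ->
  (\forall i \near F, holo_on U (h i)) -> (\forall i \near F, injective_on U (h i)) ->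
  luc F U h f -> U a0 -> U b0 -> f a0 <> f b0 -> injective_on U f.
Proof.
move=> oU cU fU hU hinj hf Ua0 Ub0 fab0 a b Ua Ub fab; apply: contrapT => ab.
have [r r0 rU] := oU a Ua.
have gl : luc F U (fun i z => h i z - h i b) (fun z => f z - f b).
  move=> z Uz; have [r1 r10 r1P] := hf z Uz; have [r2 r20 r2P] := hf b Ub.
  exists r1 => // e e0; have e2 : 0 < e / 2 by lra.
  apply: filterS2 (r1P _ e2) (r2P _ e2) => i h1 h2 w wz.
  rewrite (_ : _ - _ - _ = (h i w - f w) - (h i b - f b)); last by ring.
  apply: le_lt_trans (modulusD _ _) _; rewrite modulusN.
  have := h1 w wz; have := h2 b; rewrite subrr modulus0 => /(_ r20); lra.
have gh : \forall i \near F, holo_on U ((fun i z => h i z - h i b) i).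
  by apply: filterS hU => i; apply: holo_onB.
have nc z : U z -> forall r, 0 < r -> ~ forall w, `‖w - z‖ < r -> f w - f b = f z - f b.
  move=> Uz s s0 fs; apply: (nonconstant_near oU cU fU Ua0 Ub0 fab0 Uz s0).
  by move=> w /fs /eqP; rewrite -subr_eq0 opprB addrA subrK subr_eq0 => /eqP.
have ab0 : 0 < `‖a - b‖ by rewrite modulus_gt0 subr_eq0; apply/eqP.
have s0 : 0 < Num.min r `‖a - b‖ by rewrite lt_min r0.
have [m m0 mP] := luc_open_mapping oU (@holo_onB U f (f b) fU) gh gl Ua (nc a Ua) s0.
have [i [inj_i imv]] := filter_ex (filterI hinj mP).
have [|z] := imv 0; first by rewrite fab subrr subrr modulus0.
rewrite lt_min => /andP[zr zab] /eqP; rewrite subr_eq0 => /eqP hz.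
have zb := inj_i z b (rU z zr) Ub hz.
by move: zab; rewrite zb modulusBC ltxx.
Qed.

(** Along an ultrafilter the bounded values [h i z] converge at each point. Cauchy's estimates make
    the family uniformly Lipschitz on small discs, which upgrades this to local uniformity. The
    derivatives at a point are bounded as well, and the quadratic estimate passes to the limit, with
    their limit as derivative. *)
Lemma montel (T : Type) (F : set_system T) {FF : UltraFilter F} U (h : T -> C -> C) :
  (forall z, U z -> exists r M : R, 0 < r /\ \forall i \near F,
     forall w, `‖w - z‖ < r -> holo_at (h i) w /\ `‖h i w‖ <= M) ->
  exists2 f, holo_on U f & luc F U h f.
Proof.
move=> hU; have PF : ProperFilter F := ultra_proper.
pose f z := xget 0 [set l | tends F (fun i => h i z) l].
have fP z (M : R) : (\forall i \near F, `‖h i z‖ <= M) -> tends F (fun i => h i z) (f z).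
  move=> hM; have [l lP] := ultra_bounded_tends FF hM.
  by rewrite /f; case: xgetP => [x _ //|/(_ l)].
have loc z : U z -> exists r K Q : R, [/\ 0 < r, 0 < K,
    forall w, `‖w - z‖ <= r -> tends F (fun i => h i w) (f w) & \forall i \near F,
    (forall w w', `‖w - z‖ <= r -> `‖w' - z‖ <= r -> `‖h i w' - h i w‖ <= K * `‖w' - w‖) /\
    exists l, `‖l‖ <= K /\ forall w, `‖w - z‖ <= r ->
      `‖h i w - h i z - l * (w - z)‖ <= Q * `‖w - z‖ ^+ 2].
  move=> /hU[s [M [s0 hM]]].
  have M0 : 0 <= M.
    have [i /(_ z)] := filter_ex hM; rewrite subrr modulus0 => /(_ s0)[_].
    exact: le_trans (modulus_ge0 _).
  have K0 : 0 <= 8 * M / s by rewrite divr_ge0 ?mulr_ge0 // ltW.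
  exists (s / 4), (8 * M / s + 1), (32 * M / s ^+ 2); split; try lra.
    move=> w ws; apply: (fP w M); apply: filterS hM => i hi.
    by have [|] := hi w; first lra.
  apply: filterS hM => i hi.
  have hh w (ws : `‖w - z‖ < s) := (hi w ws).1; have hB w (ws : `‖w - z‖ < s) := (hi w ws).2.
  have lip w w' : `‖w - z‖ <= s / 4 -> `‖w' - z‖ <= s / 4 ->
      `‖h i w' - h i w‖ <= (8 * M / s + 1) * `‖w' - w‖.
    move=> ws ws'; apply: le_trans (holo_lip s0 hh hB ws ws') _.
    by apply: ler_wpM2r; [exact: modulus_ge0 | lra].
  split=> //; have [l lP] := holo_quad s0 hh hB; exists l; split=> //.
  have s4 : 0 < s / 4 by lra.
  apply: (has_deriv_le s4) (has_deriv_quad s4 (fun w ws => lP w (ltW ws))) => w ws.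
  by apply: lip; [rewrite subrr modulus0 ltW | exact: ltW].
exists f => z Uz; have [r [K [Q [r0 K0 ft hP]]]] := loc z Uz.
  have /choice[l lP] : forall i, exists l, (exists l, `‖l‖ <= K /\ forall w, `‖w - z‖ <= r ->
      `‖h i w - h i z - l * (w - z)‖ <= Q * `‖w - z‖ ^+ 2) ->
      `‖l‖ <= K /\ forall w, `‖w - z‖ <= r ->
      `‖h i w - h i z - l * (w - z)‖ <= Q * `‖w - z‖ ^+ 2.
    move=> i; case: (pselect (exists l, `‖l‖ <= K /\ forall w, `‖w - z‖ <= r ->
      `‖h i w - h i z - l * (w - z)‖ <= Q * `‖w - z‖ ^+ 2)) => [[l ?]|?]; [by exists l | by exists 0].
  have [|l0 l0P] := @ultra_bounded_tends R T F FF l K.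
    by apply: filterS hP => i [_ /lP[]].
  exists l0; apply: (@has_deriv_quad _ _ _ _ Q r) => // w wr.
  have zr : `‖z - z‖ <= r by rewrite subrr modulus0 ltW.
  apply: tends_modulus_le
    (tendsB (tendsB (ft w (ltW wr)) (ft z zr)) (tendsM l0P (tends_cst (w - z)))).
  by apply: filterS hP => i [_ /lP[_]]; apply; exact: ltW.
have fK w w' : `‖w - z‖ <= r -> `‖w' - z‖ <= r -> `‖f w' - f w‖ <= K * `‖w' - w‖.
  move=> wr wr'; apply: tends_modulus_le (tendsB (ft w' wr') (ft w wr)).
  by apply: filterS hP => i [hi _]; apply: hi.
exists (r / 2) => [|e e0]; first lra.
suff : \forall i \near F, forall w, [set w : C | `‖w - z‖ <= r / 2] w -> `‖h i w - f w‖ < e.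
  by apply: filterS => i hi w /ltW; apply: hi.
apply: near_compact; first exact: compact_closed_disc.
move=> w /= wr; have e4 : 0 < e / 4 by lra.
have r2 : 0 < r / 2 by lra.
have [d [d0 dr]] := exists_pos_lt2 r2 (divr_gt0 e4 K0).
rewrite ltr_pdivlMr // mulrC => de.
have w4 : `‖w - z‖ <= r by lra.
exists d => //; apply: filterS2 hP (ft w w4 _ e4) => i [hi _] hw w' w'd.
have w'4 : `‖w' - z‖ <= r by have := modulus_le_triangle w' w z; lra.
have k1 := hi _ _ w4 w'4; have k2 := fK _ _ w4 w'4.
have kd : K * `‖w' - w‖ < K * d by rewrite ltr_pM2l.
have := modulus_le_triangle (h i w') (h i w) (f w'); have := modulus_le_triangle (h i w) (f w) (f w').
by rewrite (modulusBC (f w)); lra.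
Qed.

Section Inverse.
Variables (U : set C) (f k : C -> C).
Hypotheses (oU : opn U) (fU : holo_on U f) (finj : injective_on U f).
Hypothesis kf : forall z, U z -> k (f z) = z.

Let nc a : U a -> forall r, 0 < r -> ~ (forall w, `‖w - a‖ < r -> f w = f a).
Proof.
move=> Ua r r0 fa; have [s s0 sU] := oU Ua.
have [t [t0 tr ts]] := exists_pos_lt2 r0 s0.
have ht : `‖a + ofR t - a‖ = t by rewrite modulus_shift.
have h1 : f (a + ofR t) = f a by apply: fa; rewrite ht.
have h2 : U (a + ofR t) by apply: sU; rewrite ht.
by have h3 := finj h2 Ua h1; move: ht; rewrite h3 subrr modulus0; lra.
Qed.

Lemma image_open_at a : U a -> forall s : R, 0 < s -> exists2 m : R, 0 < m & forall v,
    `‖v - f a‖ < m -> exists z, [/\ U z, `‖z - a‖ < s & f z = v].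
Proof.
move=> Ua s s0; have [r r0 rU] := oU Ua.
have m0 : 0 < Num.min r s by rewrite lt_min r0.
have [m mp mP] := open_mapping oU fU Ua (nc Ua) m0.
exists m => // v /mP[z]; rewrite lt_min => /andP[zr zs] fz.
by exists z; split => //; apply: rU.
Qed.

Lemma image_open : opn (f @` U).
Proof.
move=> _ [a Ua <-]; have [m m0 mP] := image_open_at Ua ltr01.
by exists m => // v /mP[z [Uz _ <-]]; exists z.
Qed.

Lemma inverse_cts a : U a -> cts k (f a).
Proof.
move=> Ua e e0; have [m m0 mP] := image_open_at Ua e0.
by exists m => // v /mP[z [Uz za <-]]; rewrite !kf.
Qed.

Lemma inverse_deriv a l : U a -> has_deriv f a l -> l != 0 -> has_deriv k (f a) l^-1.
Proof.
move=> Ua fl l0 e e0; have lp : 0 < `‖l‖ by rewrite modulus_gt0.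
pose e1 := Num.min (`‖l‖ / 2) (e * `‖l‖ ^+ 2 / 2).
have l2 : 0 < `‖l‖ ^+ 2 by rewrite exprn_gt0.
have e10 : 0 < e1 by rewrite lt_min !divr_gt0 // mulr_gt0.
have e1l : e1 <= `‖l‖ / 2 by rewrite ge_min lexx.
have e1e : e1 <= e * `‖l‖ ^+ 2 / 2 by rewrite ge_min lexx orbT.
clearbody e1.
have [s s0 sP] := fl _ e10; have [m m0 mP] := image_open_at Ua s0.
exists m => // v /mP[z [Uz za <-]]; rewrite !kf //.
have H := sP z za; have za0 := modulus_ge0 (z - a).
rewrite (_ : z - a - l^-1 * (f z - f a) = - l^-1 * (f z - f a - l * (z - a))); last by field.
have := modulus_dist (l * (z - a)) (f z - f a).
rewrite modulusM (modulusBC (l * _)) => h1.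
rewrite modulusM modulusN modulusV.
have h2 : `‖l‖ * `‖z - a‖ <= 2 * `‖f z - f a‖.
  have : e1 * `‖z - a‖ <= `‖l‖ / 2 * `‖z - a‖ by apply: ler_wpM2r.
  lra.
rewrite ler_pdivrMl //; apply: (le_trans H).
apply: le_trans (_ : e * `‖l‖ ^+ 2 / 2 * `‖z - a‖ <= _); first exact: ler_wpM2r.
have -> : e * `‖l‖ ^+ 2 / 2 * `‖z - a‖ = e * `‖l‖ / 2 * (`‖l‖ * `‖z - a‖) by ring.
apply: le_trans (_ : e * `‖l‖ / 2 * (2 * `‖f z - f a‖) <= _).
  by apply: ler_wpM2l => //; rewrite divr_ge0 // mulr_ge0 // ltW.
by rewrite le_eqVlt; apply/orP; left; apply/eqP; field.
Qed.

(** Near [a] one has [f z - f a = (z - a)^(n+1) g z] with [g a] nonzero; then [f' z] is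
    [(z - a)^n ((n + 1) g z + (z - a) g' z)], where the first summand dominates because [g'] is
    bounded. *)
Lemma deriv_neq0_near a : U a -> exists2 d : R, 0 < d & forall z l,
  `‖z - a‖ < d -> z != a -> has_deriv f z l -> l != 0.
Proof.
move=> Ua; have [r r0 rU] := oU Ua.
have gh z : `‖z - a‖ < r -> holo_at (fun z => f z - f a) z.
  by move=> /rU /fU fz; apply: (holo_subc (f a) fz).
have [g0|[n [g [gU ga fg]]]] := holo_order r0 gh.
  by exfalso; apply: (nc Ua r0) => w /g0 /eqP; rewrite subr_eq0 => /eqP.
have ar : `‖a - a‖ < r by rewrite subrr modulus0.
case: n fg => [|n] fg.
  have := fg a; rewrite subrr mul1r => g0; by rewrite -g0 eqxx in ga.
have gcts := holo_cts (gU _ ar).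
have ga0 : 0 < `‖g a‖ by rewrite modulus_gt0.
have ga2 : 0 < `‖g a‖ / 2 by lra.
have [d1 d10 d1P] := gcts _ ga2.
pose d2 := Num.min d1 r.
have d20 : 0 < d2 by rewrite lt_min d10.
have gB z : `‖z - a‖ < d2 -> `‖g z‖ <= 2 * `‖g a‖.
  rewrite lt_min => /andP[/d1P gz _].
  by have := modulusD (g z - g a) (g a); rewrite subrK; lra.
have gU' z : `‖z - a‖ < d2 -> holo_at g z.
  by rewrite lt_min => /andP[_ zr]; apply: gU.
have glip := holo_lip d20 gU' gB.
pose L := 8 * (2 * `‖g a‖) / d2 + 1.
have L1 : 0 <= 8 * (2 * `‖g a‖) / d2 by rewrite divr_ge0 ?mulr_ge0 // ltW.
have L0 : 0 < L by rewrite /L; lra.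
have [|d d0 /and4P[dd1 dd2 dL _]] := @exists_pos_lt R [:: d1; d2 / 8; `‖g a‖ / (2 * L)].
  by rewrite /= d10 !divr_gt0 // mulr_gt0.
exists d => // z l zd za fl; apply/eqP => l0.
have zd2 : `‖z - a‖ < d2 by lra.
have [m gm] := gU' z zd2.
have fd := has_derivM (has_derivX a z n) gm.
have {}fd : has_deriv (fun w => f w - f a) z ((z - a) ^+ n.+1 * m + g z * (n.+1%:R * (z - a) ^+ n)).
  by move: fd; congr (has_deriv _ _ _); apply/funext => w; rewrite fg.
have := has_deriv_unique fd (has_deriv_shift (f a) fl).
rewrite l0 exprS => E.
have zn0 : z - a != 0 by rewrite subr_eq0.
have /eqP : (z - a) ^+ n * ((z - a) * m + g z * n.+1%:R) = 0 by rewrite -E; ring.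
rewrite mulf_eq0 expf_eq0 (negbTE zn0) andbF /= => /eqP E2.
have mL : `‖m‖ <= L.
  apply: (@has_deriv_le _ _ _ _ (d2 / 8)) gm; first lra.
  move=> w wz; apply: le_trans (glip z w _ _) _; try lra.
    by have := modulus_le_triangle w z a; lra.
  by apply: ler_wpM2r; [exact: modulus_ge0 | rewrite /L; lra].
have E3 : `‖g z‖ * n.+1%:R = `‖z - a‖ * `‖m‖.
  have -> : `‖g z‖ * n.+1%:R = `‖g z * n.+1%:R‖.
    rewrite modulusM; congr (_ * _).
    have <- : ofR n.+1%:R = n.+1%:R :> C by rewrite /ofR; exact: (rmorph_nat (real_complex R)).
    by rewrite modulus_ofR ger0_norm.
  rewrite -modulusM -[RHS]modulusN; congr modulus.
  by move/eqP: E2; rewrite addrC addr_eq0 => /eqP.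
have g1 : `‖g a‖ / 2 < `‖g z‖.
  have := d1P z (lt_trans zd dd1).
  by have := modulus_dist (g a) (g z); rewrite modulusBC; lra.
have n1 : 1 <= n.+1%:R :> R by rewrite ler1n.
have : `‖z - a‖ * `‖m‖ <= d * L by apply: ler_pM; rewrite ?modulus_ge0 // ltW.
have : d * L <= `‖g a‖ / 2 by move: dL; rewrite ltr_pdivlMr ?mulr_gt0 //; lra.
rewrite -E3; have : `‖g z‖ * 1 <= `‖g z‖ * n.+1%:R by rewrite ler_pM2l //; lra.
lra.
Qed.

(** Near [f a] the inverse is differentiable except possibly at [f a], by [deriv_neq0_near], and it
    is continuous there. So the singularity is removable, without first showing that [f' a] is
    nonzero. *)
Lemma inverse_holo a : U a -> holo_at k (f a).
Proof.
move=> Ua; have [d d0 dP] := deriv_neq0_near Ua.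
have [m m0 mP] := image_open_at Ua d0.
apply: (@removable_holo R k (f a) m) => //; first exact: inverse_cts.
move=> v /mP[z [Uz za <-]] va; have [l fl] := fU Uz.
exists l^-1; apply: inverse_deriv => //; apply: dP fl => //.
by apply/eqP => zE; rewrite zE eqxx in va.
Qed.

(** Near [a] the map [f] expands by a factor at most [M], so if [k'] vanished at [f a], then [k]
    after [f] would contract by 1/2, whereas it is the identity. Used in either direction, this
    shows that biholomorphic maps have nonzero derivatives. *)
Lemma inverse_deriv_neq0 a l : U a -> has_deriv k (f a) l -> l != 0.
Proof.
move=> Ua kl; have [m fm] := fU Ua; have [r r0 rU] := oU Ua.
apply/eqP => l0; rewrite {}l0 in kl.
pose M := `‖m‖ + 1; have M0 : 0 < M by have := modulus_ge0 m; rewrite /M; lra.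
have e0 : 0 < (2 * M)^-1 by rewrite invr_gt0 mulr_gt0.
have [s s0 sP] := kl _ e0; have [d d0 dP] := fm _ ltr01.
have [|t t0 /and4P[tr td + _]] := @exists_pos_lt R [:: r; d; s / M].
  by rewrite /= r0 d0 divr_gt0.
rewrite ltr_pdivlMr // mulrC => ts.
have ht : `‖a + ofR t - a‖ = t by rewrite modulus_shift.
have Ut : U (a + ofR t) by apply: rU; rewrite ht.
have f1 : `‖f (a + ofR t) - f a‖ <= M * t.
  have := dP (a + ofR t); rewrite ht => /(_ td).
  have := modulusD (f (a + ofR t) - f a - m * (a + ofR t - a)) (m * (a + ofR t - a)).
  by rewrite subrK (modulusM m) ht /M; lra.
have := sP _ (le_lt_trans f1 ts); rewrite mul0r subr0 !kf // ht => /le_trans.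
move=> /(_ _ (ler_wpM2l (ltW e0) f1)); rewrite invfM -mulrA mulKf ?gt_eqF //; lra.
Qed.

End Inverse.

End Domains.

(** * Connectedness of disks and continuous square roots on them *)

Section SquareRoots.
Variable R : realType.
Local Notation C := (cplx R).
Implicit Types (f g u v : C -> C) (a b c z w : C) (U V : set C).

Lemma unit_interval_ind (P : R -> Prop) :
  (forall t, 0 <= t <= 1 -> P t -> exists2 d : R, 0 < d &
     forall s, 0 <= s <= 1 -> `|s - t| < d -> P s) ->
  (forall t, 0 <= t <= 1 -> ~ P t -> exists2 d : R, 0 < d &
     forall s, 0 <= s <= 1 -> `|s - t| < d -> ~ P s) ->
  P 0 -> P 1.
Proof.
move=> Po Pc P0; apply: contrapT => P1.
pose A := [set t : R | 0 <= t <= 1 /\ P t].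
have A0 : A 0 by split => //; rewrite lexx ler01.
have ubA : ubound A 1 by move=> t [/andP[]].
have hA : has_sup A by split; [exists 0 | exists 1].
have s0 : 0 <= sup A by apply: ub_le_sup => //; exists 1.
have s1 : sup A <= 1 by apply: ge_sup => //; exists 0.
have s01 : 0 <= sup A <= 1 by rewrite s0 s1.
have [Ps|nPs] := pselect (P (sup A)).
  have [d d0 dP] := Po _ s01 Ps.
  have sl1 : sup A < 1 by rewrite lt_neqAle s1 andbT; apply/eqP => E; apply: P1; rewrite -E.
  pose t := Num.min 1 (sup A + d / 2).
  have t1 : t <= 1 by rewrite ge_min lexx.
  have st : sup A < t by rewrite lt_min sl1; lra.
  have td : t <= sup A + d / 2 by rewrite ge_min lexx orbT.
  have : t <= sup A.
    apply: ub_le_sup; first by exists 1.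
    have t01 : 0 <= t <= 1 by apply/andP; split; lra.
    by split => //; apply: dP => //; rewrite gtr0_norm; lra.
  lra.
have [d d0 dP] := Pc _ s01 nPs.
have [t [t01 Pt] td] := sup_adherent d0 hA.
have ts : t <= sup A by apply: ub_le_sup; [exists 1 | split].
by apply: (dP t) => //; rewrite ler0_norm; lra.
Qed.

Lemma path_conn U :
  (forall a b, U a -> U b -> exists gamma : R -> C, [/\ gamma 0 = a, gamma 1 = b,
     forall t, 0 <= t <= 1 -> U (gamma t) &
     forall t, 0 <= t <= 1 -> forall e : R, 0 < e -> exists2 d : R, 0 < d &
       forall s, 0 <= s <= 1 -> `|s - t| < d -> `‖gamma s - gamma t‖ < e]) -> conn U.
Proof.
move=> pU P Po Pc a b Ua Ub Pa; have [gamma [g0 g1 gU gc]] := pU a b Ua Ub.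
rewrite -g1; apply: (@unit_interval_ind (P \o gamma)) => /=; last by rewrite g0.
  move=> t t01 Pt; have [r r0 rP] := Po _ (gU t t01) Pt.
  have [d d0 dP] := gc t t01 r r0; exists d => // s s01 sd.
  by apply: rP; [exact: gU | exact: dP].
move=> t t01 Pt; have [r r0 rP] := Pc _ (gU t t01) Pt.
have [d d0 dP] := gc t t01 r r0; exists d => // s s01 sd.
by apply: rP; [exact: gU | exact: dP].
Qed.

Definition seg a b (t : R) : C := a + ofR t * (b - a).

Lemma seg_cts a b t (e : R) : 0 < e -> exists2 d : R, 0 < d &
  forall s, `|s - t| < d -> `‖seg a b s - seg a b t‖ < e.
Proof.
move=> e0; have m0 := modulus_ge0 (b - a).
exists (e / (`‖b - a‖ + 1)) => [|s]; first by rewrite divr_gt0 //; lra.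
rewrite ltr_pdivlMr; last lra.
rewrite /seg opprD addrACA subrr add0r -mulrBl -ofRB modulusM modulus_ofR.
have := normr_ge0 (s - t); nra.
Qed.

Lemma seg_disc (r : R) a b t : `‖a‖ < r -> `‖b‖ < r -> 0 <= t <= 1 -> `‖seg a b t‖ < r.
Proof.
move=> ar br /andP[t0 t1].
rewrite (_ : seg a b t = ofR (1 - t) * a + ofR t * b); last by rewrite /seg ofRB ofR1; ring.
apply: le_lt_trans (modulusD _ _) _; rewrite !modulusM !modulus_ofR.
rewrite !ger0_norm //; last lra.
have [t0'|t0'] := eqVneq t 0; first by rewrite t0'; lra.
have tp : 0 < t by rewrite lt_def t0'.
have : t * `‖b‖ < t * r by rewrite ltr_pM2l.
have : (1 - t) * `‖a‖ <= (1 - t) * r by apply: ler_wpM2l; lra.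
lra.
Qed.

Lemma conn_disc (r : R) : conn [set z : C | `‖z‖ < r].
Proof.
apply: path_conn => a b ar br; exists (seg a b); split.
- by rewrite /seg mul0r addr0.
- by rewrite /seg mul1r addrC subrK.
- by move=> t; apply: seg_disc.
- by move=> t _ e /(seg_cts a b t)[d d0 dP]; exists d => // s _; apply: dP.
Qed.

Lemma opn_disc (r : R) : opn [set z : C | `‖z‖ < r].
Proof.
move=> z /= zr; exists (r - `‖z‖); first by rewrite subr_gt0.
by move=> w wz /=; have := modulusD (w - z) z; rewrite subrK; lra.
Qed.

Definition topdisk U h k := [/\ forall z, `‖z‖ < 1 -> cts h z, forall z, U z -> cts k z,
   forall z, `‖z‖ < 1 -> U (h z) & forall z, U z -> `‖k z‖ < 1] /\
  (forall z, `‖z‖ < 1 -> k (h z) = z) /\ (forall z, U z -> h (k z) = z).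

Lemma conn_topdisk U h k : topdisk U h k -> conn U.
Proof.
move=> [[hc kc hU kD] [kh hk]]; apply: path_conn => a b Ua Ub.
have sD t := @seg_disc 1 (k a) (k b) t (kD a Ua) (kD b Ub).
exists (h \o seg (k a) (k b)); split=> /=.
- by rewrite /seg mul0r addr0 hk.
- by rewrite /seg mul1r addrC subrK hk.
- by move=> t t01; apply/hU/sD.
- move=> t t01 e e0; have [r r0 rP] := hc _ (sD t t01) e e0.
  have [d d0 dP] := seg_cts (k a) (k b) t r0.
  by exists d => // s _ /dP; apply: rP.
Qed.

(** On this disc [w] has positive real part, so its square roots are not purely imaginary and one of
    them has positive real part. The disc condition stands under the existential to make [psqrt]
    total. *)
Lemma psqrt_ex w : exists s : C, `‖w - 1‖ < 1 -> s ^+ 2 = w /\ 0 < complex.Re s.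
Proof.
have [w1|w1] := boolP (`‖w - 1‖ < 1); last by exists 0.
have w0 : 0 < complex.Re w.
  have := Re_le_modulus (w - 1); case: w w1 => x y /= w1.
  by rewrite -[X in `|X|]/(x - 1) ler_norml => /andP[]; lra.
pose s : C := sqrtC w; have s2 : s ^+ 2 = w by rewrite sqrtCK.
have sr : complex.Re s != 0.
  apply/eqP => E; move: w0; rewrite -s2; case: s E {s2} => x y /= ->.
  by rewrite mulr0 sub0r oppr_gt0 => /lt_geF; rewrite -expr2 sqr_ge0.
have [s0|s0] := ltP 0 (complex.Re s); first by exists s.
exists (- s) => _; rewrite sqrrN; split => //.
have -> : complex.Re (- s) = - complex.Re s by case: (s).
by rewrite oppr_gt0 lt_neqAle sr.
Qed.

Definition psqrt w : C := sval (cid (psqrt_ex w)).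

Lemma psqrtP w : `‖w - 1‖ < 1 -> psqrt w ^+ 2 = w /\ 0 < complex.Re (psqrt w).
Proof. by rewrite /psqrt; case: cid. Qed.

(** For roots [s] of [w] and [t] of [w'] one has [|t - s| * |t + s| = |w' - w|], and [|t + s|] is at
    least the real part of [s]. *)
Lemma psqrt_cts w : `‖w - 1‖ < 1 -> cts psqrt w.
Proof.
move=> w1 e e0; have [s2 s0] := psqrtP w1; set s := psqrt w in s2 s0 *.
exists (Num.min (1 - `‖w - 1‖) (e * complex.Re s)).
  by rewrite lt_min subr_gt0 w1 mulr_gt0.
move=> w'; rewrite lt_min => /andP[w'w we].
have w'1 : `‖w' - 1‖ < 1 by have := modulus_le_triangle w' w 1; lra.
have [t2 t0] := psqrtP w'1; set t := psqrt w' in t2 t0 *.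
have st : complex.Re s <= `‖t + s‖.
  apply: le_trans (Re_le_modulus _).
  have -> : complex.Re (t + s) = complex.Re t + complex.Re s by case: (t); case: (s).
  by rewrite gtr0_norm; lra.
have E : `‖t - s‖ * `‖t + s‖ = `‖w' - w‖.
  by rewrite -modulusM -s2 -t2; congr modulus; ring.
rewrite -(ltr_pM2r s0); apply: le_lt_trans we; rewrite -E.
by apply: ler_wpM2l => //; exact: modulus_ge0.
Qed.

Lemma sqr_eq_sign (a b : C) : a ^+ 2 = b ^+ 2 -> a = b \/ a = - b.
Proof. by move/eqP; rewrite eqf_sqr => /orP[]/eqP; [left|right]. Qed.

(** Two square roots agree or are opposite at each point, and as they never vanish both alternatives
    are open. *)
Lemma cts_sqrt_unique U u v v' : conn U ->
  (forall z, U z -> cts v z) -> (forall z, U z -> cts v' z) ->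
  (forall z, U z -> v z ^+ 2 = u z) -> (forall z, U z -> v' z ^+ 2 = u z) ->
  (forall z, U z -> u z != 0) ->
  forall a b, U a -> U b -> v a = v' a -> v b = v' b.
Proof.
move=> cU vc vc' v2 v2' u0 a b Ua Ub.
have E z : U z -> v z = v' z \/ v z = - v' z.
  by move=> Uz; apply: sqr_eq_sign; rewrite v2 // v2'.
have ne z : U z -> v' z != 0 by move=> Uz; have := u0 z Uz; rewrite -v2' // expf_eq0.
have ne2 z : U z -> v z != 0 by move=> Uz; have := u0 z Uz; rewrite -v2 // expf_eq0.
apply: (cU (fun z => v z = v' z)) => // z Uz.
  move=> vz; have := cts_neq0 (ctsD (vc z Uz) (vc' z Uz)).
  rewrite vz -mulr2n mulrn_eq0 /= => /(_ (ne z Uz))[d d0 dP].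
  exists d => // w Uw /dP; have [//|->] := E w Uw.
  by rewrite addNr eqxx.
move=> vz; have := cts_neq0 (ctsB (vc z Uz) (vc' z Uz)).
rewrite subr_eq0 => /(_ (introN eqP vz))[d d0 dP].
by exists d => // w Uw /dP; rewrite subr_eq0 => /eqP.
Qed.

(* The functions z |-> u (t z) on the disc of radius r, t in [0, 1], connect a
   constant to u, and a square root of one gives one of the next when t moves by a
   uniformly small amount. *)
Lemma small_disc_sqrt u (r : R) : 0 < r -> r < 1 ->
  (forall z, `‖z‖ < 1 -> cts u z) -> (forall z, `‖z‖ < 1 -> u z != 0) ->
  exists v, (forall z, `‖z‖ < r -> cts v z) /\ (forall z, `‖z‖ < r -> v z ^+ 2 = u z).
Proof.
move=> r0 r1 uc u0; pose K := [set z : C | `‖z - 0‖ <= r].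
have cK : compact K := @compact_closed_disc R 0 r.
have KD z : K z -> `‖z‖ < 1 by rewrite /K /= subr0; lra.
have [B B0 BP] : exists2 B : R, 0 < B & forall z, K z -> `‖(u z)^-1‖ <= B.
  apply: cts_compact_bounded => // z /KD z1.
  by apply: ctsV; [exact: u0 | exact: uc].
(* A change of [u] by at most [1 / (2 * B)] keeps the quotient of consecutive values within 1/2 of
   1, inside the disc where [psqrt] is continuous. *)
have B2 : 0 < (2 * B)^-1 by rewrite invr_gt0 mulr_gt0.
have [d d0 dP] := cts_compact_uniform cK (fun z Kz => uc z (KD z Kz)) B2.
have [n _ /(_ n (leqnn n)) /= nd] := near_inv_nat d0.
pose tt j : R := j%:R / n.+1%:R.
have n0 : 0 < n.+1%:R :> R by rewrite ltr0n.
have tt1 j : (j <= n.+1)%N -> 0 <= tt j <= 1.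
  by move=> jn; rewrite /tt divr_ge0 //= ler_pdivrMr // mul1r ler_nat.
have ttS j : tt j.+1 - tt j = n.+1%:R^-1.
  by rewrite /tt -mulrBl -natr1 addrAC subrr add0r mul1r.
have Kt t z : 0 <= t <= 1 -> `‖z‖ < r -> K (ofR t * z).
  move=> /andP[t0 t1] zr; rewrite /K /= subr0 modulusM modulus_ofR ger0_norm //.
  by have := modulus_ge0 z; nra.
have step j : (j <= n.+1)%N -> exists v, (forall z, `‖z‖ < r -> cts v z) /\
    (forall z, `‖z‖ < r -> v z ^+ 2 = u (ofR (tt j) * z)).
  elim: j => [_|j IH jn].
    exists (fun=> sqrtC (u 0)); split => z _; first exact: cts_cst.
    by rewrite sqrtCK /tt mul0r mul0r.
  have [v [vc v2]] := IH (ltnW jn).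
  pose q z := u (ofR (tt j.+1) * z) * (u (ofR (tt j) * z))^-1.
  have scale t z : 0 <= t <= 1 -> `‖z‖ < r -> cts (fun z => u (ofR t * z)) z.
    move=> t01 zr; apply: (@cts_comp R (fun z => ofR t * z) u z).
      by apply: ctsM; [exact: cts_cst | exact: cts_id].
    by apply: uc; apply: KD; apply: Kt.
  have qc z : `‖z‖ < r -> cts q z.
    move=> zr; apply: ctsM; first by apply: scale => //; exact: tt1.
    apply: ctsV; last by apply: scale => //; exact: tt1 (ltnW jn).
    by apply: u0; apply: KD; apply: Kt => //; exact: tt1 (ltnW jn).
  have q1 z : `‖z‖ < r -> `‖q z - 1‖ < 1.
    move=> zr; have Kz := Kt _ _ (tt1 _ (ltnW jn)) zr.
    have uz := u0 _ (KD _ Kz).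
    rewrite (_ : q z - 1 = (u (ofR (tt j.+1) * z) - u (ofR (tt j) * z)) *
       (u (ofR (tt j) * z))^-1); last by rewrite /q; field.
    rewrite modulusM.
    have h1 : `‖ofR (tt j.+1) * z - ofR (tt j) * z‖ <= d.
      rewrite -mulrBl -ofRB ttS modulusM modulus_ofR gtr0_norm ?invr_gt0 //.
      rewrite -[leRHS]mulr1; apply: ler_pM; rewrite ?modulus_ge0 ?invr_ge0 //; first exact: ltW.
      lra.
    have := dP _ _ Kz h1; have := BP _ Kz => h2 h3.
    apply: le_lt_trans (ler_pM _ _ h3 h2) _; rewrite ?modulus_ge0 //.
    by rewrite invfM -mulrA mulVf ?gt_eqF //; lra.
  exists (fun z => v z * psqrt (q z)); split => z zr.
    apply: ctsM; first exact: vc.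
    by apply: (cts_comp (qc z zr)); apply: psqrt_cts; exact: q1.
  have [p2 _] := psqrtP (q1 z zr).
  rewrite exprMn v2 // p2 /q mulrCA mulfV ?mulr1 //.
  by apply: u0; apply: KD; apply: Kt => //; exact: tt1 (ltnW jn).
have [v [vc v2]] := step n.+1 (leqnn _).
by exists v; split => // z zr; rewrite v2 // /tt mulfV ?gt_eqF // mul1r.
Qed.

(** Roots on the discs of radius [r < 1], all normalised to the value [s0] at 0, agree on overlaps
    by uniqueness; the glued root uses at [z] the disc of radius [(1 + |z|) / 2]. *)
Lemma disc_sqrt u : (forall z, `‖z‖ < 1 -> cts u z) -> (forall z, `‖z‖ < 1 -> u z != 0) ->
  exists v, (forall z, `‖z‖ < 1 -> cts v z) /\ (forall z, `‖z‖ < 1 -> v z ^+ 2 = u z).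
Proof.
move=> uc u0; pose s0 : C := sqrtC (u 0).
have /choice[V VP] : forall r : R, exists v, 0 < r -> r < 1 ->
   [/\ forall z, `‖z‖ < r -> cts v z, forall z, `‖z‖ < r -> v z ^+ 2 = u z & v 0 = s0].
  move=> r; have [r0|r0] := ltP 0 r; last by exists id; lra.
  have [r1|r1] := ltP r 1; last by exists id; lra.
  have [v [vc v2]] := small_disc_sqrt r0 r1 uc u0.
  have : v 0 ^+ 2 = s0 ^+ 2 by rewrite v2 ?modulus0 // sqrtCK.
  move=> /sqr_eq_sign[v0|v0]; first by exists v.
  exists (fun z => - v z) => _ _; split => [z zr|z zr|].
  - by apply: ctsN; exact: vc.
  - by rewrite sqrrN v2.
  - by rewrite v0 opprK.
have agree r r' z : 0 < r -> r <= r' -> r' < 1 -> `‖z‖ < r -> V r z = V r' z.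
  move=> r0 rr r1 zr; have r'0 := lt_le_trans r0 rr.
  have [vc v2 v0] := VP r r0 (le_lt_trans rr r1); have [vc' v2' v0'] := VP r' r'0 r1.
  have c1 t : `‖t‖ < r -> cts (V r') t by move=> tr; apply: vc'; lra.
  have c2 t : `‖t‖ < r -> V r' t ^+ 2 = u t by move=> tr; apply: v2'; lra.
  have c3 t : `‖t‖ < r -> u t != 0 by move=> tr; apply: u0; lra.
  have c4 : `‖(0 : C)‖ < r by rewrite modulus0.
  have c5 : V r 0 = V r' 0 by rewrite v0 v0'.
  exact: (cts_sqrt_unique (@conn_disc r) vc c1 v2 c2 c3 c4 zr c5).
pose rad z := (1 + `‖z‖) / 2.
have radP z : `‖z‖ < 1 -> [/\ 0 < rad z, rad z < 1 & `‖z‖ < rad z].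
  by move=> z1; rewrite /rad; have := modulus_ge0 z; split; lra.
exists (fun z => V (rad z) z); split => z z1; have [z0 zr1 zr] := radP z z1; last first.
  by have [_ v2 _] := VP _ z0 zr1; apply: v2.
have [vc _ _] := VP _ z0 zr1.
have dd : 0 < rad z - `‖z‖ by lra.
apply: (cts_near dd) (vc z zr) => w wz.
have wr : `‖w‖ < rad z by have := modulusD (w - z) z; rewrite subrK; lra.
have w1 : `‖w‖ < 1 by lra.
have [w0 wr1 wr'] := radP w w1.
have [le|/ltW le] := leP (rad z) (rad w); first exact: agree.
by apply/esym; apply: agree.
Qed.

Lemma topdisk_sqrt U h k u : topdisk U h k ->
  (forall z, U z -> cts u z) -> (forall z, U z -> u z != 0) ->
  exists v, (forall z, U z -> cts v z) /\ (forall z, U z -> v z ^+ 2 = u z).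
Proof.
move=> [[hc kc hU kD] [kh hk]] uc u0.
have [z z1|z z1|v [vc v2]] := @disc_sqrt (fun z => u (h z)).
- by apply: (cts_comp (hc z z1)); apply/uc/hU.
- by apply/u0/hU.
exists (fun z => v (k z)); split => z Uz.
  by apply: (cts_comp (kc z Uz)); apply: vc; apply: kD.
by rewrite v2 ?hk //; apply: kD.
Qed.

(** The increment [v w - v z] is [(u w - u z) / (v w + v z)], whose denominator tends to
    [2 * v z]. *)
Lemma sqrt_holo U v u : opn U -> (forall z, U z -> cts v z) ->
  (forall z, U z -> v z ^+ 2 = u z) -> (forall z, U z -> u z != 0) ->
  holo_on U u -> holo_on U v.
Proof.
move=> oU vc v2 u0 uU z Uz; have [r r0 rU] := oU z Uz; have [l ul] := uU z Uz.
have vz : v z != 0 by have := u0 z Uz; rewrite -v2 // expf_eq0.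
pose q := quotient u z l; have qc : cts q z := quotient_cts ul.
have vv : v z + v z != 0 by rewrite -mulr2n mulrn_eq0.
have sc : cts (fun w => q w * (v w + v z)^-1) z.
  by apply: ctsM => //; apply: ctsV => //; apply: ctsD; [exact: vc | exact: cts_cst].
have [d1 d10 d1P] := cts_neq0 (ctsD (vc z Uz) (@cts_cst R (v z) z)) vv.
exists (q z * (v z + v z)^-1) => e e0; have [d d0 dP] := sc e e0.
exists (Num.min (Num.min d r) d1); first by rewrite !lt_min d0 r0.
move=> w; rewrite !lt_min => /andP[/andP[wd wr] wd1].
have vw := d1P w wd1.
rewrite (_ : v w - v z - _ = (q w * (v w + v z)^-1 - q z * (v z + v z)^-1) * (w - z)).
  by rewrite modulusM; apply: ler_wpM2r; [exact: modulus_ge0 | exact: ltW (dP w wd)].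
rewrite mulrBl [q w * _ * _]mulrAC -quotientE -!v2 //; last exact: rU.
by field; rewrite vv vw.
Qed.

End SquareRoots.

(** * The Riemann mapping theorem *)

Section RiemannMapping.
Variable R : realType.
Local Notation C := (cplx R).
Implicit Types (f g u v phi k : C -> C) (a b c z w x : C) (U V : set C).

Definition conjg (z : C) : C := conjc z.

Lemma modulus_sqr z : `‖z‖ ^+ 2 = complex.Re z ^+ 2 + complex.Im z ^+ 2.
Proof. by case: z => x y; rewrite /modulus /= sqr_sqrtr // addr_ge0 ?sqr_ge0. Qed.

(** For [b] in the unit disc, the automorphism of the disc that sends [b] to 0. *)
Definition mobius b a : C := (a - b) / (1 - conjg b * a).

Lemma modulus_conjg z : `‖conjg z‖ = `‖z‖.
Proof. by case: z => x y; rewrite /modulus /= sqrrN. Qed.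

Lemma mobius_den b a : `‖b‖ < 1 -> `‖a‖ < 1 -> 1 - conjg b * a != 0.
Proof.
move=> b1 a1; rewrite -modulus_gt0.
have := modulus_dist 1 (conjg b * a); rewrite modulus1 modulusM modulus_conjg.
have := modulus_ge0 a; have := modulus_ge0 b; nra.
Qed.

Lemma mobius_lt1 b a : `‖b‖ < 1 -> `‖a‖ < 1 -> `‖mobius b a‖ < 1.
Proof.
move=> b1 a1; have d0 := mobius_den b1 a1.
rewrite /mobius modulusM modulusV ltr_pdivrMr ?modulus_gt0 // mul1r.
rewrite -(ltr_pXn2r (n := 2)) ?nnegrE ?modulus_ge0 // -subr_gt0.
have -> : `‖1 - conjg b * a‖ ^+ 2 - `‖a - b‖ ^+ 2 = (1 - `‖a‖ ^+ 2) * (1 - `‖b‖ ^+ 2).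
  rewrite !modulus_sqr; case: (a) => x y; case: (b) => s t /=; ring.
by rewrite mulr_gt0 // subr_gt0 exprn_ilt1 ?modulus_ge0.
Qed.

Lemma mobius_inj b a a' : `‖b‖ < 1 -> `‖a‖ < 1 -> `‖a'‖ < 1 ->
  mobius b a = mobius b a' -> a = a'.
Proof.
move=> b1 a1 a'1 E; have d0 := mobius_den b1 a1; have d1 := mobius_den b1 a'1.
have E2 : (a - b) * (1 - conjg b * a') = (a' - b) * (1 - conjg b * a).
  have -> : a - b = mobius b a * (1 - conjg b * a) by rewrite /mobius divfK.
  by rewrite E /mobius; field.
have bb : 1 - conjg b * b != 0 by apply: mobius_den.
apply/eqP; rewrite -subr_eq0; apply/eqP; apply: (mulIf bb); rewrite mul0r.
have -> : (a - a') * (1 - conjg b * b) =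
  (a - b) * (1 - conjg b * a') - (a' - b) * (1 - conjg b * a) by ring.
by rewrite E2 subrr.
Qed.

Lemma mobius_holo b f z : `‖b‖ < 1 -> `‖f z‖ < 1 -> holo_at f z ->
  holo_at (fun z => mobius b (f z)) z.
Proof.
move=> b1 f1 fz; apply: holoM; first exact: (holo_subc b fz).
apply: holoV; first exact: mobius_den.
apply: (holoB (@holo_cst R 1 z)); exact: (holoM (@holo_cst R (conjg b) z) fz).
Qed.

Lemma mobius_neq0 b a : `‖b‖ < 1 -> `‖a‖ < 1 -> a <> b -> mobius b a != 0.
Proof.
move=> b1 a1 ab; rewrite mulf_neq0 ?invr_neq0 ?mobius_den // subr_eq0; exact/eqP.
Qed.

Definition bihol U V phi k := [/\ holo_on U phi, holo_on V k,
    forall z, U z -> V (phi z) & forall w, V w -> U (k w)] /\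
  (forall z, U z -> k (phi z) = z) /\ (forall w, V w -> phi (k w) = w).

Definition diskset : set C := [set z | `‖z‖ < 1].

Section KoebeStep.
Variables (U : set C) (x : C).
Hypotheses (oU : opn U) (Ux : U x).
(** The form in which simple connectedness is used; continuous roots suffice, since [sqrt_holo]
    makes them holomorphic. *)
Hypothesis sqrtU : forall u, (forall z, U z -> cts u z) -> (forall z, U z -> u z != 0) ->
  exists v, (forall z, U z -> cts v z) /\ (forall z, U z -> v z ^+ 2 = u z).

Definition disk_embedding f :=
  [/\ holo_on U f, injective_on U f, forall z, U z -> `‖f z‖ < 1 & f x = 0].

(* Koebe: if f omits b, then with v^2 = (f - b)/(1 - b^* f) and s = v(x) one
   has f = F * (v + s)/(1 + s^* v) where F = (v - s)/(1 - s^* v), and the second factor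
   has modulus less than 1. *)
Lemma koebe_step f b p : disk_embedding f -> `‖b‖ < 1 -> (forall z, U z -> f z <> b) ->
  U p -> p <> x -> exists2 F, disk_embedding F & `‖f p‖ < `‖F p‖.
Proof.
move=> [fU finj f1 fx] b1 fb Up px.
pose u z := mobius b (f z).
have uU : holo_on U u by move=> z Uz; apply: mobius_holo => //; [exact: f1 | exact: fU].
have u0 z : U z -> u z != 0 by move=> Uz; apply: mobius_neq0 => //; [exact: f1 | exact: fb].
have [v [vc v2]] := sqrtU (fun z Uz => holo_cts (uU z Uz)) u0.
have vU := sqrt_holo oU vc v2 u0 uU.
have v1 z : U z -> `‖v z‖ < 1.
  move=> Uz; rewrite -(ltr_pXn2r (n := 2)) ?nnegrE ?modulus_ge0 // expr1n.
  by rewrite -modulusX v2 //; apply: mobius_lt1 => //; apply: f1.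
set s := v x; have s1 : `‖s‖ < 1 by apply: v1.
have s2 : s ^+ 2 = - b by rewrite v2 // /u /mobius fx mulr0 subr0 divr1 sub0r.
pose F z := mobius s (v z).
have FE : disk_embedding F.
  split.
  - by move=> z Uz; apply: mobius_holo => //; [exact: v1 | exact: vU].
  - move=> z w Uz Uw /(mobius_inj s1 (v1 z Uz) (v1 w Uw)) vzw.
    apply: finj => //; apply: (mobius_inj b1 (f1 z Uz) (f1 w Uw)).
    by rewrite -/(u z) -/(u w) -!v2 // vzw.
  - by move=> z Uz; apply: mobius_lt1 => //; apply: v1.
  - by rewrite /F /mobius subrr mul0r.
exists F => //.
have Fp : F p != 0.
  have [_ Finj _ Fx] := FE; apply/eqP => Fp; apply: px.
  by apply: Finj => //; rewrite Fp Fx.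
have Ns1 : `‖- s‖ < 1 by rewrite modulusN.
have fF : f p = F p * mobius (- s) (v p).
  have d1 := mobius_den s1 (v1 p Up).
  have d2 := mobius_den Ns1 (v1 p Up).
  have d3 := mobius_den b1 (f1 p Up).
  have cs : conjg (- s) = - conjg s by rewrite /conjg rmorphN.
  have cb : conjg b = - conjg s ^+ 2.
    by rewrite -[b]opprK -s2 /conjg rmorphN rmorphXn.
  have E : v p ^+ 2 * (1 - conjg b * f p) = f p - b by rewrite v2 // /u /mobius divfK.
  rewrite /F /mobius; rewrite cs in d2 *.
  have E2 : f p * ((1 - conjg s * v p) * (1 - - conjg s * v p)) =
     (v p - s) * (v p - - s).
    have -> : (v p - s) * (v p - - s) = v p ^+ 2 + b by rewrite -[b]opprK -s2; ring.
    have -> : v p ^+ 2 = f p - b + v p ^+ 2 * conjg b * f p by rewrite -E; ring.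
    by rewrite cb; ring.
  rewrite mulrACA -invfM -E2 mulfK // mulf_neq0 //.
rewrite fF modulusM -[ltRHS]mulr1 ltr_pM2l ?modulus_gt0 //.
by apply: mobius_lt1 => //; apply: v1.
Qed.

End KoebeStep.

(** Koebe's extremal problem: maximise [|f p|] over the injective maps into the disc that vanish at
    [x], for one fixed [p] other than [x]. A limit of a maximising sequence is extremal, and if it
    omitted a value, [koebe_step] would beat it. Evaluating at [p] instead of differentiating at [x]
    keeps derivatives out of the problem. *)
Lemma riemann_mapping U x (M : R) : opn U -> conn U -> U x ->
  (forall z, U z -> `‖z - x‖ < M) ->
  (forall u, (forall z, U z -> cts u z) -> (forall z, U z -> u z != 0) ->
    exists v, (forall z, U z -> cts v z) /\ (forall z, U z -> v z ^+ 2 = u z)) ->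
  exists phi k, bihol diskset U phi k /\ phi 0 = x.
Proof.
move=> oU cU Ux UM sqrtU.
have [r r0 rU] := oU x Ux.
pose p := x + ofR (r / 2).
have pxr : `‖p - x‖ = r / 2.
  by rewrite /p modulus_shift; lra.
have Up : U p by apply: rU; rewrite pxr; lra.
have px : p <> x by move=> E; move: pxr; rewrite E subrr modulus0; lra.
have M0 : 0 < M by apply: le_lt_trans (UM x Ux); apply: modulus_ge0.
pose Fam := disk_embedding U x.
pose f0 z := (z - x) * ofR M^-1.
have Mi : `‖ofR M^-1‖ = M^-1 by rewrite modulus_ofR gtr0_norm // invr_gt0.
have Mi0 : ofR M^-1 != 0 by rewrite -modulus_gt0 Mi invr_gt0.
have F0 : Fam f0.
  split.
  - move=> z _; apply: holoM; last exact: holo_cst.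
    exact: (holo_subc x (@holo_id R z)).
  - by move=> z w _ _ /(mulIf Mi0) /addIr.
  - by move=> z /UM zM; rewrite modulusM Mi ltr_pdivrMr // mul1r.
  - by rewrite /f0 subrr mul0r.
pose A := [set t : R | exists2 f, Fam f & `‖f p‖ = t].
have hA : has_sup A.
  split; first by exists `‖f0 p‖, f0.
  by exists 1 => _ [f [_ _ f1 _] <-]; apply: ltW; apply: f1.
have /choice[h hP] : forall n : nat, exists f, Fam f /\ sup A - n.+1%:R^-1 < `‖f p‖.
  move=> n; have e0 : 0 < n.+1%:R^-1 :> R by rewrite invr_gt0 ltr0n.
  by have [t [f Ff <-] ft] := sup_adherent e0 hA; exists f.
have hU n z : U z -> holo_at (h n) z by have [[hn _ _ _] _] := hP n; apply: hn.
have h1 n z : U z -> `‖h n z‖ < 1 by have [[_ _ hn _] _] := hP n; apply: hn.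
have hloc z : U z -> exists r M : R, 0 < r /\ \forall n \near omega,
    forall w, `‖w - z‖ < r -> holo_at (h n) w /\ `‖h n w‖ <= M.
  move=> Uz; have [s s0 sU] := oU z Uz; exists s, 1; split => //.
  by apply: nearW => n w wz; split; [apply/hU/sU | apply/ltW/h1/sU].
have [f fU hf] := montel hloc.
have ht z : U z -> tends omega (fun n => h n z) (f z).
  move=> Uz e e0; have [s s0 sP] := hf z Uz; apply: filterS (sP e e0) => n.
  by apply; rewrite subrr modulus0.
have fx : f x = 0.
  apply: tends_unique (ht x Ux) _; apply: tends_near (tends_cst 0).
  by apply: nearW => n; have [[_ _ _ ->] _] := hP n.
have fp : sup A <= `‖f p‖.
  apply/ler_addgt0Pr => e e0.
  rewrite -lerBlDr; apply: tends_modulus_ge (ht p Up).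
  apply: near_omega; apply: filterS (near_inv_nat e0) => m me.
  have [_ /ltW] := hP m; apply: le_trans.
  by rewrite lerD2l lerN2 ltW.
(* The affine map [f0] belongs to the family and is nonzero at [p]; so the extremal limit is not
   constant, as Hurwitz's theorem requires. *)
have f0p : 0 < `‖f p‖.
  apply: lt_le_trans fp; apply: lt_le_trans (_ : `‖f0 p‖ <= _).
    by rewrite modulusM Mi pxr mulr_gt0 ?invr_gt0 //; lra.
  by apply: ub_le_sup; [case: hA | exists f0].
have fpx : f p <> f x by rewrite fx => E; move: f0p; rewrite E modulus0 ltxx.
have hUn : \forall n \near omega, holo_on U (h n) by apply: nearW => n z; apply: hU.
have hinj : \forall n \near omega, injective_on U (h n).
  by apply: nearW => n; have [[_ hn _ _] _] := hP n.
have finj : injective_on U f.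
  exact: (hurwitz_injective oU cU fU hUn hinj hf Up Ux fpx).
have fle1 z : U z -> `‖f z‖ <= 1.
  by move=> Uz; apply: tends_modulus_le (ht z Uz); apply: nearW => n; apply/ltW/h1.
have f1 z : U z -> `‖f z‖ < 1.
  move=> Uz; rewrite lt_neqAle fle1 // andbT; apply/eqP => fz1.
  have := strong_max_modulus oU cU fU fle1 Uz fz1 Ux; rewrite fx => E.
  by move: fz1; rewrite -E modulus0; lra.
have Ff : Fam f by split; [exact: fU | exact: finj | exact: f1 | exact: fx].
have fsurj b : `‖b‖ < 1 -> exists2 z, U z & f z = b.
  move=> b1; apply: contrapT => nb.
  have fb z : U z -> f z <> b by move=> Uz fz; apply: nb; exists z.
  have [F FF Fp] := koebe_step oU Ux sqrtU Ff b1 fb Up px.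
  have : `‖F p‖ <= sup A by apply: ub_le_sup; [case: hA | exists F].
  by move/(lt_le_trans Fp)/(le_lt_trans fp); rewrite ltxx.
have /choice[k kP] : forall b, exists z, `‖b‖ < 1 -> U z /\ f z = b.
  move=> b; have [/fsurj[z Uz fz]|nb] := pselect (`‖b‖ < 1); first by exists z.
  by exists x.
have kf z : U z -> k (f z) = z.
  by move=> Uz; have [Uk fk] := kP _ (f1 z Uz); apply: finj.
exists k, f; split; last by rewrite -fx kf.
split; last by split => [b b1|//]; have [] := kP b b1.
split=> // [b b1|b b1].
  have [Uk fk] := kP b b1; have := inverse_holo oU fU finj kf Uk.
  by rewrite fk.
by have [] := kP b b1.
Qed.

End RiemannMapping.

(** * Proper maps between disks with a totally ramified fibre *)

Section NormalForm.
Variable R : realType.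
Local Notation C := (cplx R).
Local Notation D := (@diskset R).
Implicit Types (f g q phi k psi l : C -> C) (a b c z w x y : C) (U V : set C).

(** Cauchy's formula for the powers of [f] gives [|f a|^n <= r / (r - |a - c|) * B^n], and for large
    [n] the factor in front becomes immaterial. This extends the maximum principle from the centre
    to all points of the disc. *)
Lemma max_modulus_disc f c a r rho (B : R) : `‖a - c‖ < r -> r < rho ->
  (forall z, `‖z - c‖ < rho -> holo_at f z) ->
  (forall z, `‖z - c‖ = r -> `‖f z‖ <= B) -> `‖f a‖ <= B.
Proof.
move=> ar rrho fh fB; have a0 := modulus_ge0 (a - c).
have r0 : 0 < r by lra.
have d0 : 0 < r - `‖a - c‖ by lra.
have B0 : 0 <= B.
  apply: le_trans (fB (c + ofR r) _); first exact: modulus_ge0.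
  by rewrite modulus_shift.
have key n : `‖f a‖ ^+ n * (r - `‖a - c‖) <= r * B ^+ n.
  have fn z : `‖z - c‖ < rho -> holo_at (fun z => f z ^+ n) z.
    by move=> /fh; apply: holoX.
  have fnc : cts (fun z => f z ^+ n) c by apply: holo_cts; apply: fn; rewrite subrr modulus0; lra.
  rewrite -modulusX (cauchy_formula fnc (fun z zr _ => fn z zr) ar rrho).
  rewrite -ler_pdivlMr //; apply: mean_le; first exact: ltW.
  move=> z zr; rewrite !modulusM zr modulusX modulusV.
  have zB : `‖f z‖ ^+ n <= B ^+ n by rewrite lerXn2r ?nnegrE ?modulus_ge0 // fB.
  have zd : r - `‖a - c‖ <= `‖z - a‖ := circle_dist (lexx _) zr.
  apply: ler_pM; rewrite ?mulr_ge0 ?invr_ge0 ?exprn_ge0 ?modulus_ge0 //; try exact: ltW.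
    by rewrite ler_pM2l.
  by rewrite lef_pV2 // posrE; apply: lt_le_trans zd.
rewrite leNgt; apply/negP => Bf.
have f0 : 0 < `‖f a‖ by apply: le_lt_trans Bf.
pose t := B / `‖f a‖.
have t0 : 0 <= t by rewrite divr_ge0 // ltW.
have t1 : t < 1 by rewrite ltr_pdivrMr // mul1r.
have e0 : 0 < (r - `‖a - c‖) / (2 * r) by rewrite divr_gt0 // mulr_gt0.
have [n nP] := expr_small t0 t1 e0.
have fn0 : 0 < `‖f a‖ ^+ n by rewrite exprn_gt0.
have tn : t ^+ n * `‖f a‖ ^+ n = B ^+ n by rewrite -exprMn /t divfK // gt_eqF.
have := key n; rewrite -tn => H.
have : `‖f a‖ ^+ n * (r - `‖a - c‖) <= r * ((r - `‖a - c‖) / (2 * r) * `‖f a‖ ^+ n).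
  by apply: (le_trans H); rewrite ler_pM2l // ler_pM2r.
have -> : r * ((r - `‖a - c‖) / (2 * r) * `‖f a‖ ^+ n) = `‖f a‖ ^+ n * (r - `‖a - c‖) / 2.
  by field; rewrite gt_eqF.
have : 0 < `‖f a‖ ^+ n * (r - `‖a - c‖) by rewrite mulr_gt0.
lra.
Qed.

Lemma order_unique a r n m q q' : 0 < r -> cts q a -> cts q' a -> q a != 0 -> q' a != 0 ->
  (forall z, `‖z - a‖ < r -> (z - a) ^+ n * q z = (z - a) ^+ m * q' z) -> n = m.
Proof.
wlog nm : n m q q' / (n <= m)%N => [wl|].
  move=> r0 qc qc' q0 q0' E; have [nm|/ltnW nm] := leqP n m; first exact: (wl n m q q').
  by apply/esym/(wl m n q' q) => // z /E.
move=> r0 qc qc' q0 q0' E; apply/eqP; rewrite eqn_leq nm /= leqNgt; apply/negP => lt.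
have {}E z : `‖z - a‖ < r -> z != a -> q z = (z - a) ^+ (m - n) * q' z.
  move=> zr za; have z0 : (z - a) ^+ n != 0 by rewrite expf_neq0 // subr_eq0.
  by apply: (mulfI z0); rewrite E // mulrA -exprD subnKC.
have c1 : cts (fun z => q z - (z - a) ^+ (m - n) * q' z) a.
  apply: ctsB => //; apply: ctsM => //.
  apply: holo_cts; apply: holoX; exact: (holo_subc a (@holo_id R a)).
have [|d d0 dP] := cts_neq0 c1.
  by rewrite subrr expr0n subn_eq0 leqNgt lt /= mul0r subr0.
have [t [t0 td tr]] := exists_pos_lt2 d0 r0.
have ht : `‖a + ofR t - a‖ = t by rewrite modulus_shift.
have := dP (a + ofR t); rewrite ht => /(_ td); rewrite E ?ht ?subrr ?eqxx //.
by rewrite -subr_eq0 -modulus_gt0 ht.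
Qed.

Lemma bernoulli (t : R) n : 0 <= t <= 1 -> 1 - n%:R * t <= (1 - t) ^+ n.
Proof.
move=> /andP[t0 t1]; elim: n => [|n IH]; first by rewrite mul0r subr0.
rewrite exprS -natr1.
have n0 : 0 <= n%:R :> R by [].
have : (1 - t) * (1 - n%:R * t) <= (1 - t) * (1 - t) ^+ n by apply: ler_wpM2l => //; lra.
have : 0 <= n%:R * t * t by rewrite !mulr_ge0.
lra.
Qed.

(* The maximum principle applied to q = B / z^n and to 1/q, properness giving
   |B| -> 1 at the boundary. *)
Lemma proper_disc_monomial (B q : C -> C) n : holo_on D B -> holo_on D q ->
  (forall z, D z -> `‖B z‖ < 1) -> (forall z, B z = z ^+ n * q z) ->
  (forall z, D z -> B z = 0 -> z = 0) -> q 0 != 0 ->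
  (forall e : R, 0 < e -> exists2 d : R, 0 < d & forall z, D z -> 1 - d < `‖z‖ -> 1 - e < `‖B z‖) ->
  `‖q 0‖ = 1 /\ forall z, D z -> B z = q 0 * z ^+ n.
Proof.
move=> BD qD B1 Bq B0 q0 bd.
have D0 : D 0 by rewrite /diskset /mkset modulus0.
have qz z : D z -> q z != 0.
  move=> Dz; have [->//|z0] := eqVneq z 0.
  by apply/eqP => qz0; move/eqP: z0; apply; apply: B0; rewrite // Bq qz0 mulr0.
have circ (r : R) z : `‖z - 0‖ = r -> r ^+ n * `‖q z‖ = `‖B z‖.
  by rewrite subr0 => <-; rewrite Bq modulusM modulusX.
have qle1 : `‖q 0‖ <= 1.
  rewrite leNgt; apply/negP => q1; pose e := `‖q 0‖ - 1; have e0 : 0 < e by rewrite /e; lra.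
  (* The circle of radius [1 - t] gives [|q 0| * (1 - t)^n <= 1], hence by Bernoulli
     [|q 0| - 1 <= n * t * |q 0|]; this [t] makes the right side at most half of the left. *)
  pose t := Num.min (1 / 2) (e / (2 * n.+1%:R * `‖q 0‖)).
  have n0 : 0 < n.+1%:R :> R by rewrite ltr0n.
  have nq : 0 < 2 * n.+1%:R * `‖q 0‖ by rewrite !mulr_gt0 //; lra.
  have t0 : 0 < t by rewrite lt_min !divr_gt0.
  have t1 : t <= 1 / 2 by rewrite ge_min lexx.
  have te : t * (2 * n.+1%:R * `‖q 0‖) <= e by rewrite -ler_pdivlMr // ge_min lexx orbT.
  clearbody t.
  have rn : 0 < (1 - t) ^+ n by rewrite exprn_gt0; lra.
  have H : `‖q 0‖ <= 1 / (1 - t) ^+ n.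
    apply: (@max_modulus R q 0 (1 - t)) => [|z zr|z zr]; first lra.
      by apply: qD; rewrite /diskset /mkset; move: zr; rewrite subr0; lra.
    rewrite ler_pdivlMr // mulrC circ //; apply: ltW; apply: B1.
    by rewrite /diskset /mkset; move: zr; rewrite subr0; lra.
  have bn : 1 - n%:R * t <= (1 - t) ^+ n by apply: bernoulli; apply/andP; split; lra.
  move: H; rewrite ler_pdivlMr // => H.
  have h1 : `‖q 0‖ * (1 - n%:R * t) <= 1.
    by apply: le_trans H; apply: ler_wpM2l => //; exact: modulus_ge0.
  have h2 : 0 <= t * `‖q 0‖ by rewrite mulr_ge0 ?modulus_ge0 // ltW.
  move: te; rewrite -natr1 /e => te.
  have h3 : 0 <= n%:R * (t * `‖q 0‖) by rewrite mulr_ge0.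
  lra.
pose p z := (q z)^-1.
have pD : holo_on D p by move=> z Dz; apply: holoV; [exact: qz | exact: qD].
have p1 a : D a -> `‖p a‖ <= 1.
  move=> Da; apply/ler_addgt0Pr => e e0.
  (* Then [1 - e1] is the inverse of [1 + e], so that [1 - e1 < |q z|] means [|p z| < 1 + e]. *)
  pose e1 := e / (1 + e).
  have e11 : 1 - e1 = (1 + e)^-1 by rewrite /e1; field; lra.
  have e10 : 0 < e1 by rewrite divr_gt0 //; lra.
  have [d d0 dP] := bd e1 e10.
  pose r := Num.max (1 - d / 2) ((1 + `‖a‖) / 2).
  have ar : (1 + `‖a‖) / 2 <= r by rewrite le_max lexx orbT.
  have dr : 1 - d / 2 <= r by rewrite le_max lexx.
  have a1 : `‖a‖ < 1 := Da.
  have r1 : r < 1 by rewrite gt_max; apply/andP; split; lra.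
  have a0 := modulus_ge0 a.
  clearbody r.
  apply: (@max_modulus_disc p 0 a r 1) => //; first by rewrite subr0; lra.
    by move=> z; rewrite subr0 => z1; apply: pD.
  move=> z zr; have Dz : D z by rewrite /diskset /mkset; move: zr; rewrite subr0; lra.
  have zb : 1 - e1 < `‖B z‖ by apply: dP => //; move: zr; rewrite subr0; lra.
  have qb : 1 - e1 < `‖q z‖.
    apply: (lt_le_trans zb); rewrite -(circ r) // -[leRHS]mul1r.
    apply: ler_wpM2r; first exact: modulus_ge0.
    by rewrite exprn_ile1 //; lra.
  rewrite modulusV -[leRHS]invrK lef_pV2 ?posrE ?modulus_gt0 ?qz ?invr_gt0 //; last lra.
  by rewrite -e11 ltW.
have q01 : `‖q 0‖ = 1.
  apply/le_anti; rewrite qle1 /=.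
  by have := p1 0 D0; rewrite modulusV invf_le1 // modulus_gt0.
have p01 : `‖p 0‖ = 1 by rewrite modulusV q01 invr1.
split=> // z Dz.
have := strong_max_modulus (@opn_disc R 1) (@conn_disc R 1) pD p1 D0 p01 Dz.
by move/invr_inj => qE; rewrite Bq qE mulrC.
Qed.

Lemma bihol_open U V phi k : bihol U V phi k -> opn U -> opn V.
Proof.
move=> [[phiU _ UV VU] [kphi phik]] oU.
have inj : injective_on U phi by move=> z w Uz Uw E; rewrite -(kphi z Uz) E kphi.
have := image_open oU phiU inj; congr opn; apply/seteqP; split => [_ [z Uz <-]|w Vw].
  exact: UV.
by exists (k w); [exact: VU | exact: phik].
Qed.

Lemma bihol_rot V psi l (t : C) : `‖t‖ = 1 -> bihol D V psi l ->
  bihol D V (fun z => psi (t * z)) (fun w => t^-1 * l w).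
Proof.
move=> t1 [[psiD lV DV VD] [lpsi psil]].
have t0 : t != 0 by rewrite -modulus_gt0 t1.
have Dt z : D z -> D (t * z) by rewrite /diskset /mkset modulusM t1 mul1r.
split; first split=> [z Dz|w Vw|z Dz|w Vw].
- apply: (@holo_comp R (fun z => t * z) psi z); last exact/psiD/Dt.
  exact: (holoM (@holo_cst R t z) (@holo_id R z)).
- exact: (holoM (@holo_cst R t^-1 w) (lV w Vw)).
- exact/DV/Dt.
- by rewrite /diskset /mkset modulusM modulusV t1 invr1 mul1r; apply: VD.
split=> [z Dz|w Vw]; first by rewrite lpsi ?mulKf //; apply: Dt.
by rewrite mulVKf // psil.
Qed.

Lemma compact_image (K : set C) f : compact K -> (forall z, K z -> cts f z) -> compact (f @` K).
Proof.
move=> cK fK; apply: continuous_compact => //; apply/continuous_withinP => z Kz e e0.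
by have [d d0 dP] := fK z Kz e e0; exists d => // w _; apply: dP.
Qed.

Lemma normal_form U V g x y n phi k psi l : (0 < n)%N ->
  bihol D U phi k -> phi 0 = x -> bihol D V psi l -> psi 0 = y ->
  holo_on U g -> (forall z, U z -> V (g z)) ->
  (forall K, compact K -> K `<=` V -> compact (U `&` g @^-1` K)) ->
  (forall z, U z -> g z = y -> z = x) ->
  (exists h r, [/\ 0 < r, cts h x, h x != 0 &
    forall z, `‖z - x‖ < r -> g z - y = (z - x) ^+ n * h z]) ->
  exists psi l, [/\ bihol D V psi l, psi 0 = y & forall z, D z -> g (phi z) = psi (z ^+ n)].
Proof.
move=> n0 bphi phi0 bpsi psi0 gU gV gK gx [h [r [r0 hc hx gh]]].
have [[phiD kU DU UD] [kphi phik]] := bphi.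
have [[psiD lV DV VD] [lpsi psil]] := bpsi.
have oD := @opn_disc R 1; have oU := bihol_open bphi oD; have oV := bihol_open bpsi oD.
have D0 : D 0 by rewrite /diskset /mkset modulus0.
have Ux : U x by rewrite -phi0; apply: DU.
have Vy : V y by rewrite -psi0; apply: DV.
pose B z := l (g (phi z)).
have BD : holo_on D B.
  move=> z Dz; apply: (@holo_comp R (fun z => g (phi z)) l z); last exact/lV/gV/DU.
  by apply: (@holo_comp R phi g z); [exact: phiD | exact/gU/DU].
have B1 z : D z -> `‖B z‖ < 1 by move=> Dz; apply/VD/gV/DU.
have gx0 : g x = y.
  have := gh x; rewrite subrr modulus0 => /(_ r0).
  by rewrite expr0n eqn0Ngt n0 mul0r => /eqP; rewrite subr_eq0 => /eqP.
have l0 : l y = 0 by rewrite -psi0 lpsi.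
have B00 : B 0 = 0 by rewrite /B phi0 gx0.
have Bzero z : D z -> B z = 0 -> z = 0.
  move=> Dz Bz; rewrite -(kphi z Dz) -(kphi 0 D0); congr k; rewrite phi0.
  by apply: gx; [exact: DU | rewrite -(psil _ (gV _ (DU _ Dz))) -/(B z) Bz].
have Bdisc z : `‖z - 0‖ < 1 -> holo_at B z by rewrite subr0 => z1; apply: BD.
have [B0|[m [q [qD q0 Bq]]]] := holo_order ltr01 Bdisc.
  have h2 : `‖ofR (1 / 2)‖ = 1 / 2 :> R by rewrite modulus_ofR gtr0_norm //; lra.
  have : ofR (1 / 2) = 0 :> C by apply: Bzero; rewrite ?B0 // ?subr0 /diskset /mkset h2; lra.
  by move=> E; move: h2; rewrite E modulus0; lra.
have {}Bq z : B z = z ^+ m * q z by rewrite Bq subr0.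
have {}qD : holo_on D q by move=> z Dz; apply: qD; rewrite subr0.
(* The coordinate changes [phi] at 0 and [l] at [y] have nonzero derivatives, so [B] vanishes at 0
   to the same order as [g - y] at [x]. *)
have mn : m = n.
  have [s s0 sV] := oV y Vy.
  have lyh z : `‖z - y‖ < s -> holo_at l z by move=> /sV; apply: lV.
  have [ll lld] := lV y Vy.
  have [l1 [l1h l1y l1E]] := holo_factor s0 lyh l0 lld.
  have ll0 : ll != 0.
    by apply: (inverse_deriv_neq0 oD psiD lpsi D0); rewrite psi0.
  have [p pd] := phiD 0 D0.
  have p0 : p != 0.
    have := inverse_deriv_neq0 oU kU phik Ux; rewrite -{1}phi0 kphi //.
    exact.
  have phixh z : `‖z - 0‖ < 1 -> holo_at (fun z => phi z - x) z.
    by rewrite subr0 => z1; apply: (holo_subc x (phiD z z1)).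
  have phix0 : phi 0 - x = 0 by rewrite phi0 subrr.
  have [p1 [p1h p10 p1E]] := holo_factor ltr01 phixh phix0 (has_deriv_shift x pd).
  have phic : cts phi 0 by apply: holo_cts; exact: phiD.
  have [d1 d10 d1P] := phic r r0.
  have p1c : cts p1 0 by apply: holo_cts; apply: p1h; rewrite subr0 modulus0.
  pose d := Num.min d1 1.
  have d0 : 0 < d by rewrite lt_min d10 ltr01.
  apply: (@order_unique 0 d m n q (fun z => p1 z ^+ n * h (phi z) * l1 (g (phi z)))) => //.
  - by apply: holo_cts; apply: qD.
  - have gphic : cts (fun z => g (phi z)) 0.
      apply: (cts_comp phic); apply: holo_cts; apply: gU; rewrite phi0 //.
    apply: ctsM; first apply: ctsM.
    + by apply: (@cts_comp R p1 (fun w => w ^+ n) 0 p1c); apply: holo_cts; apply: holoX; apply: holo_id.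
    + by apply: (cts_comp phic); rewrite phi0.
    + apply: (cts_comp gphic); rewrite phi0 gx0; apply: holo_cts; apply: l1h.
      by rewrite subrr modulus0.
  - by rewrite phi0 gx0 l1y p10 !mulf_neq0 // expf_neq0.
  - move=> z; rewrite lt_min subr0 => /andP[zd1 z1]; rewrite -Bq.
    have zr : `‖phi z - x‖ < r by rewrite -phi0; apply: d1P; rewrite subr0.
    by rewrite /B l1E (gh _ zr) p1E subr0 exprMn !mulrA.
rewrite {}mn in Bq.
have bd (e : R) : 0 < e -> exists2 d : R, 0 < d & forall z, D z -> 1 - d < `‖z‖ -> 1 - e < `‖B z‖.
  move=> e0; pose K0 := [set w : C | `‖w - 0‖ <= 1 - e].
  have K0D w : K0 w -> D w by rewrite /K0 /diskset /mkset subr0; lra.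
  have cK : compact (psi @` K0).
    apply: compact_image; first exact: compact_closed_disc.
    by move=> w /K0D Dw; apply: holo_cts; apply: psiD.
  have KV : psi @` K0 `<=` V by move=> _ [w /K0D Dw <-]; apply: DV.
  have [z [Uz _]|d d0 dP] := @compact_uniform_radius R _ (fun d z => `‖k z‖ <= 1 - d) (gK _ cK KV).
    have kz : `‖k z‖ < 1 := UD z Uz.
    have t0 : 0 < (1 - `‖k z‖) / 2 by lra.
    have [d d0 dP] := holo_cts (kU z Uz) t0.
    exists (Num.min d ((1 - `‖k z‖) / 2)); first by rewrite lt_min d0.
    move=> z' d'; rewrite !lt_min => /andP[z'd _] d'0 /andP[_ d'k].
    by have := modulusD (k z' - k z) (k z); rewrite subrK; have := dP z' z'd; lra.
  exists d => // z Dz zd; rewrite ltNge; apply/negP => Be.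
  have : `‖k (phi z)‖ <= 1 - d.
    apply: dP; split; first exact: DU.
    exists (B z); first by rewrite /K0 /= subr0.
    by rewrite /B psil //; apply/gV/DU.
  by rewrite kphi //; lra.
have [q1 BE] := proper_disc_monomial BD qD B1 Bq Bzero q0 bd.
exists (fun z => psi (q 0 * z)), (fun w => (q 0)^-1 * l w); split.
- exact: bihol_rot.
- by rewrite mulr0.
- by move=> z Dz; rewrite -BE // /B psil //; apply/gV/DU.
Qed.

End NormalForm.

Section UniformConvergence.
Variable K : numClosedFieldType.

Lemma uniform_cvg_closed (A : set K) (F : set_system (K -> K)) {FF : Filter F} (f : K -> K) :
  (forall e : K, 0 < e -> \forall g \near F, forall x, A x -> `|f x - g x| < e) ->
  {uniform A, F --> f}.
Proof.
move=> H P /uniform_nbhs[E [eE EP]].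
move: eE; rewrite -entourage_ballE => -[e /= e0 eE].
apply: filterS (H e e0) => g ge; apply: EP => x Ax; apply: eE => /=.
by rewrite -ball_normE /=; apply: ge.
Qed.

End UniformConvergence.

(** * Limits of Riemann maps and Carathéodory convergence *)

Section KernelConvergence.
Variable R : realType.
Local Notation C := (cplx R).
Local Notation D := (@diskset R).
Implicit Types (f g phi k psi l : C -> C) (a b c z w x y u v : C) (U V W K : set C).

Lemma diskset0 : D 0.
Proof. by rewrite /diskset /mkset modulus0. Qed.

Lemma opn_diskset : opn D.
Proof. exact: opn_disc. Qed.

Lemma conn_diskset : conn D.
Proof. exact: conn_disc. Qed.

Lemma luc_compact (T : Type) (F : set_system T) {FF : Filter F} U (h : T -> C -> C) f K :
  luc F U h f -> compact K -> K `<=` U ->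
  forall e : R, 0 < e -> \forall i \near F, forall z, K z -> `‖h i z - f z‖ < e.
Proof.
move=> hf cK KU e e0; apply: near_compact => // z /KU/hf[r r0 rP].
by exists r => //; apply: rP.
Qed.

Lemma luc_tends (T : Type) (F : set_system T) {FF : Filter F} U (h : T -> C -> C) f z :
  luc F U h f -> U z -> tends F (fun i => h i z) (f z).
Proof.
move=> hf /hf[r r0 rP] e /rP; apply: filterS => i; apply.
by rewrite subrr modulus0.
Qed.

Lemma bihol_inj U V phi k : bihol U V phi k -> injective_on U phi.
Proof. by move=> [_ [kphi _]] z w Uz Uw E; rewrite -(kphi z Uz) E kphi. Qed.

Lemma half_in_disc : D (ofR (1 / 2)) /\ ofR (1 / 2) <> 0 :> C.
Proof.
have h : `‖ofR (1 / 2)‖ = 1 / 2 :> R by rewrite modulus_ofR gtr0_norm //; lra.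
by split; [rewrite /diskset /mkset h; lra | move=> E; move: h; rewrite E modulus0; lra].
Qed.

Lemma bihol_nonconstant V phi k a : bihol D V phi k -> D a ->
  forall r : R, 0 < r -> ~ (forall w, `‖w - a‖ < r -> phi w = phi a).
Proof.
move=> bphi Da r r0; have [[phiD _ _ _] _] := bphi; have [Dh h0] := half_in_disc.
apply: (nonconstant_near opn_diskset conn_diskset phiD Dh diskset0 _ Da r0).
by move=> /(bihol_inj bphi Dh diskset0).
Qed.

(** Montel's theorem gives the limit, and Hurwitz's theorem its injectivity once the limit is known
    not to be constant; the common inner disc of radius [r] ensures the latter. *)
Lemma ultra_limit_bihol (T : Type) (F : set_system T) {FF : UltraFilter F}
    (Un : T -> set C) (phin kn : T -> C -> C) x (r M : R) : 0 < r ->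
  (forall i, bihol D (Un i) (phin i) (kn i)) -> (forall i, phin i 0 = x) ->
  (forall i z, `‖z - x‖ < r -> Un i z) -> (forall i z, Un i z -> `‖z - x‖ < M) ->
  exists phi k, [/\ bihol D (phi @` D) phi k, phi 0 = x & luc F D phin phi].
Proof.
move=> r0 bi phi0 rU UM; have PF : ProperFilter F := ultra_proper.
have hloc z : D z -> exists s B : R, 0 < s /\ \forall i \near F,
    forall w, `‖w - z‖ < s -> holo_at (phin i) w /\ `‖phin i w‖ <= B.
  move=> Dz; have [s s0 sD] := opn_diskset Dz; exists s, (M + `‖x‖); split => //.
  apply: nearW => i w /sD Dw; have [[ph _ DU _] _] := bi i; split; first exact: ph.
  by have := UM i _ (DU w Dw); have := modulusD (phin i w - x) x; rewrite subrK; lra.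
have [phi phiD hphi] := montel hloc.
have phix : phi 0 = x.
  apply: tends_unique (luc_tends hphi diskset0) _.
  by apply: tends_near (tends_cst x); apply: nearW => i; rewrite phi0.
have [z [Dz phiz]] : exists z, D z /\ phi z <> phi 0.
  apply: contrapT => nz.
  have cphi z : D z -> phi z = x.
    by move=> Dz; apply: contrapT => zx; apply: nz; exists z; rewrite phix.
  (* The inverses are bounded by 1 on the disc of radius [r] about [x], hence [8 / r]-Lipschitz near
     [x], and send this point into the disc of radius 1/2. If [phin] tended to the constant [x]
     uniformly there, it could not send the image back to [w]. *)
  pose w := x + ofR (r / 16).
  have wx : `‖w - x‖ = r / 16 by rewrite /w modulus_shift //; lra.
  have KD : [set z : C | `‖z - 0‖ <= 1 / 2] `<=` D.
    by move=> z; rewrite /diskset /mkset subr0; lra.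
  have wx0 : 0 < `‖w - x‖ by lra.
  have [i iP] := filter_ex (luc_compact hphi (@compact_closed_disc R 0 (1 / 2)) KD wx0).
  have [[_ kh DU UD] [kphi phik]] := bi i.
  have Uw : Un i w by apply: rU; lra.
  have Ux : Un i x by rewrite -(phi0 i); apply: DU; exact: diskset0.
  have kx : kn i x = 0 by rewrite -(phi0 i) kphi //; exact: diskset0.
  have kw : `‖kn i w - 0‖ <= 1 / 2.
    have := @holo_lip R (kn i) x r 1 r0 (fun z zr => kh z (rU i z zr))
       (fun z zr => ltW (UD z (rU i z zr))) x w.
    rewrite subrr modulus0 kx wx => H.
    apply: le_trans (H _ _) _; try lra.
    by rewrite mulr1 le_eqVlt; apply/orP; left; apply/eqP; field; rewrite gt_eqF.
  have := iP (kn i w) kw; rewrite phik // cphi ?ltxx //; exact: UD.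
have inj : injective_on D phi.
  apply: (hurwitz_injective opn_diskset conn_diskset phiD _ _ hphi Dz diskset0 phiz).
    by apply: nearW => i; have [[]] := bi i.
  by apply: nearW => i; apply: bihol_inj (bi i).
have /choice[k kP] : forall v, exists z, (phi @` D) v -> D z /\ phi z = v.
  move=> v; have [[t Dt <-]|nv] := pselect ((phi @` D) v); first by exists t.
  by exists 0.
have kphi t : D t -> k (phi t) = t.
  by move=> Dt; have [|Dk] := kP (phi t); [exists t | apply: inj].
exists phi, k; split => //; split; first split => //.
- by move=> _ [t Dt <-]; apply: (inverse_holo opn_diskset phiD inj kphi Dt).
- by move=> v /kP[].
by split => // v /kP[].
Qed.

Lemma increasing_ge s n : increasing s -> (n <= s n)%N.
Proof. by move=> incs; elim: n => // n IH; apply: leq_ltn_trans IH (incs _ _ (ltnSn n)). Qed.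

(** Closeness within [1 / (m + 1)] on the disc of radius [1 - 1 / (m + 1)] holds along the
    ultrafilter, so arbitrarily large indices achieve it for both families at once. *)
Lemma luc_subsequence (F : set_system nat) {FF : UltraFilter F} (phin psin : nat -> C -> C) phi psi :
  \oo `<=` F -> luc F D phin phi -> luc F D psin psi ->
  exists2 t, increasing t & luc \oo D (phin \o t) phi /\ luc \oo D (psin \o t) psi.
Proof.
move=> ooF hphi hpsi; have PF : ProperFilter F := ultra_proper.
pose e (m : nat) : R := m.+1%:R^-1.
have e0 m : 0 < e m by rewrite invr_gt0 ltr0n.
pose A m n := (forall z, `‖z - 0‖ <= 1 - e m -> `‖phin n z - phi z‖ < e m) /\
              (forall z, `‖z - 0‖ <= 1 - e m -> `‖psin n z - psi z‖ < e m).
have /choice[t tP] : forall mN : nat * nat, exists n, (mN.2 <= n)%N /\ A mN.1 n.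
  move=> [m N] /=.
  have KD : [set z : C | `‖z - 0‖ <= 1 - e m] `<=` D.
    by move=> z; rewrite /diskset /mkset subr0; have := e0 m; lra.
  have FN : \forall n \near F, (N <= n)%N by apply: ooF; exists N.
  have h1 := luc_compact hphi (@compact_closed_disc R 0 (1 - e m)) KD (e0 m).
  have h2 := luc_compact hpsi (@compact_closed_disc R 0 (1 - e m)) KD (e0 m).
  by have [n [[Nn n1] n2]] := filter_ex (filterI (filterI FN (h1 _)) (h2 _)); exists n.
pose fix s m := if m is m'.+1 then t (m, (s m').+1) else t (0%N, 0%N).
have sA m : A m (s m).
  by case: m => [|m]; [have [] := tP (0%N, 0%N) | have [] := tP (m.+1, (s m).+1)].
have sinc : increasing s.
  apply: homo_ltn; first exact: ltn_trans.
  by move=> m /=; have [] := tP (m.+1, (s m).+1).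
have sub (hn : nat -> C -> C) h :
    (forall m z, `‖z - 0‖ <= 1 - e m -> `‖hn (s m) z - h z‖ < e m) -> luc \oo D (hn \o s) h.
  move=> hP z0 z01; have d0 : 0 < (1 - `‖z0‖) / 2 by move: z01; rewrite /diskset /mkset; lra.
  exists ((1 - `‖z0‖) / 2) => // d dp.
  apply: filterS2 (near_inv_nat d0) (near_inv_nat dp) => m m1 m2 w wz /=.
  have {}m1 : e m < (1 - `‖z0‖) / 2 := m1.
  apply: lt_trans (hP m w _) m2; rewrite subr0; clearbody e.
  by have := modulusD (w - z0) z0; rewrite subrK; lra.
by exists s => //; split; apply: sub => m; case: (sA m).
Qed.

(** By the open mapping theorem uniform in the family, every point near [v0] is reached by [phin i]
    from a point close to [k v0], so it lies in [Un i] and its inverse image is under control. *)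
Lemma near_inverse (T : Type) (F : set_system T) {FF : ProperFilter F}
    (Un : T -> set C) (phin kn : T -> C -> C) U phi k :
  (forall i, bihol D (Un i) (phin i) (kn i)) -> bihol D U phi k -> luc F D phin phi ->
  forall v0, U v0 -> forall e : R, 0 < e -> exists2 m : R, 0 < m & \forall i \near F,
    forall v, `‖v - v0‖ < m -> Un i v /\ `‖kn i v - k v0‖ < e.
Proof.
move=> bi bphi hphi v0 Uv e e0; have [[phiD kU DU UD] [kphi phik]] := bphi.
have Da : D (k v0) := UD _ Uv.
have [s s0 sD] := opn_diskset Da.
have m0 : 0 < Num.min e s by rewrite lt_min e0.
have hD : \forall i \near F, holo_on D (phin i) by apply: nearW => i; have [[]] := bi i.
have [m mp mP] := luc_open_mapping opn_diskset phiD hD hphi Da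
  (bihol_nonconstant bphi Da) m0.
exists m => //; apply: filterS mP => i iP v; rewrite -{1}(phik v0 Uv) => /iP[z].
rewrite lt_min => /andP[ze /sD Dz] <-.
by have [[_ _ DUi _] [ki _]] := bi i; rewrite ki //; split => //; apply: DUi.
Qed.

Lemma connected_conn W : opn W -> connected W -> conn W.
Proof.
move=> oW cW P Po Pc a b Wa Wb Pa.
pose A := [set z | exists2 r : R, 0 < r & forall w, W w -> `‖w - z‖ < r -> P w].
pose B := [set z | exists2 r : R, 0 < r & forall w, W w -> `‖w - z‖ < r -> ~ P w].
have shrink (Q : C -> Prop) : open [set z | exists2 r : R, 0 < r &
    forall w, W w -> `‖w - z‖ < r -> Q w].
  apply/open_discP => z [r r0 rP]; exists (r / 2); first lra.
  move=> w /= wz; exists (r / 2); first lra.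
  by move=> t Wt tw; apply: rP => //; have := modulus_le_triangle t w z;
    rewrite /disc /= in wz; lra.
have E : W `&` A = W.
  apply: cW.
  - by exists a; split => //; apply: Po.
  - by exists A => //; apply: shrink.
  - exists (~` B); first by rewrite closedC; apply: shrink.
    apply/seteqP; split => z [Wz zP]; split => //.
      move=> [r r0 rP]; have [s s0 sP] := zP.
      apply: (rP z Wz); first by rewrite subrr modulus0.
      by apply: sP => //; rewrite subrr modulus0.
    by apply: Po => //; apply: contrapT => nP; apply: zP; apply: Pc.
have : W b by []. rewrite -{1}E => -[_ [r r0]]; apply=> //.
by rewrite subrr modulus0.
Qed.

Lemma conn_connected W : conn W -> connected W.
Proof.
move=> cW B [b Bb] [A oA BA] [E cE BE].
apply/seteqP; split=> [z|z Wz]; first by rewrite BA => -[].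
have Wb : W b by move: Bb; rewrite BA => -[].
apply: (cW B _ _ b z Wb Wz Bb) => t Wt.
  rewrite {1}BA => -[_ At]; have [r r0 rA] := iffLR (open_discP A) oA t At.
  by exists r => // w Ww wt; rewrite BA; split => //; apply: rA.
rewrite {1}BE => nEt; have cEt : (~` E) t by move=> Et; apply: nEt; split.
have [r r0 rA] := iffLR (open_discP (~` E)) (closed_openC cE) t cEt.
by exists r => // w Ww wt; rewrite BE => -[_]; apply: rA.
Qed.

Lemma cvg_cst_near (un : nat -> C) x : (forall n, un n = x) -> un n @[n --> \oo] --> x.
Proof.
move=> ux; apply: (iffRL (@tendsP R nat \oo _ un x)) => e e0.
by apply: nearW => n; rewrite ux subrr modulus0.
Qed.

(** Compact subsets are absorbed by [near_inverse]. For maximality, let [W] lie in infinitely many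
    [Un n]: along an ultrafilter on those indices the inverses [kn n] converge on [W] to some [chi].
    Since [chi x = 0], the strong maximum principle keeps [chi] inside the open disc, and
    [phi (chi v) = v] puts [W] into [U]. *)
Lemma cara_kernel (Un : nat -> set C) (un : nat -> C) (phin kn : nat -> C -> C) U phi k x :
  (forall n, un n = x) -> (forall n, phin n 0 = x) ->
  (forall n, bihol D (Un n) (phin n) (kn n)) -> bihol D U phi k -> phi 0 = x ->
  luc \oo D phin phi -> cara_cvg Un un U x.
Proof.
move=> unx phin0 bi bphi phi0 hphi; split.
- exact: cvg_cst_near.
- move=> K cK KU; apply: (near_compact cK) => v /KU Uv.
  have [m m0 mP] := near_inverse bi bphi hphi Uv ltr01.
  by exists m => //; apply: filterS mP => n nP w /nP[].
move=> W oW cW Wx WU v Wv.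
have opW := iffLR (opnP W) oW; have conW := connected_conn opW cW.
pose A := [set n | W `<=` Un n].
have PA : ProperFilter (within A \oo).
  apply: Build_ProperFilter => -[N _ NP].
  by have [n Nn Wn] := WU N; apply: (NP n Nn Wn).
have [F [FF AF]] := ultraFilterLemma PA.
have PF : ProperFilter F := ultra_proper.
have FA : F A by apply: AF; apply: nearW.
have ooF : \oo `<=` F by move=> P oP; apply: AF; apply: filterS oP.
have hphiF : luc F D phin phi.
  move=> z Dz; have [r r0 rP] := hphi z Dz; exists r => // e e0.
  by apply: ooF; apply: rP.
have hloc z : W z -> exists r M : R, 0 < r /\ \forall n \near F,
    forall w, `‖w - z‖ < r -> holo_at (kn n) w /\ `‖kn n w‖ <= M.
  move=> Wz; have [r r0 rW] := opW z Wz; exists r, 1; split => //.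
  apply: filterS FA => n nW w /rW/nW Uw; have [[_ kh _ UD] _] := bi n.
  by split; [exact: kh | exact: ltW (UD w Uw)].
have [chi chiW hchi] := montel hloc.
have ht z : W z -> tends F (fun n => kn n z) (chi z) by move=> Wz; apply: luc_tends hchi Wz.
have chi1 z : W z -> `‖chi z‖ <= 1.
  move=> Wz; apply: tends_modulus_le (ht z Wz); apply: filterS FA => n nW.
  by have [[_ _ _ UD] _] := bi n; apply: ltW; apply: UD; apply: nW.
have chix : chi x = 0.
  apply: tends_unique (ht x Wx) _; apply: tends_near (tends_cst 0).
  apply: nearW => n; have [_ [kphi _]] := bi n.
  by rewrite -(phin0 n) kphi //; exact: diskset0.
have chiD z : W z -> D (chi z).
  move=> Wz; rewrite /diskset /mkset lt_neqAle chi1 // andbT; apply/eqP => c1.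
  have := strong_max_modulus opW conW chiW chi1 Wz c1 Wx; rewrite chix => E.
  by move: c1; rewrite -E modulus0; lra.
have [[phiD _ DU _] _] := bphi.
suff -> : v = phi (chi v) by apply: DU; apply: chiD.
have [r r0 rP] := hphiF _ (chiD v Wv).
have phit : tends F (fun n => phi (kn n v)) (phi (chi v)).
  by apply: tends_cts_comp (ht v Wv); apply: holo_cts; apply: phiD; apply: chiD.
apply: (@tends_unique R nat F _ (fun=> v)); first exact: tends_cst.
move=> e e0; have e2 : 0 < e / 2 by lra.
apply: filterS (filterI (filterI FA (ht v Wv r r0)) (filterI (rP _ e2) (phit _ e2))).
move=> n [[nW kr] [h1 h2]].
have [_ [_ phik]] := bi n.
have := h1 _ kr; rewrite phik; last exact: nW.
by have := modulus_le_triangle v (phi (kn n v)) (phi (chi v)); lra.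
Qed.

(** The map [z^d] seen through Riemann maps of the domain and the range, normalised at the marked
    points. *)
Definition normal_pmap d (g : Defs.pmap R) phi k psi l :=
  [/\ bihol D (pdom g) phi k, bihol D (pran g) psi l, phi 0 = pbase g, psi 0 = ptgt g &
    forall z, D z -> pfun g (phi z) = psi (z ^+ d)].

Lemma diskX d z : (0 < d)%N -> D z -> D (z ^+ d).
Proof.
move=> d0 Dz; rewrite /diskset /mkset modulusX exprn_ilt1 ?modulus_ge0 //.
by rewrite -lt0n.
Qed.

Lemma normal_pmap_fun d (g : Defs.pmap R) phi k psi l v : normal_pmap d g phi k psi l -> pdom g v ->
  pfun g v = psi (k v ^+ d).
Proof.
move=> [[[_ _ _ UD] [_ phik]] _ _ _ E] Uv.
by rewrite -{1}(phik v Uv) E //; exact: UD.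
Qed.

Lemma uniform_modulusP K (h : nat -> C -> C) f :
  (forall e : R, 0 < e -> \forall n \near \oo, forall z, K z -> `‖h n z - f z‖ < e) ->
  {uniform K, h @ \oo --> f}.
Proof.
move=> hf; apply: (@uniform_cvg_closed C K (h @ \oo) _ f) => e.
rewrite ltcE /= => /andP[/eqP Ie Re0].
have -> : e = (complex.Re e)%:C%C by case: e Ie {Re0} => a b /= ->.
apply: filterS (hf _ Re0) => n hn z Kz.
by rewrite ltr_modulusE modulusBC; apply: hn.
Qed.

Lemma normal_pmap_cvg d (H : nat -> Defs.pmap R) (g : Defs.pmap R) phin kn psin ln phi k psi l :
  (0 < d)%N -> (forall n, normal_pmap d (H n) (phin n) (kn n) (psin n) (ln n)) ->
  normal_pmap d g phi k psi l ->
  (forall n, pbase (H n) = pbase g) -> (forall n, ptgt (H n) = ptgt g) ->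
  luc \oo D phin phi -> luc \oo D psin psi -> pmap_cvg H g.
Proof.
move=> d0 HN gN Hb Ht hphi hpsi; have [bphi bpsi phi0 psi0 gE] := gN.
have bphin n : bihol D (pdom (H n)) (phin n) (kn n) by case: (HN n).
have bpsin n : bihol D (pran (H n)) (psin n) (ln n) by case: (HN n).
split.
- apply: (cara_kernel (phin := phin) (kn := kn) (phi := phi) (k := k)) => // n.
  by case: (HN n) => _ _ -> _ _.
- apply: (cara_kernel (phin := psin) (kn := ln) (phi := psi) (k := l)) => // n.
  by case: (HN n) => _ _ _ -> _.
move=> K cK KU; apply: uniform_modulusP => e e0; apply: near_compact => // v0 /KU Uv.
have [[phiD kU DU UD] [kphi phik]] := bphi; have [[psiD _ _ _] _] := bpsi.
have Da : D (k v0 ^+ d) by apply: diskX => //; exact: UD.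
have e2 : 0 < e / 2 by lra. have e4 : 0 < e / 4 by lra.
have [r1 r10 r1P] := hpsi _ Da.
have [r2 r20 r2P] := holo_cts (psiD _ Da) e4.
have r0 : 0 < Num.min r1 r2 by rewrite lt_min r10.
have pc : cts (fun w => w ^+ d) (k v0).
  by apply: holo_cts; apply: (@holoX R id); apply: holo_id.
have [s s0 sP] := pc _ r0.
have oU : opn (pdom g) := bihol_open bphi opn_diskset.
have [t t0 tU] := oU v0 Uv.
have [t' t'0 t'P] := holo_cts (kU _ Uv) s0.
have [m m0 mP] := near_inverse bphin bphi hphi Uv s0.
exists (Num.min (Num.min t t') m); first by rewrite !lt_min t0 t'0.
apply: filterS2 mP (r1P _ e4) => n nP n1 w; rewrite !lt_min => /andP[/andP[wt wt'] wm].
have [Unw kw] := nP w wm; have Uw := tU w wt; have kw' := t'P w wt'.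
rewrite (normal_pmap_fun (HN n) Unw) (normal_pmap_fun gN Uw).
have := sP _ kw; rewrite lt_min => /andP[q1 q2].
have := sP _ kw'; rewrite lt_min => /andP[_ q3].
have := n1 _ q1; have := r2P _ q2; have := r2P _ q3.
set A := psin n _; set B := psi (k v0 ^+ d); set E := psi (kn n w ^+ d).
set G := psi (k w ^+ d) => h1 h2 h3.
have := modulus_le_triangle A E G; have := modulus_le_triangle E B G.
rewrite (modulusBC B G); clear -e0 h1 h2 h3; lra.
Qed.

End KernelConvergence.

Section ClosedFieldRoots.
Variable K : numClosedFieldType.

Lemma compact_closed_closed (A : set K) : compact A -> closed A.
Proof. by apply: compact_closed; apply: norm_hausdorff. Qed.

(** In characteristic 0 the polynomial [X^d - 1] is separable; its [d] distinct roots are multiplied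
    by one root of [w]. *)
Lemma nth_roots (w : K) d : (0 < d)%N -> w != 0 ->
  exists s : seq K, [/\ uniq s, size s = d & forall x, x \in s <-> x ^+ d = w].
Proof.
move=> d0 w0; pose p : {poly K} := 'X^d - 1.
have [rs prs] := closed_field_poly_normal p.
have lp : lead_coef p = 1 by rewrite lead_coefXnsubC.
rewrite lp scale1r in prs.
have urs : uniq rs.
  by rewrite -separable_prod_XsubC -prs separable_Xn_sub_1 // pnatr_eq0 -lt0n.
pose t := d.-root w; have td : t ^+ d = w by rewrite rootCK.
have t0 : t != 0 by move: w0; rewrite -td expf_eq0 d0.
exists [seq t * r | r <- rs]; split.
- by rewrite map_inj_uniq // => x y /(mulfI t0).
- by have := congr1 (fun p : {poly K} => size p) prs; rewrite size_map size_prod_XsubC size_XnsubC // => -[].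
move=> x; have -> : x = t * (x / t) by rewrite mulrCA divff ?mulr1.
move: (x / t) => y; rewrite mem_map; last by move=> u v /(mulfI t0).
rewrite -root_prod_XsubC -prs rootE !hornerE_comm hornerXn exprMn td.
rewrite subr_eq0; split=> [/eqP ->|E]; first by rewrite mulr1.
by apply/eqP; apply: (mulfI w0); rewrite mulr1.
Qed.

Lemma uniform_cvg_point (A : set K) (h : nat -> K -> K) (f : K -> K) (z : K) :
  A z -> {uniform A, h @ \oo --> f} -> h n z @[n --> \oo] --> f z.
Proof.
move=> Az hf P /nbhs_ballP[e /= e0 eP].
have /hf [N _ NP] : nbhs (f : {uniform` A -> K}) [set g : K -> K | ball (f z) e (g z)].
  apply/uniform_nbhs; exists [set xy | ball xy.1 e xy.2]; split.
    by rewrite -entourage_ballE; exists e.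
  by move=> g /= /(_ z Az).
by exists N => // n /NP; exact: eP.
Qed.

End ClosedFieldRoots.

(** * Degree and branching of normal forms; uniqueness of Carathéodory limits *)

Section BranchedCovers.
Variable R : realType.
Local Notation C := (cplx R).
Local Notation D := (@diskset R).
Implicit Types (f g h phi k psi l : C -> C) (a b c z w x y u v : C) (U V W K : set C).

Definition order_at f a n := exists h r, [/\ 0 < r,
  forall z, `‖z - a‖ < r -> holo_at h z, h a != 0 &
  forall z, `‖z - a‖ < r -> f z - f a = (z - a) ^+ n * h z].

Lemma holo_degreeP f a n : holo_degree f a n <-> order_at f a n.
Proof.
split=> [[h [/near_modulusP[r r0 rP] h0 /near_modulusP[s s0 sP]]]|[h [r [r0 rP h0 hE]]]].
  exists h, (Num.min r s); split=> //; first by rewrite lt_min r0.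
    by move=> z; rewrite lt_min => /andP[zr _]; apply/holo_atP; apply: rP.
  by move=> z; rewrite lt_min => /andP[_]; apply: sP.
exists h; split=> //; apply/near_modulusP; exists r => // z /rP.
by move/holo_atP.
Qed.

Lemma order_at_unique f a n m : order_at f a n -> order_at f a m -> n = m.
Proof.
move=> [h [r [r0 hh h0 hE]]] [h' [r' [r'0 hh' h0' hE']]].
have m0 : 0 < Num.min r r' by rewrite lt_min r0.
apply: (order_unique m0 _ _ h0 h0').
- by apply: holo_cts; apply: hh; rewrite subrr modulus0.
- by apply: holo_cts; apply: hh'; rewrite subrr modulus0.
- by move=> z; rewrite lt_min => /andP[zr zr']; rewrite -hE // -hE'.
Qed.

Lemma order_at_near f g a n (r : R) : 0 < r -> (forall z, `‖z - a‖ < r -> f z = g z) ->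
  order_at f a n -> order_at g a n.
Proof.
move=> r0 fg [h [s [s0 hh h0 hE]]]; exists h, (Num.min r s); split=> //.
- by rewrite lt_min r0.
- by move=> z; rewrite lt_min => /andP[_]; apply: hh.
- move=> z; rewrite lt_min => /andP[zr zs]; rewrite -!fg ?hE //.
  by rewrite subrr modulus0.
Qed.

Lemma order_at_comp f g a n m : cts f a -> order_at f a n -> order_at g (f a) m ->
  (exists2 s : R, 0 < s & forall z, `‖z - a‖ < s -> holo_at f z) ->
  order_at (fun z => g (f z)) a (n * m).
Proof.
move=> fc [h [r [r0 hh h0 hE]]] [h' [r' [r'0 hh' h0' hE']]] [t t0 tP].
have [s s0 sP] := fc r' r'0.
exists (fun z => h z ^+ m * h' (f z)), (Num.min (Num.min r s) t); split.
- by rewrite !lt_min r0 s0.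
- move=> z; rewrite !lt_min => /andP[/andP[zr zs] zt]; apply: holoM.
    by apply: holoX; apply: hh.
  by apply: (holo_comp (tP z zt)); apply/hh'/sP.
- by rewrite mulf_neq0 // expf_neq0.
move=> z; rewrite !lt_min => /andP[/andP[zr zs] zt].
by rewrite hE'; [rewrite hE // exprMn exprM mulrA | exact: sP].
Qed.

Lemma order_at1 f a (rho : R) (l : C) : 0 < rho -> (forall z, `‖z - a‖ < rho -> holo_at f z) ->
  has_deriv f a l -> l != 0 -> order_at f a 1.
Proof.
move=> rho0 fh fl l0.
have fh' z : `‖z - a‖ < rho -> holo_at (fun z => f z - f a) z.
  by move=> /fh fz; apply: (holo_subc (f a) fz).
have f0 : f a - f a = 0 by rewrite subrr.
have [h [hh ha hE]] := holo_factor rho0 fh' f0 (has_deriv_shift (f a) fl).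
by exists h, rho; split => //; rewrite ha.
Qed.

Lemma order_at_pow z d : (0 < d)%N ->
  order_at (fun w : C => w ^+ d) z (if z == 0 then d else 1%N).
Proof.
case: d => // d _; case: eqVneq => [->|z0].
  exists (fun=> 1), 1; split => //; [by move=> w _; apply: holo_cst |].
  by move=> w _; rewrite subr0 mulr1 expr0n subr0.
have Xh w : holo_at (fun w : C => w ^+ d.+1) w by apply: (@holoX R id); apply: holo_id.
have [l dl] := Xh z; apply: (@order_at1 _ z 1 l ltr01 _ dl) => //.
have := @has_derivX R 0 z d; rewrite subr0 => dX.
have E : l = d.+1%:R * z ^+ d.
  have eX : (fun w : C => (w - 0) ^+ d.+1) = (fun w => w ^+ d.+1).
    by apply/funext => w; rewrite subr0.
  by rewrite eX in dX; exact: has_deriv_unique dl dX.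
by rewrite E mulf_neq0 ?expf_neq0 // pnatr_eq0.
Qed.

Lemma bihol_sym U V phi k : bihol U V phi k -> bihol V U k phi.
Proof. by move=> [[? ? ? ?] [? ?]]; split. Qed.

Lemma bihol_order_at U V phi k a : opn U -> bihol U V phi k -> U a -> order_at phi a 1.
Proof.
move=> oU bphi Ua; have oV := bihol_open bphi oU.
have [[phiU kV UV VU] [kphi phik]] := bphi.
have [r r0 rU] := oU a Ua; have [l dl] := phiU a Ua.
apply: (order_at1 r0 _ dl) => [z /rU|]; first exact: phiU.
have Va := UV a Ua; have ka := kphi a Ua.
by apply: (inverse_deriv_neq0 oV kV phik Va); rewrite ka.
Qed.

Lemma holo_open_near U f a : opn U -> holo_on U f -> U a ->
  exists2 s : R, 0 < s & forall z, `‖z - a‖ < s -> holo_at f z.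
Proof. by move=> oU fU Ua; have [s s0 sU] := oU a Ua; exists s => // z /sU; apply: fU. Qed.

Section NormalMaps.
Variables (d : nat) (g : Defs.pmap R) (phi k psi l : C -> C).
Hypotheses (d0 : (0 < d)%N) (gN : normal_pmap d g phi k psi l).

Let bphi : bihol D (pdom g) phi k. Proof. by case: gN. Qed.
Let bpsi : bihol D (pran g) psi l. Proof. by case: gN. Qed.
Let oU : opn (pdom g). Proof. exact: bihol_open bphi (@opn_diskset R). Qed.
Let gE z : pdom g z -> pfun g z = psi (k z ^+ d).
Proof. exact: normal_pmap_fun gN. Qed.

Lemma normal_holo : holo_on (pdom g) (pfun g).
Proof.
move=> z Uz; have [r r0 rU] := oU Uz.
have [[phiD kU DU UD] [kphi phik]] := bphi; have [[psiD _ _ _] _] := bpsi.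
apply: (holo_near r0 (f := fun z => psi (k z ^+ d))); first by move=> w /rU Uw; rewrite gE.
apply: (@holo_comp R (fun z => k z ^+ d) psi); first by apply: holoX; apply: kU.
by apply: psiD; apply: diskX => //; apply: UD.
Qed.

Lemma normal_order x : pdom g x -> order_at (pfun g) x (if k x == 0 then d else 1%N).
Proof.
move=> Ux; have [r r0 rU] := oU Ux.
have [[phiD kU DU UD] [kphi phik]] := bphi; have [[psiD _ _ _] _] := bpsi.
have Xh w : holo_at (fun w : C => w ^+ d) w by apply: (@holoX R id); apply: holo_id.
have o1 := bihol_order_at oU (bihol_sym bphi) Ux.
have kc : cts k x by apply: holo_cts; apply: kU.
have o2 := order_at_comp kc o1 (order_at_pow (k x) d0) (holo_open_near oU kU Ux).
have Dx : D (k x ^+ d) by apply: diskX => //; apply: UD.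
have o3 := bihol_order_at (@opn_diskset R) bpsi Dx.
have kXU : holo_on (pdom g) (fun z => k z ^+ d) by move=> z Uz; apply: holoX; apply: kU.
have o4 := order_at_comp (holo_cts (kXU x Ux)) o2 o3 (holo_open_near oU kXU Ux).
rewrite mul1n muln1 in o4.
by apply: (order_at_near r0 _ o4) => z /rU Uz; rewrite gE.
Qed.

(** Where [l v] is nonzero, the fibre is the image of its [d] distinct roots, each simple; where it
    is zero, the fibre is one point of multiplicity [d]. Properness is inherited from that of [z^d]
    on the disc. *)
Lemma normal_branched_cover : branched_cover d (pdom g) (pran g) (pfun g).
Proof.
have [[phiD kU DU UD] [kphi phik]] := bphi; have [[psiD lV DV VD] [lpsi psil]] := bpsi.
split.
- by move=> z Uz; apply/holo_atP; apply: normal_holo.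
- by move=> z Uz; rewrite gE //; apply: DV; apply: diskX => //; apply: UD.
- move=> K cK KV.
  have clK : compact (l @` K) by apply: compact_image => // v /KV Vv; apply: holo_cts; apply: lV.
  pose S := [set z : C | (l @` K) (z ^+ d)].
  have SD z : S z -> D z.
    move=> [v /KV Vv vz]; have : D (z ^+ d) by rewrite -vz; apply: VD.
    rewrite /diskset /mkset modulusX => zd; rewrite ltNge; apply/negP => z1.
    by move: zd; apply/negP; rewrite -leNgt exprn_ege1.
  have cS : compact S.
    apply: (@subclosed_compact _ _ [set z : C | `‖z - 0‖ <= 1]).
    + have clo : closed (l @` K) := @compact_closed_closed C _ clK.
      rewrite -openC; apply/open_discP => z nSz.
      have [r r0 rP] := iffLR (open_discP _) (closed_openC clo) _ nSz.
      have Xh : holo_at (fun w : C => w ^+ d) z by apply: (@holoX R id); apply: holo_id.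
      have [s s0 sP] := holo_cts Xh r0.
      by exists s => // w /sP; apply: rP.
    + exact: compact_closed_disc.
    + by move=> z /SD; rewrite /diskset /mkset subr0 => /ltW.
  have -> : pdom g `&` pfun g @^-1` K = phi @` S.
    apply/seteqP; split => [z [Uz Kz]|_ [z Sz <-]].
      exists (k z); last exact: phik.
      exists (pfun g z) => //; rewrite gE // lpsi //.
      by apply: diskX => //; apply: UD.
    have Dz := SD z Sz; split; first exact: DU.
    rewrite /= gE ?kphi //; last exact: DU.
    by case: Sz => v Kv <-; rewrite psil //; apply: KV.
  by apply: compact_image => // z /SD Dz; apply: holo_cts; apply: phiD.
move=> v Vv; have Dv := VD v Vv.
have fibre x : pdom g x -> pfun g x = v <-> k x ^+ d = l v.
  move=> Ux; rewrite gE //; have Dk : D (k x ^+ d) by apply: diskX => //; apply: UD.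
  by split=> [<-|->]; rewrite ?lpsi ?psil.
have [lv0|lv0] := eqVneq (l v) 0.
  have U0 : pdom g (phi 0) by apply: DU; exact: diskset0.
  exists [:: phi 0], (fun=> d); split=> //.
  - move=> x; rewrite inE; split=> [/eqP ->|[Ux /(fibre x Ux)/eqP]].
      split=> //; apply/fibre => //; rewrite kphi ?lv0 ?expr0n ?gtn_eqF //.
      exact: diskset0.
    by rewrite lv0 expf_eq0 d0 /= => /eqP kx; rewrite -(phik x Ux) kx.
  - move=> x; rewrite inE => /eqP ->; apply/holo_degreeP.
    have := normal_order U0; rewrite kphi ?eqxx //; exact: diskset0.
  - by rewrite big_seq1.
have [s [us ss sP]] := nth_roots d0 lv0.
have sD z : z \in s -> D z.
  move=> /sP zd; have : D (z ^+ d) by rewrite zd.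
  rewrite /diskset /mkset modulusX => z1; rewrite ltNge; apply/negP => z2.
  by move: z1; apply/negP; rewrite -leNgt exprn_ege1.
exists (map phi s), (fun=> 1%N); split.
- rewrite map_inj_in_uniq // => z w /sD Dz /sD Dw; exact: (bihol_inj bphi Dz Dw).
- move=> x; split=> [/mapP[z zs ->]|[Ux /(fibre x Ux) kx]].
    have Uz := DU z (sD z zs); split=> //; apply/fibre => //.
    by rewrite kphi; [apply/sP | apply: sD].
  by rewrite -(phik x Ux) map_f //; apply/sP.
- move=> x /mapP[z zs ->]; apply/holo_degreeP.
  have := normal_order (DU z (sD z zs)); rewrite kphi; last exact: sD.
  case: eqVneq => // z0; move/sP: zs; rewrite z0 expr0n gtn_eqF // => E.
  by rewrite -E eqxx in lv0.
- by rewrite big_map sum1_size.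
Qed.

Lemma normal_branched_only_at : (1 < d)%N -> branched_only_at (pdom g) (pfun g) (pbase g).
Proof.
move=> d1 x Ux; have [[phiD kU DU UD] [kphi phik]] := bphi.
have phi0 : phi 0 = pbase g by case: gN.
have ox := normal_order Ux; split=> [[n n1 /holo_degreeP on]|xE].
  have := order_at_unique on ox; case: eqVneq => [kx _|_ nE]; last by rewrite nE in n1.
  by rewrite -(phik x Ux) kx.
exists d => //; apply/holo_degreeP; move: ox.
by rewrite xE -phi0 kphi ?eqxx //; exact: diskset0.
Qed.

End NormalMaps.

Lemma cts_within_opn U f : opn U -> {within U, continuous f} -> forall z, U z -> cts f z.
Proof.
move=> oU /continuous_withinP fU z Uz e e0; have [r r0 rP] := fU z Uz e e0.
have [s s0 sU] := oU z Uz; exists (Num.min r s); first by rewrite lt_min r0.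
by move=> w; rewrite lt_min => /andP[wr /sU Uw]; apply: rP.
Qed.

Lemma cts_within U f : (forall z, U z -> cts f z) -> {within U, continuous f}.
Proof.
move=> fU; apply/continuous_withinP => z Uz e /(fU z Uz)[r r0 rP].
by exists r => // w _; apply: rP.
Qed.

Lemma unit_discE : @unit_disc R = D.
Proof. by apply/seteqP; split => z; rewrite /unit_disc /disc /diskset /mkset subr0. Qed.

Lemma pointed_disk_topdisk U x : pointed_disk U x ->
  [/\ opn U, U x & exists h k, topdisk U h k].
Proof.
move=> [/opnP oU [h [k [[hc kc hU kD] [kh hk]]]] Ux].
rewrite unit_discE in hc hU kD kh; split => //; exists h, k; split; first split.
- by move=> z Dz; apply: (cts_within_opn (@opn_diskset R) hc).
- by move=> z Uz; apply: (cts_within_opn oU kc).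
- by move=> z Dz; apply: hU; exists z.
- by move=> z Uz; apply: kD; exists z.
by [].
Qed.

Lemma bihol_pointed_disk U phi k x : bihol D U phi k -> phi 0 = x -> pointed_disk U x.
Proof.
move=> bphi phi0; have [[phiD kU DU UD] [kphi phik]] := bphi; split.
- by apply/opnP; apply: (bihol_open bphi (@opn_diskset R)).
- exists phi; rewrite unit_discE; exists k; split=> //; split.
  + by apply: cts_within => z /phiD /holo_cts.
  + by apply: cts_within => z /kU /holo_cts.
  + by move=> _ [z Dz <-]; apply: DU.
  + by move=> _ [z Uz <-]; apply: UD.
- by rewrite -phi0; apply: DU; exact: diskset0.
Qed.

Lemma normal_is_pmap d (g : Defs.pmap R) phi k psi l : (0 < d)%N ->
  normal_pmap d g phi k psi l -> is_pmap g.
Proof.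
move=> d0 gN; have [bphi bpsi phi0 psi0 gE] := gN.
have [[phiD kU DU UD] [kphi phik]] := bphi; have [[psiD lV DV VD] [lpsi psil]] := bpsi.
split.
- exact: bihol_pointed_disk bphi phi0.
- exact: bihol_pointed_disk bpsi psi0.
- move=> z Uz; rewrite (normal_pmap_fun gN Uz); apply: DV; apply: diskX => //; exact: UD.
- by rewrite -phi0 gE ?expr0n ?gtn_eqF //; exact: diskset0.
Qed.

(** One half of the uniqueness of Carathéodory limits. [U] is exhausted by the images of smaller
    concentric discs: each is open, connected and inside a compact subset of [U], hence eventually
    inside [Un n], so maximality of [U'] captures it. *)
Lemma cara_subset (Un : nat -> set C) un U u U' u' : pointed_disk U u ->
  cara_cvg Un un U u -> cara_cvg Un un U' u' -> u = u' -> U `<=` U'.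
Proof.
move=> /pointed_disk_topdisk[oU Uu [h [k [[hc kc hU kD] [kh hk]]]]].
move=> [_ cU _] [_ _ cU'] uu' v Uv.
have [r [ur vr r1]] : exists r : R, [/\ `‖k u‖ < r, `‖k v‖ < r & r < 1].
  have u1 := kD u Uu; have v1 := kD v Uv.
  exists ((1 + Num.max `‖k u‖ `‖k v‖) / 2).
  have m1 : `‖k u‖ <= Num.max `‖k u‖ `‖k v‖ by rewrite le_max lexx.
  have m2 : `‖k v‖ <= Num.max `‖k u‖ `‖k v‖ by rewrite le_max lexx orbT.
  have m3 : Num.max `‖k u‖ `‖k v‖ < 1 by rewrite gt_max u1.
  by split; lra.
pose W := [set z | U z /\ `‖k z‖ < r].
have oW : opn W.
  move=> z [Uz kz]; have [s s0 sU] := oU z Uz.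
  have e0 : 0 < r - `‖k z‖ by lra.
  have [t t0 tP] := kc z Uz _ e0.
  exists (Num.min s t); first by rewrite lt_min s0.
  move=> w; rewrite lt_min => /andP[ws wt]; split; first exact: sU.
  by have := modulusD (k w - k z) (k z); rewrite subrK; have := tP w wt; lra.
have cW : conn W.
  apply: path_conn => a b [Ua ka] [Ub kb].
  have sr t := @seg_disc R r (k a) (k b) t ka kb.
  have s1 t : 0 <= t <= 1 -> `‖seg (k a) (k b) t‖ < 1 by move=> /sr; lra.
  exists (h \o seg (k a) (k b)); split=> /=.
  - by rewrite /seg mul0r addr0 hk.
  - by rewrite /seg mul1r addrC subrK hk.
  - by move=> t t01; split; [apply/hU/s1 | rewrite kh; [apply: sr | apply: s1]].
  - move=> t t01 e e0; have [s s0 sP] := hc _ (s1 t t01) e e0.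
    have [d d0 dP] := seg_cts (k a) (k b) t s0.
    by exists d => // t' _ /dP; apply: sP.
have cK : compact (h @` [set z : C | `‖z - 0‖ <= r]).
  apply: compact_image; first exact: compact_closed_disc.
  by move=> z /=; rewrite subr0 => zr; apply: hc; lra.
have KU : h @` [set z : C | `‖z - 0‖ <= r] `<=` U.
  by move=> _ [z /= zr <-]; apply: hU; move: zr; rewrite subr0; lra.
have WK : W `<=` h @` [set z : C | `‖z - 0‖ <= r].
  by move=> z [Uz kz]; exists (k z); [rewrite /= subr0 ltW | exact: hk].
have [N _ NP] := cU _ cK KU.
apply: (cU' W) => //.
- by apply/opnP.
- exact: conn_connected.
- by rewrite -uu'.
- by move=> M; exists (maxn N M); [exact: leq_maxr | move=> z /WK; apply: NP; exact: leq_maxl].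
Qed.

Lemma cvg_unique_seq (un : nat -> C) u u' : un n @[n --> \oo] --> u ->
  un n @[n --> \oo] --> u' -> u = u'.
Proof.
move=> uu uu'.
exact: (@cvg_unique_closed C nat \oo _ un u u' uu uu').
Qed.

End BranchedCovers.

(** * Critical points of rational maps through the Wronskian *)

Section Wronskian.
Variable K : numClosedFieldType.
Implicit Types (p q u : {poly K}) (a b : K).

Definition wronskian p q : {poly K} := p^`() * q - p * q^`().

Lemma mup_factor p a m : p != 0 -> mup a p = m ->
  exists2 u : {poly K}, ~~ root u a & p = u * ('X - a%:P) ^+ m.
Proof.
move=> p0 pm; have : ('X - a%:P) ^+ m %| p by rewrite -mup_geq // pm.
move=> /dvdpP[u pu]; exists u => //; apply/negP => /factor_theorem[v uv].
have : ('X - a%:P) ^+ m.+1 %| p by rewrite pu uv -mulrA -exprS dvdp_mull.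
by rewrite -mup_geq // pm ltnn.
Qed.

(** With [p = u (X - a)^(m+1)] the Wronskian is [(X - a)^m] times a polynomial whose value at [a] is
    [(m + 1) u(a) q(a)], nonzero in characteristic 0. *)
Lemma mup_wronskian p q a m : p != 0 -> ~~ root q a -> mup a p = m.+1 ->
  mup a (wronskian p q) = m.
Proof.
move=> p0 qa pm; have [u ua pu] := mup_factor p0 pm.
pose A := u * q * (m.+1%:R)%:P + (u^`() * q - u * q^`()) * ('X - a%:P).
have -> : wronskian p q = A * ('X - a%:P) ^+ m.
  rewrite /wronskian pu derivM deriv_exp derivXsubC mul1r /= /A.
  by rewrite exprSr -[_ *+ m.+1]mulr_natr polyC_natr; ring.
rewrite mupMr; first by rewrite mup_XsubCX eqxx.
by rewrite /A /root !hornerE subrr mulr0 addr0 !mulf_neq0 // pnatr_eq0.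
Qed.

Lemma root2_mup p a : p != 0 -> root p a -> root p^`() a -> (1 < mup a p)%N.
Proof.
move=> p0 /factor_theorem[q pq] dp; rewrite mup_geq //.
move: dp; rewrite pq derivM derivXsubC mulr1 /root !hornerE subrr mulr0 add0r.
move=> /factor_theorem[u ->]; by rewrite -mulrA -expr2 dvdp_mull.
Qed.

(** The coefficient in degree [m + n - 1] is [m - n] times the product of the leading coefficients,
    nonzero because [n < m]. *)
Lemma size_wronskian p q m n : size p = m.+1 -> size q = n.+1 -> (n < m)%N -> (0 < n)%N ->
  size (wronskian p q) = (m + n)%N.
Proof.
move=> sp sq nm n0.
have lp : p`_m != 0 by have := lead_coef_eq0 p; rewrite lead_coefE sp /= => ->; rewrite -size_poly_eq0 sp.
have lq : q`_n != 0 by have := lead_coef_eq0 q; rewrite lead_coefE sq /= => ->; rewrite -size_poly_eq0 sq.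
have sdp : (size p^`() <= m)%N by have := lt_size_deriv (_ : p != 0); rewrite sp ltnS; apply; rewrite -size_poly_eq0 sp.
have sdq : (size q^`() <= n)%N by have := lt_size_deriv (_ : q != 0); rewrite sq ltnS; apply; rewrite -size_poly_eq0 sq.
have dp : p^`()`_m.-1 = p`_m *+ m by rewrite coef_deriv prednK // (leq_ltn_trans _ nm).
have dq : q^`()`_n.-1 = q`_n *+ n by rewrite coef_deriv prednK.
have top (u v : {poly K}) i j : (size u <= i.+1)%N -> (size v <= j.+1)%N ->
    (u * v)`_(i + j) = u`_i * v`_j.
  move=> su sv; rewrite coefM (bigD1 (Ordinal (leq_addr j i : (i < (i + j).+1)%N))) //=.
  rewrite addKn big1 ?addr0 // => k /eqP ki.
  have [ik|ki'|E] := ltngtP i k; last by exfalso; apply: ki; apply: val_inj.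
    by rewrite nth_default ?mul0r // (leq_trans su).
  rewrite [v`_ _]nth_default ?mulr0 // (leq_trans sv) //.
  by have := ltn_ord k; lia.
apply/eqP; rewrite eqn_leq; apply/andP; split.
  apply: leq_trans (size_polyD _ _) _; rewrite size_polyN geq_max.
  apply/andP; split; apply: leq_trans (size_polyMleq _ _) _; rewrite ?sp ?sq.
    by move: sdp; move: (size _) => s; lia.
  by move: sdq; move: (size _) => s; lia.
have : (wronskian p q)`_(m.-1 + n) != 0.
  rewrite coefB top ?sq ?prednK //; try lia.
  have -> : (m.-1 + n = m + n.-1)%N by lia.
  rewrite top ?sp ?prednK // dp dq.
  rewrite -mulr_natr -[q`_n *+ n]mulr_natr.
  have -> : p`_m * m%:R * q`_n - p`_m * (q`_n * n%:R) = p`_m * q`_n * (m%:R - n%:R) by ring.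
  by rewrite !mulf_neq0 // subr_eq0 eqr_nat; lia.
by apply: contraNleq => H; rewrite nth_default //; move: H; move: (size _) => s; lia.
Qed.

(* The Wronskian of p and q has degree m + n - 1, and its only roots are 0,
   of multiplicity n, and 1. *)
Lemma mup_unicritical p q w m n : size p = m.+1 -> size q = n.+1 -> (n < m)%N -> (0 < n)%N ->
  ~~ root q 0 -> ~~ root q 1 -> mup 0 p = n.+1 ->
  (0 < mup 1 (p - w *: q))%N ->
  (forall a, root (wronskian p q) a -> a = 0 \/ a = 1) ->
  mup 1 (p - w *: q) = m.
Proof.
move=> sp sq nm n0 q0 q1 p0 p1 W01; set W := wronskian p q.
have sW : size W = (m + n)%N by apply: size_wronskian.
have pn0 : p != 0 by rewrite -size_poly_eq0 sp.
have W0 : mup 0 W = n by apply: mup_wronskian.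
have spw : size (p - w *: q) = m.+1.
  rewrite size_polyDl ?sp // size_polyN ltnS.
  by apply: leq_trans (size_scale_leq _ _) _; rewrite sq.
have pwn0 : p - w *: q != 0 by rewrite -size_poly_eq0 spw.
(* Replacing [p] by [p - w *: q] leaves the Wronskian unchanged, so its order at 1 is one less than
   the multiplicity sought. *)
have WE : W = wronskian (p - w *: q) q.
  by rewrite /W /wronskian derivB derivZ !mulrBl -!scalerAl; rewrite [q * _]mulrC; ring.
have W1 : mup 1 W = (mup 1 (p - w *: q)).-1.
  by rewrite WE; apply: mup_wronskian => //; rewrite prednK.
have [rs Wrs] := closed_field_poly_normal W.
have Wn0 : W != 0 by rewrite -size_poly_eq0 sW; lia.
have lW : lead_coef W != 0 by rewrite lead_coef_eq0.
have mupW a : mup a W = count_mem a rs.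
  rewrite Wrs -mul_polyC mupMr ?mu_prod_XsubC //.
  by rewrite rootC.
have srs : size rs = (m + n).-1.
  by rewrite -sW Wrs size_scale // size_prod_XsubC.
have rsE : size rs = (count_mem (0%R : K) rs + count_mem (1%R : K) rs)%N.
  rewrite -[LHS](count_predT rs) -count_predUI.
  have -> : count (predI (pred1 (0 : K)) (pred1 (1 : K))) rs = 0%N.
    apply/eqP; rewrite -leqn0 leqNgt -has_count; apply/hasPn => a _ /=.
    by apply/andP => -[/eqP -> ]; rewrite eq_sym oner_eq0.
  rewrite addn0; apply: eq_in_count => a ars /=; apply/esym.
  have : root W a by rewrite Wrs rootZ // root_prod_XsubC.
  by move=> /W01[]->; rewrite eqxx ?orbT.
move: rsE; rewrite srs -!mupW W0 W1; lia.
Qed.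

End Wronskian.

(** * Order of contact of the iterates at the critical point *)

Section Iterates.
Variable R : realType.
Local Notation C := (cplx R).
Implicit Types (f : ratmap R) (p q : {poly C}) (a z w : C).

Lemma holo_horner p z : holo_at (fun w => p.[w]) z.
Proof.
elim/poly_ind: p => [|p c IH].
  have -> : (fun w : C => (0 : {poly C}).[w]) = fun=> 0 by apply/funext => w; rewrite horner0.
  exact: holo_cst.
have -> : (fun w => (p * 'X + c%:P).[w]) = fun w => p.[w] * w + c.
  by apply/funext => w; rewrite hornerMXaddC.
by apply: holoD; [apply: holoM => //; exact: holo_id | exact: holo_cst].
Qed.

Lemma reval_finite f a b : reval f (Some a) = Some b ->
  (rden f).[a] != 0 /\ b = (rnum f).[a] / (rden f).[a].
Proof. by rewrite /reval; case: eqVneq => // d0 [<-]. Qed.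

Lemma reval_near f a b : reval f (Some a) = Some b -> exists L r : R, [/\ 0 < L, 0 < r &
  forall z, `‖z - a‖ < r -> exists w, reval f (Some z) = Some w /\ `‖w - b‖ <= L * `‖z - a‖].
Proof.
move=> /reval_finite[d0 ->].
have hR : holo_at (fun z => (rnum f).[z] * ((rden f).[z])^-1) a.
  by apply: holoM; [exact: holo_horner | apply: holoV => //; exact: holo_horner].
have [l dl] := hR; have [r r0 rP] := dl _ ltr01.
have [s s0 sP] := cts_neq0 (holo_cts (holo_horner (rden f) a)) d0.
exists (`‖l‖ + 1), (Num.min r s); split; [have := modulus_ge0 l; lra | by rewrite lt_min r0 |].
move=> z; rewrite lt_min => /andP[zr zs].
exists ((rnum f).[z] / (rden f).[z]); rewrite /reval (negbTE (sP z zs)); split=> //.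
have := rP z zr; set A := (rnum f).[z] * _ - _ => H.
have := modulusD (A - l * (z - a)) (l * (z - a)); rewrite subrK modulusM; lra.
Qed.

Lemma reval_contact f a b d : reval f (Some a) = Some b ->
  (d <= local_degree f (Some a))%N -> exists L r : R, [/\ 0 < L, 0 < r &
  forall z, `‖z - a‖ < r -> exists w, reval f (Some z) = Some w /\ `‖w - b‖ <= L * `‖z - a‖ ^+ d].
Proof.
move=> fa; rewrite /local_degree fa; have [d0 bE] := reval_finite fa => dm.
set p := rnum f - b *: rden f in dm.
have [q pq] : exists q, p = q * ('X - a%:P) ^+ d.
  have [p0|p0] := eqVneq p 0; first by exists 0; rewrite p0 mul0r.
  by move: dm; rewrite mup_geq // => /dvdpP[q ->]; exists q.
have hR : holo_at (fun z => q.[z] * ((rden f).[z])^-1) a.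
  by apply: holoM; [exact: holo_horner | apply: holoV => //; exact: holo_horner].
have [r r0 rP] := holo_cts hR ltr01.
have [s s0 sP] := cts_neq0 (holo_cts (holo_horner (rden f) a)) d0.
set A := q.[a] * _ in rP; have A0 := modulus_ge0 A.
exists (`‖A‖ + 1), (Num.min r s); split; [lra | by rewrite lt_min r0 |].
move=> z; rewrite lt_min => /andP[zr zs]; have dz := sP z zs.
exists ((rnum f).[z] / (rden f).[z]); rewrite /reval (negbTE dz); split=> //.
have E : (rnum f).[z] - b * (rden f).[z] = q.[z] * (z - a) ^+ d.
  have := congr1 (fun p : {poly C} => p.[z]) pq.
  by rewrite /p !hornerE.
have -> : (rnum f).[z] / (rden f).[z] - b = (q.[z] * ((rden f).[z])^-1) * (z - a) ^+ d.
  by rewrite mulrAC -E; field.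
rewrite modulusM modulusX; apply: ler_wpM2r; first by rewrite exprn_ge0 // modulus_ge0.
have := rP z zr; set B := q.[z] * _ => H.
by have := modulusD (B - A) A; rewrite subrK; lra.
Qed.

(* The contact of order d at the critical point persists along the finite
   orbit, since f is Lipschitz near each of its points. *)
Lemma iter_contact f (c : int -> C) d : (0 < d)%N ->
  (forall j, reval f (Some (c j)) = Some (c (j + 1))) ->
  (d <= local_degree f (Some (c 0)))%N ->
  forall j, (0 < j)%N -> exists L r : R, [/\ 0 < L, 0 < r &
    forall z, `‖z - c 0‖ < r -> exists w, iter j (reval f) (Some z) = Some w /\
      `‖w - c j%:Z‖ <= L * `‖z - c 0‖ ^+ d].
Proof.
move=> d0 fc dm; elim=> // j IH _; case: j IH => [_|j /(_ isT)].
  by have := reval_contact (fc 0) dm; rewrite add0r.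
move=> [L [r [L0 r0 rP]]].
have [L' [r' [L'0 r'0 r'P]]] := reval_near (fc j.+1%:Z).
have LL : 0 < L' * L by rewrite mulr_gt0.
(* The bound by 1 makes the [d]-th power of the distance at most the distance itself, and [r' / L]
   then keeps the image where the next step is Lipschitz. *)
exists (L' * L), (Num.min r (Num.min 1 (r' / L))); split => //.
  by rewrite !lt_min r0 ltr01 divr_gt0.
move=> z; rewrite !lt_min => /andP[zr /andP[z1 zL]].
have [w [wz wc]] := rP z zr; have t0 := modulus_ge0 (z - c 0).
have tle : `‖z - c 0‖ ^+ d <= `‖z - c 0‖.
  by case: (d) d0 => // n _; rewrite exprS ler_piMr // exprn_ile1 // ltW.
have wr : `‖w - c j.+1%:Z‖ < r'.
  apply: (le_lt_trans wc); apply: (@le_lt_trans _ _ (L * `‖z - c 0‖)).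
    by rewrite ler_pM2l.
  by move: zL; rewrite ltr_pdivlMr // mulrC.
have [w' [ww' w'c]] := r'P w wr; exists w'; split; first by rewrite iterS wz.
rewrite -[j.+2]addn1 PoszD; apply: (le_trans w'c).
by rewrite -mulrA ler_pM2l.
Qed.

(** At [z = x + u] with small [u > 0], order [n] makes the left side comparable to [u^n], which
    cannot stay below [L * u^d] when [n < d]. *)
Lemma order_at_contact g x n d (L r : R) : 0 < r ->
  (forall z, `‖z - x‖ < r -> `‖g z - g x‖ <= L * `‖z - x‖ ^+ d) ->
  order_at g x n -> (d <= n)%N.
Proof.
move=> r0 gL [h [s [s0 hh h0 hE]]]; rewrite leqNgt; apply/negP => nd.
have hc : cts h x by apply: holo_cts; apply: hh; rewrite subrr modulus0.
have hp : 0 < `‖h x‖ by rewrite modulus_gt0.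
have h2 : 0 < `‖h x‖ / 2 by lra.
have [t t0 tP] := hc _ h2.
pose L1 := `|L| + 1; have L10 : 0 < L1 by rewrite /L1; have := normr_ge0 L; lra.
have [|u u0 /and5P[ur us ut u1 /andP[uL _]]] :=
    @exists_pos_lt R [:: r; s; t; 1; `‖h x‖ / 2 / L1].
  by rewrite /= r0 s0 t0 ltr01 divr_gt0.
rewrite ltr_pdivlMr // mulrC in uL.
have hu : `‖x + ofR u - x‖ = u by rewrite modulus_shift.
have un : 0 < u ^+ n by rewrite exprn_gt0.
have := gL (x + ofR u); rewrite hE ?hu // modulusM modulusX hu => /(_ ur).
rewrite -(subnKC (ltnW nd)) exprD mulrCA ler_pM2l // => H.
have ud : u ^+ (d - n) <= u.
  have : (0 < d - n)%N by rewrite subn_gt0.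
  case: (d - n)%N => // k _; rewrite exprS ler_piMr ?exprn_ile1 //; exact: ltW.
have ud0 : 0 <= u ^+ (d - n) by rewrite exprn_ge0 // ltW.
have LL1 : L <= L1 by rewrite /L1; have := ler_norm L; lra.
have : L * u ^+ (d - n) <= L1 * u by apply: le_trans (ler_wpM2r ud0 LL1) _; rewrite ler_pM2l.
have := tP (x + ofR u); rewrite hu => /(_ ut).
by have := modulus_dist (h x) (h (x + ofR u)); rewrite (modulusBC (h x)); lra.
Qed.

End Iterates.

(** * Precompactness of maps in normal form and geometry of the rescaled disks *)

Section Precompactness.
Variable R : realType.
Local Notation C := (cplx R).
Local Notation D := (@diskset R).
Implicit Types (phi k psi l : C -> C) (a b x y z w : C) (U V : set C) (G : nat -> Defs.pmap R).

Definition has_normal_form d (g : Defs.pmap R) :=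
  exists phi k psi l, normal_pmap d g phi k psi l.

(** Fixed discs inside and around all domains, and likewise all ranges, give limits of both families
    of Riemann maps along [omega]; one common subsequence then converges locally uniformly. *)
Lemma normal_precompact d G x y (r M : R) : (0 < d)%N -> 0 < r ->
  (forall n, has_normal_form d (G n)) ->
  (forall n, pbase (G n) = x) -> (forall n, ptgt (G n) = y) ->
  (forall n z, `‖z - x‖ < r -> pdom (G n) z) -> (forall n z, pdom (G n) z -> `‖z - x‖ < M) ->
  (forall n z, `‖z - y‖ < r -> pran (G n) z) -> (forall n z, pran (G n) z -> `‖z - y‖ < M) ->
  exists t g, [/\ increasing t, has_normal_form d g & pmap_cvg (G \o t) g].
Proof.
move=> d0 r0 GN Gx Gy xr xM yr yM.
have /choice[T TP] : forall n, exists T : (C -> C) * (C -> C) * ((C -> C) * (C -> C)),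
    normal_pmap d (G n) T.1.1 T.1.2 T.2.1 T.2.2.
  by move=> n; have [phi [k [psi [l N]]]] := GN n; exists ((phi, k), (psi, l)).
pose phin n := (T n).1.1; pose kn n := (T n).1.2.
pose psin n := (T n).2.1; pose ln n := (T n).2.2.
have N n : normal_pmap d (G n) (phin n) (kn n) (psin n) (ln n) := TP n.
have bphin n : bihol D (pdom (G n)) (phin n) (kn n) by case: (N n).
have bpsin n : bihol D (pran (G n)) (psin n) (ln n) by case: (N n).
have phin0 n : phin n 0 = x by case: (N n) => _ _ -> _ _.
have psin0 n : psin n 0 = y by case: (N n) => _ _ _ -> _.
have [phi [k [bphi phi0 hphi]]] := ultra_limit_bihol (F := @omega) r0 bphin phin0 xr xM.
have [psi [l [bpsi psi0 hpsi]]] := ultra_limit_bihol (F := @omega) r0 bpsin psin0 yr yM.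
have [|t inct [tphi tpsi]] := luc_subsequence (F := @omega) _ hphi hpsi.
  by move=> P; apply: near_omega.
pose g := PMap (phi @` D) x (psi @` D) y (fun v => psi (k v ^+ d)).
have gN : normal_pmap d g phi k psi l.
  split=> // z Dz /=; have [_ [kphi _]] := bphi; by rewrite kphi.
exists t, g; split=> //; first by exists phi, k, psi, l.
apply: (normal_pmap_cvg d0 (fun n => N (t n)) gN) => // n /=.
Qed.

Lemma cara_cvg_subseq (Un : nat -> set C) un U u t : increasing t ->
  cara_cvg Un un U u -> cara_cvg (Un \o t) (un \o t) U u.
Proof.
move=> inct [cu cK cW]; split.
- move=> P /cu [N _ NP]; exists N => // n /= Nn; apply: NP => /=.
  exact: leq_trans Nn (increasing_ge _ inct).
- move=> K cpK KU; have [N _ NP] := cK K cpK KU; exists N => // n /= Nn; apply: NP => /=.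
  exact: leq_trans Nn (increasing_ge _ inct).
- move=> W oW conW Wu WU; apply: cW => // N; have [n Nn Wn] := WU N.
  by exists (t n) => //; apply: leq_trans Nn (increasing_ge _ inct).
Qed.

Lemma uniform_tends (K : set C) (h : nat -> C -> C) f z : K z ->
  {uniform K, h @ \oo --> f} -> tends \oo (fun n => h n z) (f z).
Proof.
move=> Kz hf; apply: (iffLR (@tendsP R nat \oo _ (fun n => h n z) (f z))).
exact: (@uniform_cvg_point C K h f z Kz hf).
Qed.

(** About [g] nothing is known beyond being a Carathéodory limit. By uniqueness it has the same
    disks and marked points as the limit [g'] of a subsequence, and the same values on the domain,
    so the Riemann maps of [g'] serve for [g]. *)
Lemma pmap_limit_normal d G t (g g' : Defs.pmap R) : (0 < d)%N -> increasing t ->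
  is_pmap g -> pmap_cvg G g -> has_normal_form d g' -> pmap_cvg (G \o t) g' ->
  has_normal_form d g.
Proof.
move=> d0 inct [dg rg _ _] [cd cr cf] [phi [k [psi [l gN]]]] [cd' cr' cf'].
have [dg' rg' _ _] := normal_is_pmap d0 gN.
have {}cd := cara_cvg_subseq inct cd; have {}cr := cara_cvg_subseq inct cr.
have be : pbase g = pbase g'.
  by case: cd => + _ _; case: cd' => + _ _ => h1 h2; exact: (@cvg_unique_seq R _ _ _ h2 h1).
have te : ptgt g = ptgt g'.
  by case: cr => + _ _; case: cr' => + _ _ => h1 h2; exact: (@cvg_unique_seq R _ _ _ h2 h1).
have de : pdom g = pdom g'.
  apply/seteqP; split; first exact: cara_subset dg cd cd' be.
  exact: cara_subset dg' cd' cd (esym be).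
have re : pran g = pran g'.
  apply/seteqP; split; first exact: cara_subset rg cr cr' te.
  exact: cara_subset rg' cr' cr (esym te).
have fe z : pdom g z -> pfun g z = pfun g' z.
  move=> gz; have c1 : compact [set z] := @compact_set1 _ z.
  have s1 : [set z] `<=` pdom g by move=> w ->.
  have s2 : [set z] `<=` pdom g' by rewrite -de.
  have t1 := uniform_tends (erefl z : [set z] z) (cf _ c1 s1).
  have t2 := uniform_tends (erefl z : [set z] z) (cf' _ c1 s2).
  apply: tends_unique t2 => e e0; have [N _ NP] := t1 e e0.
  exists N => // n /= Nn; apply: (NP (t n)) => /=.
  exact: leq_trans Nn (increasing_ge _ inct).
have [b1 b2 p1 p2 E] := gN.
exists phi, k, psi, l; split; rewrite ?de ?re ?be ?te // => z Dz.
by rewrite fe ?E // de; case: b1 => -[_ _ + _] _; apply.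
Qed.

Lemma affine_normK a b z : a != b -> affine_norm_inv a b (affine_norm a b z) = z.
Proof.
rewrite eq_sym -subr_eq0 => ab; rewrite /affine_norm_inv /affine_norm; by field.
Qed.

Lemma affine_norm_invK a b z : a != b -> affine_norm a b (affine_norm_inv a b z) = z.
Proof.
rewrite eq_sym -subr_eq0 => ab; rewrite /affine_norm_inv /affine_norm; by field.
Qed.

Lemma bihol_affine U phi k a b : a != b -> bihol D U phi k ->
  bihol D (affine_norm a b @` U) (affine_norm a b \o phi) (k \o affine_norm_inv a b).
Proof.
move=> ab [[phiD kU DU UD] [kphi phik]]; split; first split.
- move=> z Dz; apply: holoM; last exact: holo_cst.
  exact: (holo_subc a (phiD z Dz)).
- move=> _ [z Uz <-]; apply: (@holo_comp R (affine_norm_inv a b) k).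
    apply: holoD; first exact: holo_cst.
    by apply: holoM; [exact: holo_cst | exact: holo_id].
  by rewrite affine_normK //; apply: kU.
- by move=> z Dz; exists (phi z) => //; apply: DU.
- by move=> _ [z Uz <-]; rewrite /= affine_normK //; apply: UD.
split=> [z Dz|_ [z Uz <-]] /=; first by rewrite affine_normK // kphi.
by rewrite affine_normK // phik.
Qed.

Lemma affine_modulus a b c z : `‖affine_norm a b z - affine_norm a b c‖ = `‖z - c‖ / `‖b - a‖.
Proof.
rewrite -modulusV -modulusM; congr modulus.
by rewrite /affine_norm -mulrBl; congr (_ * _); ring.
Qed.

Lemma rescaled_normal d a b U V F phi k psi l : (0 < d)%N -> a != b ->
  bihol D U phi k -> phi 0 = a -> bihol D V psi l -> psi 0 = b ->
  (forall z, D z -> F (phi z) = psi (z ^+ d)) ->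
  has_normal_form d (rescaled a b U V F).
Proof.
move=> d0 ab bphi phi0 bpsi psi0 FE.
exists (affine_norm a b \o phi), (k \o affine_norm_inv a b),
  (affine_norm a b \o psi), (l \o affine_norm_inv a b); split => /=.
- exact: bihol_affine.
- exact: bihol_affine.
- by rewrite phi0 /affine_norm subrr mul0r.
- by rewrite psi0 /affine_norm divff // subr_eq0 eq_sym.
- by move=> z Dz; rewrite affine_normK // FE.
Qed.

Section Geometry.
Variables (K : R) (U : set C) (x : C) (delta : R).
Hypotheses (K0 : 0 < K) (oU : opn U) (Ux : U x).
Hypothesis dU : diameter_comparable K U delta.

Lemma diameter_ge p q : U p -> U q -> ((`‖p - q‖)%:E <= diameter U)%E.
Proof. by move=> Up Uq; apply: ereal_sup_ubound; exists (p, q). Qed.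

Lemma diameter_dist_le z : U z -> `‖z - x‖ <= K * delta.
Proof.
move=> Uz; have [d1 _] := dU; rewrite -lee_fin EFinM.
exact: le_trans (diameter_ge Uz Ux) d1.
Qed.

(** A nonempty open set has positive diameter, so comparability forces [delta] to be positive. This
    is what separates [c_0] from [c_(q_n)] and makes the rescaling invertible. *)
Lemma diameter_gt0 : 0 < delta.
Proof.
have [r r0 rU] := oU Ux; pose z := x + ofR (r / 2).
have zx : `‖z - x‖ = r / 2 by rewrite /z modulus_shift //; lra.
have Uz : U z by apply: rU; rewrite zx; lra.
have := diameter_dist_le Uz; rewrite zx => H.
have : 0 < K * delta by lra.
by rewrite pmulr_rgt0.
Qed.

(** If the inner radius were at most [r0 = delta / (4 K^2)], the outer radius would be at most
    [K r0]. With the factor 3/2 as margin for the infimum, the diameter would be at most [3 K r0],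
    and [delta] at most [3 K^2 r0], which is only three quarters of [delta]. *)
Lemma bounded_shape_disc : bounded_shape K U x -> disc x (delta / (4 * K ^+ 2)) `<=` U.
Proof.
move=> bs; have delta0 := diameter_gt0; have [_ d2] := dU.
pose r0 := delta / (4 * K ^+ 2).
have K2 : 0 < 4 * K ^+ 2 by rewrite mulr_gt0 // exprn_gt0.
have r00 : 0 < r0 by rewrite divr_gt0.
have [ir|ir] := leP (inner_radius U x) r0%:E; last first.
  have [_ [r rU <-]] := ereal_sup_gt ir; rewrite lte_fin => rr z zr.
  by apply: rU; rewrite /disc /= in zr *; apply: lt_trans zr rr.
exfalso.
have : (outer_radius U x <= (K * r0)%:E)%E.
  by apply: (le_trans bs); rewrite EFinM lee_pmul2l // lte_fin.
have Kr : 0 < K * r0 by rewrite mulr_gt0.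
move=> ho; have /ereal_inf_lt[_ [r rU <-]] : (outer_radius U x < (3 / 2 * (K * r0))%:E)%E.
  by apply: (le_lt_trans ho); rewrite lte_fin; lra.
rewrite lte_fin => rr.
have dm : (diameter U <= (2 * r)%:E)%E.
  apply: ge_ereal_sup => _ [[p q] [Up Uq] <-]; rewrite lee_fin /=.
  have := rU p Up; have := rU q Uq; rewrite /disc /=.
  by have := modulus_le_triangle p x q; rewrite (modulusBC x q); lra.
have : (delta%:E <= (K * (2 * r))%:E)%E.
  by apply: (le_trans d2); rewrite EFinM lee_pmul2l // lte_fin.
rewrite lee_fin => H.
have : K * (2 * r) < K * (3 * (K * r0)) by rewrite ltr_pM2l //; lra.
have -> : K * (3 * (K * r0)) = 3 / 4 * delta by rewrite /r0; field; rewrite gt_eqF.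
lra.
Qed.

End Geometry.

Lemma rescaled_disc_sub (a b c : C) U (delta r : R) : a != b -> `‖b - a‖ = delta ->
  disc c (delta * r) `<=` U ->
  forall z, `‖z - affine_norm a b c‖ < r -> (affine_norm a b @` U) z.
Proof.
move=> ab dE cU z zr; exists (affine_norm_inv a b z); last by rewrite affine_norm_invK.
apply: cU; rewrite /disc /=.
have ba : 0 < `‖b - a‖ by rewrite modulus_gt0 subr_eq0 eq_sym.
rewrite -(affine_norm_invK z ab) affine_modulus dE ltr_pdivrMr -?dE // in zr.
by rewrite mulrC -dE.
Qed.

Lemma rescaled_sub_disc (a b c : C) U (K delta : R) : a != b -> `‖b - a‖ = delta ->
  (forall z, U z -> `‖z - c‖ <= K * delta) ->
  forall z, (affine_norm a b @` U) z -> `‖z - affine_norm a b c‖ < K + 1.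
Proof.
move=> ab dE Uc _ [z Uz <-]; rewrite affine_modulus dE.
have ba : 0 < delta by rewrite -dE modulus_gt0 subr_eq0 eq_sym.
by rewrite ltr_pdivrMr // mulrDl mul1r; have := Uc z Uz; lra.
Qed.

(** The fibre of [g x] has total multiplicity [d], and [x] uses it up. Any other point of the fibre
    would carry multiplicity 0, but order 0 at [z] reads [0 = h z] with [h z] nonzero. *)
Lemma branched_cover_total_order d U V g x : branched_cover d U V g -> U x -> 
  (forall n, order_at g x n -> (d <= n)%N) ->
  order_at g x d /\ forall z, U z -> g z = g x -> z = x.
Proof.
move=> [_ UV _ fib] Ux dx; have [s [m [us sP sm sd]]] := fib _ (UV x Ux).
have xs : x \in s by apply/sP.
have ox := iffLR (holo_degreeP _ _ _) (sm x xs).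
have dm := dx _ ox.
rewrite (bigD1_seq x) //= in sd.
have mx : m x = d by lia.
rewrite -{1}mx; split=> // z Uz gz; apply/eqP; apply: contrapT => /negP zx.
have zs : z \in s by apply/sP.
have : (\sum_(i <- s | i != x) m i)%N = 0%N.
  by move/eqP: sd; rewrite mx -[X in _ == X]addn0 eqn_add2l => /eqP.
move/eqP; rewrite sum_nat_seq_eq0 => /allP /(_ z zs) /=; rewrite zx => /eqP mz.
have := iffLR (holo_degreeP _ _ _) (sm z zs); rewrite mz => -[h [r [r0 _ h0 hE]]].
have := hE z; rewrite !subrr modulus0 mul1r => /(_ r0) hz.
by rewrite -hz eqxx in h0.
Qed.

Lemma pointed_disk_riemann U x (M : R) : pointed_disk U x ->
  (forall z, U z -> `‖z - x‖ < M) -> exists phi k, bihol D U phi k /\ phi 0 = x.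
Proof.
move=> /pointed_disk_topdisk[oU Ux [h [k hk]]] UM.
apply: (riemann_mapping oU (conn_topdisk hk) Ux UM) => u.
exact: topdisk_sqrt hk.
Qed.

Lemma unicritical_local_degree d0 dinf theta f (H : set C) c1 : (2 <= d0)%N -> (2 <= dinf)%N ->
  in_X d0 dinf theta f H -> unicritical f -> reval f (Some 1) = Some c1 ->
  local_degree f (Some 1) = (d0 + dinf - 1)%N.
Proof.
move=> d02 dinf2 [fdeg [f0 l0 fi li] _ _ _] uf f1.
have [q0 p0E] := reval_finite f0; have [q1 p1E] := reval_finite f1.
have p00 : (rnum f).[0] = 0 by move/eqP: p0E; rewrite eq_sym mulf_eq0 invr_eq0 (negbTE q0) orbF => /eqP.
rewrite /local_degree f0 scale0r subr0 in l0.
rewrite /local_degree fi fdeg in li.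
(* The local degree [dinf] at infinity is [d0 + dinf - 1] minus the degree of the denominator. *)
have sq : size (rden f) = (d0.-1).+1.
  have : size (rden f) != 0%N by rewrite size_poly_eq0; apply: contraNneq q0 => ->; rewrite horner0.
  by move: li; move: (size (rden f)) => s; lia.
have sp : size (rnum f) = (d0 + dinf - 1).+1.
  by move: fdeg; rewrite /rdeg sq /maxn; case: ifP; move: (size (rnum f)) => s; lia.
have pn0 b : rnum f - b *: rden f != 0.
  rewrite -size_poly_eq0 size_polyDl ?sp // size_polyN ltnS.
  apply: leq_trans (size_scale_leq _ _) _; rewrite sq; lia.
rewrite /local_degree f1.
have n0 (b : C) : b <> 0 -> Some b <> Some 0 :> sphere R by move=> b0 [].
have nN (b : C) : Some b <> None :> sphere R by [].
have one0 : (1 : C) <> 0 by apply/eqP; rewrite oner_eq0.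
have c1crit : critical f (Some 1) by apply: (iffRL (uf (Some 1) (n0 1 one0) (nN 1))).
apply: (@mup_unicritical C _ _ _ _ d0.-1 sp sq) => //; try lia.
- by rewrite l0; lia.
- by move: c1crit; rewrite /critical /local_degree f1 /= => /ltnW.
move=> a Wa; have [a0|/eqP a0] := eqVneq a 0; [by left | right].
suff ac : critical f (Some a) by have [] := iffLR (uf (Some a) (n0 a a0) (nN a)) ac.
move: Wa; rewrite /wronskian /root !hornerE => /eqP Wa.
(* At a pole the fibre equation is the denominator, elsewhere it is the numerator minus [f(a)] times
   the denominator; in both cases the vanishing Wronskian makes [a] a root of its derivative too. *)
rewrite /critical /local_degree /reval; case: eqVneq => da.
  have na : (rnum f).[a] != 0.
    by apply: (@coprimep_root _ (rden f)); [rewrite coprimep_sym; exact: rcoprime | apply/eqP].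
  apply: root2_mup.
  - by rewrite -size_poly_eq0 sq.
  - exact/eqP.
  - move/eqP: Wa; rewrite da mulr0 sub0r oppr_eq0 mulf_eq0 (negbTE na) /=.
    by [].
apply: root2_mup; first exact: pn0.
- by rewrite /root !hornerE divfK // subrr.
- rewrite /root derivB derivZ !hornerE; apply/eqP; apply: (mulIf da).
  by rewrite mul0r mulrBl -Wa; field.
Qed.

End Precompactness.

Theorem corollary10p3 (R : realType) (d0 dinf : nat) (theta : R)
    (f : ratmap R) (H : set (cplx R)) (c : int -> cplx R)
    (U V : nat -> set (cplx R)) (K : R) :
  let d := (d0 + dinf - 1)%N in
  let q := cf_denom theta in
  let F := fun (n : nat) (z : cplx R) =>
    finite_part (iter (q n) (reval f) (Some z)) in
  let delta := fun n : nat => modulus (c 0 - c (q n)%:Z) in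
  (2 <= d0)%N -> (2 <= dinf)%N ->
  0 < theta < 1 -> irrational theta -> bounded_type theta ->
  in_X d0 dinf theta f H -> unicritical f ->
  orbit_on f H 1 c ->
  0 < K ->
  (forall n, pointed_disk (U n) (c 0)) ->
  (forall n, pointed_disk (V n) (c (q n)%:Z)) ->
  (forall n z, U n z -> iter (q n) (reval f) (Some z) <> None) ->
  (forall n, branched_cover d (U n) (V n) (F n)) ->
  (forall n, bounded_shape K (U n) (c 0)) ->
  (forall n, bounded_shape K (V n) (c (q n)%:Z)) ->
  (forall n, diameter_comparable K (U n) (delta n)) ->
  (forall n, diameter_comparable K (V n) (delta n)) ->
  let G := fun n : nat =>
    rescaled (c 0) (c (q n)%:Z) (U n) (V n) (F n) in
  cara_precompact G /\
  (forall g, limit_map G g ->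
     branched_cover d (pdom g) (pran g) (pfun g) /\
     branched_only_at (pdom g) (pfun g) 0).
Proof.
move=> d q F delta d02 dinf2 _ _ _ fX funi [c0 _ fc] K0 Udisk Vdisk _ FUV Ush Vsh Ud Vd G.
have dpos : (0 < d)%N by rewrite /d; lia.
have dgt1 : (1 < d)%N by rewrite /d; lia.
have ld : (d <= local_degree f (Some (c 0)))%N.
  rewrite c0 (unicritical_local_degree d02 dinf2 fX funi (c1 := c 1)) //.
  by have := fc 0; rewrite add0r c0.
have U_opn n := pointed_disk_topdisk (Udisk n).
have V_opn n := pointed_disk_topdisk (Vdisk n).
have delta0 n : 0 < delta n.
  by have [oU Uc _] := U_opn n; apply: diameter_gt0 K0 oU Uc (Ud n).
have ab n : c 0 != c (q n)%:Z.
  by rewrite -subr_eq0 -modulus_gt0; apply: delta0.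
have ba n : modulus (c (q n)%:Z - c 0) = delta n by rewrite modulusBC.
(* If [q n] were 0, the points [c 0] and [c (q n)] would coincide. With at least one iterate, the
   orbit passes through the critical point and picks up the contact of order [d]. *)
have q0 n : (0 < q n)%N.
  by rewrite lt0n; apply/eqP => q0; have := ab n; rewrite q0 eqxx.
(* Near [c 0] the iterates stay in the plane, so [finite_part] does not return its default value 0
   there. *)
have Fcontact n : exists L r : R, [/\ 0 < L, 0 < r, F n (c 0) = c (q n)%:Z &
    forall z, modulus (z - c 0) < r -> modulus (F n z - c (q n)%:Z) <= L * modulus (z - c 0) ^+ d].
  have [L [r [L0 r0 rP]]] := iter_contact dpos fc ld (q0 n).
  exists L, r; split=> // [|z zr].
    have cr : modulus (c 0 - c 0) < r by rewrite subrr modulus0.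
    have [w [wE]] := rP _ cr; rewrite subrr modulus0 expr0n gtn_eqF // mulr0 => wc.
    rewrite /F wE /=; apply/eqP; rewrite -subr_eq0 -modulus_eq0.
    by apply/eqP/le_anti; rewrite wc modulus_ge0.
  by have [w [wE wc]] := rP z zr; rewrite /F wE.
have GN n : has_normal_form d (G n).
  have [L [r [L0 r0 Fc FL]]] := Fcontact n.
  have [oU Uc _] := U_opn n; have [oV Vc _] := V_opn n.
  have UM z : U n z -> modulus (z - c 0) < K * delta n + 1.
    by move=> Uz; apply: le_lt_trans (diameter_dist_le Uc (Ud n) Uz) _; rewrite ltrDl.
  have VM z : V n z -> modulus (z - c (q n)%:Z) < K * delta n + 1.
    by move=> Vz; apply: le_lt_trans (diameter_dist_le Vc (Vd n) Vz) _; rewrite ltrDl.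
  have [phi [k [bphi phi0]]] := pointed_disk_riemann (Udisk n) UM.
  have [psi [l [bpsi psi0]]] := pointed_disk_riemann (Vdisk n) VM.
  have [Fd FV Fproper _] := FUV n.
  have FL' z : modulus (z - c 0) < r -> modulus (F n z - F n (c 0)) <= L * modulus (z - c 0) ^+ d.
    by rewrite Fc; apply: FL.
  have [od fibre] := branched_cover_total_order (FUV n) Uc (fun m => order_at_contact r0 FL').
  have Fh : holo_on (U n) (F n) by move=> z Uz; apply/holo_atP; apply: Fd.
  have fibre' z : U n z -> F n z = c (q n)%:Z -> z = c 0 by rewrite -Fc; apply: fibre.
  have [h [s [s0 hh h0 hE]]] := od.
  have local : exists h s, [/\ 0 < s, cts h (c 0), h (c 0) != 0 & forall z,
      modulus (z - c 0) < s -> F n z - c (q n)%:Z = (z - c 0) ^+ d * h z].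
    exists h, s; split=> // [|z zs]; last by rewrite -Fc hE.
    by apply: holo_cts; apply: hh; rewrite subrr modulus0.
  have [psi' [l' [bpsi' psi'0 FE]]] :=
    normal_form dpos bphi phi0 bpsi psi0 Fh FV Fproper fibre' local.
  exact: rescaled_normal dpos (ab n) bphi phi0 bpsi' psi'0 FE.
have Gprecompact s : increasing s -> exists t g,
    [/\ increasing t, has_normal_form d g & pmap_cvg (G \o s \o t) g].
  (* The radius of [bounded_shape_disc] divided by [delta n], hence the same for all [n]. *)
  move=> _; pose rho := (4 * K ^+ 2)^-1.
  have rho0 : 0 < rho by rewrite invr_gt0 mulr_gt0 // exprn_gt0.
  have A0 n : affine_norm (c 0) (c (q n)%:Z) (c 0) = 0 by rewrite /affine_norm subrr mul0r.
  have A1 n : affine_norm (c 0) (c (q n)%:Z) (c (q n)%:Z) = 1.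
    by rewrite /affine_norm divff // subr_eq0 eq_sym.
  have GsN n : has_normal_form d ((G \o s) n) by apply: GN.
  apply: (@normal_precompact R d (G \o s) 0 1 rho (K + 1)) => // n z; rewrite /=.
  - have [oU Uc _] := U_opn (s n); rewrite -(A0 (s n)).
    apply: (rescaled_disc_sub (ab (s n)) (ba (s n))).
    exact: (bounded_shape_disc K0 oU Uc (Ud (s n)) (Ush (s n))).
  - have [oU Uc _] := U_opn (s n); rewrite -[X in modulus (_ - X)](A0 (s n)).
    apply: (rescaled_sub_disc (ab (s n)) (ba (s n))) => w Uw.
    exact: (diameter_dist_le Uc (Ud (s n)) Uw).
  - have [oV Vc _] := V_opn (s n); rewrite -(A1 (s n)).
    apply: (rescaled_disc_sub (ab (s n)) (ba (s n))).
    exact: (bounded_shape_disc K0 oV Vc (Vd (s n)) (Vsh (s n))).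
  - have [oV Vc _] := V_opn (s n); rewrite -[X in modulus (_ - X)](A1 (s n)).
    apply: (rescaled_sub_disc (ab (s n)) (ba (s n))) => w Vw.
    exact: (diameter_dist_le Vc (Vd (s n)) Vw).
split.
  move=> s incs; have [t [g [inct gN cg]]] := Gprecompact s incs.
  exists t, g; split=> //; have [phi [k [psi [l N]]]] := gN.
  exact: normal_is_pmap dpos N.
(* Precompactness is applied along the very subsequence that converges to [g]. *)
move=> g [gp [s incs cg]]; have [t [g' [inct gN cg']]] := Gprecompact s incs.
have [phi [k [psi [l N]]]] := pmap_limit_normal dpos inct gp cg gN cg'.
split; first exact: normal_branched_cover dpos N.
have <- : pbase g = 0.
  have [[+ _ _] _ _] := cg; have h : (fun=> (0 : cplx R)) @ \oo --> (0 : cplx R).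
    exact: cvg_cst_near.
  by move=> h'; exact: (@cvg_unique_seq R _ _ _ h' h).
exact: normal_branched_only_at dpos N dgt1.
Qed.
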